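(* Let $d\in\{1,2,3\}$. Let $u$ be the solution of $i\partial_tu=-\Delta u+\mu|u|^2u$ on $\mathbb{T}^d$, $u(0)=u_0$, let $T>0$ be smaller than its maximal existence time, and suppose $M_{2+d/4}<\infty$. Let $u^n$ be computed by the scheme sLRI2: $u^0=u_0$, $$u^1=e^{i\tau\Delta}u_0-i\mu\tau e^{i\tau\Delta}\bigl(u_0^2[\varphi_1(-2i\tau\Delta)-\varphi_2(-2i\tau\Delta)]\overline{u_0}\bigr)-i\mu\tau(e^{i\tau\Delta}u_0)^2\bigl[e^{i\tau\Delta}\varphi_2(-2i\tau\Delta)\overline{u_0}\bigr]-\mu^2\tfrac{\tau^2}{2}e^{i\tau\Delta}\bigl[|u_0|^4u_0\bigr],$$ and for $n\ge1$ $$\begin{aligned}u^{n+1}={}&e^{2i\tau\Delta}u^{n-1}-2i\mu\tau e^{i\tau\Delta}\bigl((u^n)^2[\mathrm{Re}\,\varphi_1(-2i\tau\Delta)-\mathrm{Re}\,\varphi_2(-2i\tau\Delta)]\overline{u^n}\bigr)\\&-i\mu\tau(e^{i\tau\Delta}u^n)^2\bigl[e^{i\tau\Delta}\varphi_2(-2i\tau\Delta)\overline{u^n}\bigr]\\&-i\mu\tau e^{2i\tau\Delta}\bigl((e^{-i\tau\Delta}u^n)^2\bigl[e^{-i\tau\Delta}\varphi_2(2i\tau\Delta)\overline{u^n}\bigr]\bigr).\end{aligned}$$ Then for all $0<\tau\le\tau_0$ with $\tau_0>0$ depending on $M_{2+d/4}$ and $T$, $$\|u(t_n)-u^n\|_{L^2}\le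 C(M_{2+d/4})\,\tau^2,\qquad0\le n\le T/\tau,\quad t_n=n\tau.$$
   Context: $\mathbb{T}^d$ is the $2\pi$-periodic torus, $\mu$ a nonzero real constant; $H^\delta=H^\delta(\mathbb{T}^d)$ is the periodic Sobolev space with norm $\|u\|_{H^\delta}^2=\sum_{\mathbf{k}\in\mathbb{Z}^d}(1+|\mathbf{k}|^2)^\delta|\hat u_{\mathbf{k}}|^2$. $M_\delta:=\sup_{0\le t\le T}\|u(t)\|_{H^\delta}$. $\varphi_1(z)=(e^z-1)/z$ and $\varphi_2(z)=(e^z-\varphi_1(z))/z$, extended continuously by $\varphi_1(0)=1$, $\varphi_2(0)=1/2$. Functions of $\Delta$ are Fourier multipliers: $f(\Delta)$ has symbol $f(-|\mathbf{k}|^2)$; $\mathrm{Re}\,\varphi_j(-2i\tau\Delta)$ has symbol $\mathrm{Re}\,\varphi_j(2i\tau|\mathbf{k}|^2)$. $C(M_\delta)$ denotes a positive constant depending on $M_\delta$ and on the fixed data ($T$, $\mu$, $d$), but independent of $\tau$ and $n$; likewise $\tau_0$ may depend on the fixed data. *)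

(* Defs.v *)
From HB Require Import structures.
From mathcomp Require Import all_boot all_order all_algebra.
From mathcomp Require Import all_classical all_reals all_analysis.
From mathcomp.real_closed Require Import complex.
Set Implicit Arguments.
Unset Strict Implicit.
Unset Printing Implicit Defensive.
Import Order.TTheory GRing.Theory Num.Theory.
Import numFieldNormedType.Exports.

Local Open Scope classical_set_scope.
Local Open Scope ring_scope.
Local Open Scope complex_scope.

(* The torus T^d = (R / 2 pi Z)^d is represented by its fundamental cell
   [0, 2 pi]^d, i.e. by d-tuples of reals with the product of d copies of the
   uniform probability on [0, 2 pi].  This is the Haar measure of T^d normalised
   to mass 1, for which the functions e^{i k . x} are orthonormal and the norm
   of H^0 is that of L^2. *)
Notation torus R d := (d.-tuple (measurableTypeR R)).

Section torus_measure.
Context {R : realType}.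

Lemma twopi_gt0 : 0 < 2 * pi :> R.
Proof. by rewrite mulr_gt0// pi_gt0. Qed.

Definition circle_prob : probability (measurableTypeR R) R :=
  uniform_prob twopi_gt0.

Definition tcons d (x : measurableTypeR R * torus R d) : torus R d.+1 :=
  [tuple of x.1 :: x.2].

Lemma measurable_tcons d : measurable_fun setT (@tcons d).
Proof. exact: measurable_cons. Qed.

HB.instance Definition _ d :=
  isMeasurableFun.Build _ _ _ _ (@tcons d) (@measurable_tcons d).

Fixpoint torus_prob (d : nat) : probability (torus R d) R :=
  if d is d'.+1 then
    distribution (circle_prob \x torus_prob d')%E (@tcons d')
  else dirac [tuple].

End torus_measure.

Section fourier.
Context {R : realType} {d : nat}.
Implicit Types (f g : torus R d -> R[i]) (k : 'rV[int]_d).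

Definition cexp (z : R[i]) : R[i] :=
  (expR (complex.Re z))%:C * (cos (complex.Im z) +i* sin (complex.Im z)).

Definition cintegral f : R[i] :=
  (\int[torus_prob d]_x complex.Re (f x)) +i*
  (\int[torus_prob d]_x complex.Im (f x)).

Definition character k (x : torus R d) : R[i] :=
  cexp ('i%C * (\sum_(j < d) (k 0 j)%:~R * (tnth x j : R))%:C).

Definition fourier f k : R[i] :=
  cintegral (fun x => f x * conjc (character k x)).

Definition freq2 k : R := \sum_(j < d) (k 0 j)%:~R ^+ 2.

Definition L2norm f : \bar R :=
  ('N[torus_prob d]_2%:E[(fun x => (Normc.normc (f x))%:E)])%E.

Definition L2 f : Prop :=
  [/\ measurable_fun setT (fun x => complex.Re (f x)),
      measurable_fun setT (fun x => complex.Im (f x))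
    & (L2norm f < +oo)%E].

Definition Hnorm (delta : R) f : \bar R :=
  ((\esum_(k in [set: 'rV[int]_d])
      (((1 + freq2 k) `^ delta) * Normc.normc (fourier f k) ^+ 2)%:E)
     `^ 2^-1)%E.

Definition Hspace (delta : R) f : Prop := L2 f /\ (Hnorm delta f < +oo)%E.

(* The L^2 function whose k-th Fourier coefficient is m k times that of f; it
   is determined up to equality almost everywhere, and is 0 by convention if
   there is none. *)
Definition multiplier (m : 'rV[int]_d -> R[i]) f : torus R d -> R[i] :=
  xget (fun=> 0) [set g | L2 g /\ forall k, fourier g k = m k * fourier f k].

(* h(Delta) f *)
Definition fun_laplacian (h : R -> R[i]) f : torus R d -> R[i] :=
  multiplier (fun k => h (- freq2 k)) f.

End fourier.

Section nls.
Context {R : realType} {d : nat}.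
Implicit Types (mu t tau : R) (u v w : torus R d -> R[i]).

Definition laplacian w : torus R d -> R[i] :=
  fun_laplacian (fun l => l%:C) w.

Definition cubic w : torus R d -> R[i] :=
  fun x => `|w x| ^+ 2 * w x.

(* u is in C([0, Tmax[; H^2) and C^1([0, Tmax[; L^2), and the equation
   i u_t = - Delta u + mu |u|^2 u holds in L^2 at every time of [0, Tmax[. *)
Definition nls_solution mu (u0 : torus R d -> R[i]) (Tmax : \bar R)
    (u : R -> torus R d -> R[i]) : Prop :=
  let I := [set t : R | 0 <= t /\ (t%:E < Tmax)%E] in
  [/\ (0 < Tmax)%E,
      u 0 = u0,
      forall t, I t -> Hspace 2 (u t),
      forall t, I t ->
        Hnorm 2 (fun x => u s x - u t x) @[s --> within I (nbhs t)] --> 0%E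
    & forall t, I t ->
        L2norm (fun x => 'i%C * ((u s x - u t x) / (s - t)%:C)
                         - (- laplacian (u t) x + mu%:C * cubic (u t) x))
          @[s --> within I t^'] --> 0%E].

Definition maximal_nls_solution mu (u0 : torus R d -> R[i]) (Tmax : \bar R)
    (u : R -> torus R d -> R[i]) : Prop :=
  nls_solution mu u0 Tmax u /\
  forall (T' : \bar R) (u' : R -> torus R d -> R[i]),
    nls_solution mu u0 T' u' -> (T' <= Tmax)%E.

Definition sup_Hnorm (delta T : R) (u : R -> torus R d -> R[i]) : \bar R :=
  ereal_sup [set Hnorm delta (u t) | t in `[0, T]].

End nls.

Section sLRI2.
Context {R : realType} {d : nat}.
Variables (mu tau : R).
Implicit Types (u v w : torus R d -> R[i]) (z : R[i]).

Definition phi1 z : R[i] := if z == 0 then 1 else (cexp z - 1) / z.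
Definition phi2 z : R[i] := if z == 0 then 2^-1 else (cexp z - phi1 z) / z.

(* e^{i t Delta} *)
Definition schroedinger (t : R) w : torus R d -> R[i] :=
  fun_laplacian (fun l => cexp ('i%C * (t * l)%:C)) w.

Definition conj_fun w : torus R d -> R[i] := fun x => conjc (w x).

(* -2 i tau l, the value of -2 i tau Delta at the eigenvalue l of Delta *)
Let zeta (l : R) : R[i] := - 2 * 'i%C * (tau * l)%:C.

Definition sLRI2_first (u0 : torus R d -> R[i]) : torus R d -> R[i] :=
  let a := schroedinger tau (fun x => u0 x ^+ 2 *
    fun_laplacian (fun l => phi1 (zeta l) - phi2 (zeta l)) (conj_fun u0) x) in
  let b := fun x => schroedinger tau u0 x ^+ 2 *
    fun_laplacian (fun l => cexp ('i%C * (tau * l)%:C) * phi2 (zeta l))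
      (conj_fun u0) x in
  let c := schroedinger tau (fun x => `|u0 x| ^+ 4 * u0 x) in
  fun x => schroedinger tau u0 x
           - 'i%C * mu%:C * tau%:C * a x
           - 'i%C * mu%:C * tau%:C * b x
           - mu%:C ^+ 2 * (tau%:C ^+ 2 / 2) * c x.

(* u is u^{n-1} and v is u^n *)
Definition sLRI2_step u v : torus R d -> R[i] :=
  let a := schroedinger tau (fun x => v x ^+ 2 *
    fun_laplacian
      (fun l => (complex.Re (phi1 (zeta l)))%:C - (complex.Re (phi2 (zeta l)))%:C)
      (conj_fun v) x) in
  let b := fun x => schroedinger tau v x ^+ 2 *
    fun_laplacian (fun l => cexp ('i%C * (tau * l)%:C) * phi2 (zeta l))
      (conj_fun v) x in
  let c := schroedinger (2 * tau) (fun x => schroedinger (- tau) v x ^+ 2 *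
    fun_laplacian (fun l => cexp (- 'i%C * (tau * l)%:C) * phi2 (- zeta l))
      (conj_fun v) x) in
  fun x => schroedinger (2 * tau) u x
           - 2 * 'i%C * mu%:C * tau%:C * a x
           - 'i%C * mu%:C * tau%:C * b x
           - 'i%C * mu%:C * tau%:C * c x.

Fixpoint sLRI2 (u0 : torus R d -> R[i]) (n : nat) : torus R d -> R[i] :=
  if n is n'.+1 then
    if n' is m.+1 then sLRI2_step (sLRI2 u0 m) (sLRI2 u0 n')
    else sLRI2_first u0
  else u0.

End sLRI2.

(* Main.v *)
(* On the Fourier side, write V_k(s) = e^(is|k|^2) u^_k(t_n + s). Then V' = -i mu Xi, where
   Xi is the trilinear convolution of V, V and the conjugate of V with the oscillating symbol
   e^(isL), L = |k|^2 - |k1|^2 - |k2|^2 + |k3|^2 = 2|k3|^2 + y. The scheme replaces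
   V(tau) - V(-tau) by a convolution of V(0) whose symbol has an explicit s-derivative q_s, so
   the local error is the integral of Xi(s) + Xi(-s) minus the convolution with q_s. Two facts
   make it O(tau^3) in L^2: the symmetry in s cancels the first-order terms of V(s) - V(0), and
   |2 cos(sL) - q_s| <= C tau^2 y^2, where y^2 is a sum of products |ki|^2 |kj|^2, which costs
   only H^(2+d/4) by a critical product estimate. The interpolated bound
   |2 cos(sL) - q_s| <= C (tau |y|)^(d/4) gives a local error O(tau^(1+d/4)) in H^2, whence a
   uniform H^2 bound on the numerical solution, and then the L^2 stability of the two-step
   recursion yields the global error.
   Truncated convolutions approximate the Fourier coefficients of products uniformly, so
   every l^2 bound can be read on finite sets of frequencies. *)

Require Import Defs.
From mathcomp Require Import all_boot all_order all_algebra.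
From mathcomp Require Import all_classical all_reals all_analysis.
From mathcomp.real_closed Require Import complex.
From mathcomp Require Import measurable_realfun ring lra.
Import Order.TTheory GRing.Theory Num.Theory.
Local Open Scope ring_scope.

(** All norms enter squared, as bounds on finite weighted sums. Young's inequality with parameter
    tau then stands in for the triangle inequality, and its factor 1 + tau is harmless over T / tau
    steps. The nonlinear part of a step is Lipschitz only on balls of H^2, a space chosen because (1
    + |k|^2)^-2 is summable for d <= 3, so that its elements have absolutely summable coefficients.
    This forces a bootstrap: the H^2 and L^2 errors are propagated together, and the H^2 error stays
    below 1 because its rate tau^(d/4) tends to zero; the threshold on tau comes from there. The
    exponent d/4 is that of the critical embedding H^(d/4) -> L^4, whose lattice sum grows with the
    cutoff instead of converging, hence an ordering of the frequencies in the product estimate. The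
    local L^2 error tau^3 is summed over T / tau steps, whereas the first step occurs once and is
    allowed tau^2. Completeness of the characters is indispensable because [multiplier] fixes a
    function by its coefficients alone and the final norm is that of a function. *)

Module Convergence.

Set Implicit Arguments.
Unset Strict Implicit.
Unset Printing Implicit Defensive.
Import numFieldNormedType.Exports.
Local Open Scope classical_set_scope.
Local Open Scope ring_scope.
Local Open Scope complex_scope.
Local Notation Re := complex.Re.
Local Notation Im := complex.Im.
Local Notation N := Normc.normc.
Local Notation "x ^*" := (conjc x) : ring_scope.

(** * Complex-valued integrals *)

Section normc_theory.
Context {R : realType}.
Implicit Types z w : R[i].

Lemma normc_sqr z : N z ^+ 2 = Re z ^+ 2 + Im z ^+ 2.
Proof. by case: z => a b /=; rewrite sqr_sqrtr// addr_ge0// sqr_ge0. Qed.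

Lemma normc_ge0 z : 0 <= N z.
Proof. by case: z => a b /=; rewrite sqrtr_ge0. Qed.
Hint Resolve normc_ge0 : core.

Lemma normc_conj z : N z^* = N z.
Proof. by case: z => a b /=; rewrite sqrrN. Qed.

Lemma normc_real (x : R) : N x%:C = `|x|.
Proof. by rewrite /= expr0n addr0 sqrtr_sqr. Qed.

Lemma normcX z n : N (z ^+ n) = N z ^+ n.
Proof. by elim: n => [|n IH]; rewrite ?expr0 ?Normc.normc1// !exprS Normc.normcM IH. Qed.

Lemma normcB z w : N (z - w) <= N z + N w.
Proof. by rewrite -(complex.normcN w); exact: complex.le_normcD. Qed.

Lemma normc_sum I (s : seq I) (p : pred I) (F : I -> R[i]) :
  N (\sum_(i <- s | p i) F i) <= \sum_(i <- s | p i) N (F i).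
Proof.
apply: (big_ind2 (fun x y => N x <= y)) => //; first by rewrite Normc.normc0.
move=> x1 x2 y1 y2 h1 h2; apply: (le_trans (complex.le_normcD _ _)).
exact: lerD.
Qed.

Lemma le_Re_normc z : `|Re z| <= N z.
Proof.
by rewrite -(@ler_pXn2r _ 2)// ?nnegrE// normc_sqr real_normK ?num_real// lerDl sqr_ge0.
Qed.

Lemma le_Im_normc z : `|Im z| <= N z.
Proof.
by rewrite -(@ler_pXn2r _ 2)// ?nnegrE// normc_sqr real_normK ?num_real// lerDr sqr_ge0.
Qed.

Lemma normc_le_ReIm z : N z <= `|Re z| + `|Im z|.
Proof.
rewrite {1}[z]complexE (le_trans (complex.le_normcD _ _))//.
rewrite Normc.normcM !normc_real lerD2l.
by rewrite [N 'i](_ : _ = 1) ?mul1r//= expr0n expr1n add0r sqrtr1.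
Qed.

Lemma normc_sqrD_le z w : N (z + w) ^+ 2 <= 2 * N z ^+ 2 + 2 * N w ^+ 2.
Proof.
have := complex.le_normcD z w.
have := normc_ge0 (z + w); have := normc_ge0 z; have := normc_ge0 w.
move: (N (z + w)) (N z) (N w) => a b c c0 b0 a0 h.
have : 0 <= (c - b)^+2 by rewrite sqr_ge0.
nra.
Qed.

Lemma mulc_conj z : z * z^* = (N z ^+ 2)%:C.
Proof. by rewrite normc_sqr; case: z => a b; apply/eqP; rewrite eq_complex/=; apply/andP; split; apply/eqP; ring. Qed.

Lemma cReD z w : Re (z + w) = Re z + Re w. Proof. by case: z; case: w. Qed.
Lemma cImD z w : Im (z + w) = Im z + Im w. Proof. by case: z; case: w. Qed.
Lemma cReM z w : Re (z * w) = Re z * Re w - Im z * Im w. Proof. by case: z; case: w. Qed.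
Lemma cImM z w : Im (z * w) = Re z * Im w + Im z * Re w.
Proof. by case: z; case: w. Qed.
Lemma cReN z : Re (- z) = - Re z. Proof. by case: z. Qed.
Lemma cImN z : Im (- z) = - Im z. Proof. by case: z. Qed.
Lemma cRe_conj z : Re z^* = Re z. Proof. by case: z. Qed.
Lemma cIm_conj z : Im z^* = - Im z. Proof. by case: z. Qed.
Definition ReImE := (cReD, cImD, cReN, cImN, cRe_conj, cIm_conj, cReM, cImM).

Lemma complex_eq z w : Re z = Re w -> Im z = Im w -> z = w.
Proof. by case: z; case: w => a b c d /= -> ->. Qed.

(** A unit factor turns a modulus into a real part, so that the triangle inequality for complex
    integrals follows from the monotonicity of real ones. *)
Lemma normc_rotate z : exists2 u : R[i], N u = 1 & N z = Re (u * z).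
Proof.
have [->|z0] := eqVneq z 0.
  by exists 1; rewrite ?Normc.normc1// Normc.normc0 mulr0.
have Nz0 : N z != 0 by apply: contra z0 => /eqP/Normc.eq0_normc ->.
exists (z^* * (N z)^-1%:C).
  by rewrite Normc.normcM normc_conj normc_real ger0_norm ?invr_ge0// mulfV.
rewrite mulrAC [_^* * z]mulrC mulc_conj -rmorphM/= expr2 mulfK//.
Qed.

End normc_theory.
#[local] Hint Resolve normc_ge0 : core.

Section complex_integral.
Context {R : realType} {dT : measure_display} {T : measurableType dT}.
Variable P : probability T R.
Implicit Types (f g : T -> R[i]) (u v : T -> R).

Definition ible u := P.-integrable setT (EFin \o u).

Lemma ibleD u v : ible u -> ible v -> ible (fun x => u x + v x).
Proof. by move=> iu iv; exact: (integrableD measurableT iu iv). Qed.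

Lemma ibleZ c u : ible u -> ible (fun x => c * u x).
Proof. by move=> iu; exact: (integrableZl measurableT c iu). Qed.

Lemma ible_cst c : ible (fun=> c).
Proof. exact: finite_measure_integrable_cst. Qed.

Lemma ible_le u v : measurable_fun setT u -> (forall x, `|u x| <= v x) -> ible v -> ible u.
Proof.
move=> mu uv; apply: le_integrable => //; first exact/measurable_EFinP.
by move=> x _ /=; rewrite lee_fin (le_trans (uv x))// ler_norm.
Qed.

Lemma ible_meas u : ible u -> measurable_fun setT u.
Proof. by move=> /measurable_int /measurable_EFinP. Qed.

Lemma ible_norm u : ible u -> ible (fun x => `|u x|).
Proof. exact: integrable_norm. Qed.

Lemma Rint_le u v : ible u -> ible v -> (forall x, u x <= v x) ->
  \int[P]_x u x <= \int[P]_x v x.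
Proof. by move=> iu iv uv; exact: le_Rintegral. Qed.

Lemma RintD u v : ible u -> ible v ->
  \int[P]_x (u x + v x) = \int[P]_x u x + \int[P]_x v x.
Proof. by move=> iu iv; exact: RintegralD. Qed.

Lemma RintZ c u : ible u -> \int[P]_x (c * u x) = c * \int[P]_x u x.
Proof. by move=> iu; exact: RintegralZl. Qed.

Lemma Rint_cst c : \int[P]_x c = c.
Proof. by rewrite Rintegral_cst//= [X in fine X]probability_setT mulr1. Qed.

Definition cmeas f :=
  measurable_fun setT (fun x => Re (f x)) /\ measurable_fun setT (fun x => Im (f x)).
Definition cible f := ible (fun x => Re (f x)) /\ ible (fun x => Im (f x)).
Definition cint f : R[i] := (\int[P]_x Re (f x)) +i* (\int[P]_x Im (f x)).

Lemma cmeasD f g : cmeas f -> cmeas g -> cmeas (fun x => f x + g x).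
Proof.
move=> [? ?] [? ?]; split; under eq_fun do rewrite ReImE; exact: measurable_funD.
Qed.

Lemma cmeasN f : cmeas f -> cmeas (fun x => - f x).
Proof.
by move=> [? ?]; split; under eq_fun do rewrite ReImE; exact: measurableT_comp.
Qed.

Lemma cmeasM f g : cmeas f -> cmeas g -> cmeas (fun x => f x * g x).
Proof.
move=> [? ?] [? ?]; split; under eq_fun do rewrite ReImE.
  by apply: measurable_funB; exact: measurable_funM.
by apply: measurable_funD; exact: measurable_funM.
Qed.

Lemma cmeas_conj f : cmeas f -> cmeas (fun x => (f x)^*).
Proof.
by move=> [? ?]; split; under eq_fun do rewrite ReImE; [|exact: measurableT_comp].
Qed.

Lemma cmeas_cst c : cmeas (fun=> c).
Proof. by split; exact: measurable_cst. Qed.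

Lemma measurable_normc_sqr f : cmeas f -> measurable_fun setT (fun x => N (f x) ^+ 2).
Proof.
move=> [? ?]; under eq_fun do rewrite normc_sqr.
by apply: measurable_funD; exact: measurable_funX.
Qed.

Lemma measurable_normc f : cmeas f -> measurable_fun setT (fun x => N (f x)).
Proof.
move=> mf; rewrite (_ : (fun x => _) = (fun x => Num.sqrt (N (f x) ^+ 2))).
  apply: measurableT_comp; last exact: measurable_normc_sqr.
  by apply: continuous_measurable_fun; exact: sqrt_continuous.
by apply/funext => x; rewrite sqrtr_sqr ger0_norm.
Qed.

Lemma cible_meas f : cible f -> cmeas f.
Proof. by move=> [/ible_meas ? /ible_meas ?]. Qed.

Lemma cible_le f u : cmeas f -> (forall x, N (f x) <= u x) -> ible u -> cible f.
Proof.
move=> [m1 m2] fu iu; split; (apply: ible_le iu => // x).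
  by rewrite (le_trans (le_Re_normc _)).
by rewrite (le_trans (le_Im_normc _)).
Qed.

Lemma ible_normc f : cible f -> ible (fun x => N (f x)).
Proof.
move=> [i1 i2]; apply: (ible_le (v := fun x => `|Re (f x)| + `|Im (f x)|)).
- exact: measurable_normc (cible_meas _).
- by move=> x; rewrite (ger0_norm (normc_ge0 _)) normc_le_ReIm.
- by apply: ibleD; exact: ible_norm.
Qed.

Lemma cibleD f g : cible f -> cible g -> cible (fun x => f x + g x).
Proof.
move=> [? ?] [? ?]; split; under eq_fun do rewrite ReImE; exact: ibleD.
Qed.

Lemma cibleZ c f : cible f -> cible (fun x => c * f x).
Proof.
move=> [i1 i2]; split; under eq_fun do rewrite ReImE.
  by under eq_fun do rewrite -mulNr; apply: ibleD; exact: ibleZ.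
by apply: ibleD; exact: ibleZ.
Qed.

Lemma cible_cst c : cible (fun=> c).
Proof. by split; exact: ible_cst. Qed.

Lemma cible_sum I (s : seq I) (F : I -> T -> R[i]) :
  (forall i, cible (F i)) -> cible (fun x => \sum_(i <- s) F i x).
Proof.
move=> mF; elim: s => [|i s IH].
  under eq_fun do rewrite big_nil; exact: cible_cst.
by under eq_fun do rewrite big_cons; exact: cibleD.
Qed.

Lemma cintD f g : cible f -> cible g -> cint (fun x => f x + g x) = cint f + cint g.
Proof.
move=> [? ?] [? ?]; apply: complex_eq; rewrite /= ?ReImE/= -RintegralD//;
by congr Rintegral; apply/funext => x; rewrite !ReImE.
Qed.

Lemma cintZ c f : cible f -> cint (fun x => c * f x) = c * cint f.
Proof.
move=> [i1 i2]; apply: complex_eq; rewrite /= ?ReImE/=.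
  rewrite -!RintegralZl// -RintegralB//; try exact: ibleZ.
  by congr Rintegral; apply/funext => x; rewrite !ReImE.
rewrite -!RintegralZl// -RintegralD//; try exact: ibleZ.
by congr Rintegral; apply/funext => x; rewrite !ReImE.
Qed.

Lemma cint_conj f : cible f -> cint (fun x => (f x)^*) = (cint f)^*.
Proof.
move=> [i1 i2]; apply: complex_eq; rewrite /= -1?mulN1r -?RintegralZl//;
by congr Rintegral; apply/funext => x; rewrite !ReImE ?mulN1r.
Qed.

Lemma cint0 : cint (fun=> 0) = 0.
Proof. by apply: complex_eq; rewrite /= /Rintegral integral0. Qed.

Lemma cint_sum I (s : seq I) (F : I -> T -> R[i]) : (forall i, cible (F i)) ->
  cint (fun x => \sum_(i <- s) F i x) = \sum_(i <- s) cint (F i).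
Proof.
move=> mF; elim: s => [|i s IH].
  by under eq_fun do rewrite big_nil; rewrite cint0 big_nil.
rewrite big_cons -IH -cintD//; last exact: cible_sum.
by congr cint; apply/funext => x; rewrite big_cons.
Qed.

Lemma normc_cint f : cible f -> N (cint f) <= \int[P]_x N (f x).
Proof.
move=> if_; have [u u1 ->] := normc_rotate (cint f).
rewrite -cintZ//= le_Rintegral//.
- exact: (cibleZ u if_).1.
- exact: ible_normc.
- move=> x _; rewrite (le_trans (ler_norm _))// (le_trans (le_Re_normc _))//.
  by rewrite Normc.normcM u1 mul1r.
Qed.

Definition l2 f := cmeas f /\ ible (fun x => N (f x) ^+ 2).
Definition n2 f : R := \int[P]_x (N (f x) ^+ 2).

Lemma n2_ge0 f : 0 <= n2 f.
Proof. by apply: Rintegral_ge0 => x _; rewrite sqr_ge0. Qed.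

Lemma l2_le f g c : cmeas f -> l2 g -> (forall x, N (f x) <= c * N (g x)) -> l2 f.
Proof.
move=> mf [mg ig] fg; split=> //.
apply: (ible_le (v := fun x => c ^+ 2 * N (g x) ^+ 2)); last exact: ibleZ.
  exact: measurable_normc_sqr.
move=> x; rewrite ger0_norm ?sqr_ge0// -exprMn lerXn2r// nnegrE; first exact: normc_ge0.
exact: le_trans (normc_ge0 _) (fg x).
Qed.

Lemma l2D f g : l2 f -> l2 g -> l2 (fun x => f x + g x).
Proof.
move=> [mf if_] [mg ig]; split; first exact: cmeasD.
apply: (ible_le (v := fun x => 2 * N (f x) ^+ 2 + 2 * N (g x) ^+ 2)).
- by apply: measurable_normc_sqr; exact: cmeasD.
- by move=> x; rewrite ger0_norm ?sqr_ge0 ?normc_sqrD_le.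
- by apply: ibleD; exact: ibleZ.
Qed.

Lemma n2D_le f g : l2 f -> l2 g -> n2 (fun x => f x + g x) <= 2 * n2 f + 2 * n2 g.
Proof.
move=> lf lg; rewrite -!RintZ -1?RintD; [|by apply: ibleZ; case: lf|by apply: ibleZ; case: lg|by case: lg|by case: lf].
apply: Rint_le; [by case: (l2D lf lg)|by apply: ibleD; apply: ibleZ; [case: lf|case: lg]|].
by move=> x; exact: normc_sqrD_le.
Qed.

Lemma n2N f : n2 (fun x => - f x) = n2 f.
Proof. by apply: eq_Rintegral => x _; rewrite complex.normcN. Qed.

Lemma l2Z c f : l2 f -> l2 (fun x => c * f x).
Proof.
move=> lf; apply: (l2_le (c := N c) _ lf); last by move=> x; rewrite Normc.normcM.
by apply: cmeasM; [exact: cmeas_cst|exact: lf.1].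
Qed.

Lemma l2N f : l2 f -> l2 (fun x => - f x).
Proof. by move=> lf; under eq_fun do rewrite -mulN1r; exact: l2Z. Qed.

Lemma l2B f g : l2 f -> l2 g -> l2 (fun x => f x - g x).
Proof. by move=> lf lg; apply: l2D => //; exact: l2N. Qed.

Lemma l2_conj f : l2 f -> l2 (fun x => (f x)^*).
Proof.
move=> lf; apply: (l2_le (c := 1) _ lf); last by move=> x; rewrite mul1r normc_conj.
exact: cmeas_conj lf.1.
Qed.

Lemma l2_bounded f c : cmeas f -> (forall x, N (f x) <= c) -> l2 f.
Proof.
move=> mf fc; split=> //; apply: (ible_le (v := fun=> c ^+ 2)); last exact: ible_cst.
  exact: measurable_normc_sqr.
move=> x; rewrite ger0_norm ?sqr_ge0// lerXn2r// nnegrE; first exact: normc_ge0.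
exact: le_trans (normc_ge0 _) (fc x).
Qed.

Lemma l2_cst c : l2 (fun=> c).
Proof. by apply: (@l2_bounded _ (N c)) => //; exact: cmeas_cst. Qed.

Lemma l2_sum I (s : seq I) (F : I -> T -> R[i]) :
  (forall i, l2 (F i)) -> l2 (fun x => \sum_(i <- s) F i x).
Proof.
move=> mF; elim: s => [|i s IH].
  under eq_fun do rewrite big_nil; exact: l2_cst.
by under eq_fun do rewrite big_cons; exact: l2D.
Qed.

Lemma l2_cibleM f g : l2 f -> l2 g -> cible (fun x => f x * g x).
Proof.
move=> [mf if_] [mg ig].
apply: (cible_le (u := fun x => N (f x) ^+ 2 + N (g x) ^+ 2)).
- exact: cmeasM.
- move=> x; rewrite Normc.normcM.
  have := normc_ge0 (f x); have := normc_ge0 (g x).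
  move: (N _) (N _) => a b a0 b0; have : 0 <= (a - b)^+2 by rewrite sqr_ge0.
  nra.
- exact: ibleD.
Qed.

Lemma l2_cible f : l2 f -> cible f.
Proof.
by move=> lf; have := l2_cibleM lf (l2_cst 1); under eq_fun do rewrite mulr1.
Qed.

Lemma n2B_le f g : l2 f -> l2 g -> n2 (fun x => f x - g x) <= 2 * n2 f + 2 * n2 g.
Proof. by move=> lf lg; rewrite -(n2N g); apply: n2D_le => //; exact: l2N. Qed.

(* AM-GM with a free parameter instead of Cauchy-Schwarz avoids square roots. *)
Lemma cintM_le f g c : 0 < c -> l2 f -> l2 g ->
  N (cint (fun x => f x * g x)) <= c * n2 f + c^-1 * n2 g.
Proof.
move=> c0 lf lg; apply: (le_trans (normc_cint (l2_cibleM lf lg))).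
rewrite /n2 -!RintegralZl//; try by case: lf; case: lg.
rewrite -RintegralD//; try by apply: ibleZ; case: lf; case: lg.
apply: le_Rintegral => //.
- exact: ible_normc (l2_cibleM lf lg).
- by apply: ibleD; apply: ibleZ; case: lf; case: lg.
- move=> x _; rewrite Normc.normcM.
  have := normc_ge0 (f x); have := normc_ge0 (g x).
  move: (N _) (N _) => a b a0 b0.
  rewrite -(@ler_pM2l _ c)// mulrDr !mulrA mulfV ?gt_eqF// mul1r.
  have : 0 <= (c * b - a)^+2 by rewrite sqr_ge0.
  have : 0 <= c * (a * b) by rewrite mulr_ge0 ?mulr_ge0// ltW.
  nra.
Qed.

End complex_integral.

(** * Orthonormal systems *)

Section limit_integral.
Context {R : realType} {dT : measure_display} {T : measurableType dT}.
Variable P : probability T R.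

(** Integrability of the limit is part of the conclusion; this is how the limit in [l2_complete] is
    seen to be square integrable. *)
Lemma fatou_le (u_ : nat -> T -> R) (u : T -> R) (C : R) :
  (forall n, ible P (u_ n)) -> (forall n x, 0 <= u_ n x) ->
  (forall x, u_ ^~ x @ \oo --> u x) ->
  (\forall n \near \oo, \int[P]_x u_ n x <= C) -> ible P u /\ \int[P]_x u x <= C.
Proof.
move=> iu u0 cu uC.
have mu : measurable_fun setT u.
  by apply: measurable_fun_cvg => [n|x _]; [exact: ible_meas (iu n)|exact: cu].
have uge0 x : 0 <= u x.
  by apply: (ler_cvg_to (@cvg_cst _ _ _ _ _) (cu x)); exact: nearW.
have IE n : (\int[P]_x (u_ n x)%:E)%E = (\int[P]_x u_ n x)%:E.
  by rewrite fineK//; exact: (integrable_fin_num _ (iu n)).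
have h : (\int[P]_x (u x)%:E <= C%:E)%E.
  have mE n : measurable_fun setT (fun x => (u_ n x)%:E).
    by apply/measurable_EFinP; exact: ible_meas (iu n).
  have pE n x : setT x -> (0 <= (u_ n x)%:E)%E by rewrite lee_fin.
  have uE : (\int[P]_x (u x)%:E = \int[P]_x limn_einf (fun n => (u_ n x)%:E))%E.
    apply: eq_integral => x _; apply/esym.
    have : (fun n => (u_ n x)%:E) @ \oo --> (u x)%:E.
      by apply: cvg_EFin; [exact: nearW|exact: cu].
    by move=> /cvg_limn_einf_sup[].
  rewrite uE (le_trans (fatou P measurableT mE pE))//.
  rewrite limn_einf_lim; apply: lime_le; first exact: is_cvg_einfs.
  near=> n; apply: (@le_trans _ _ (\int[P]_x (u_ n x)%:E)%E).
    by apply: ereal_inf_lbound => /=; exists n => //=.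
  by rewrite IE lee_fin; near: n.
have iu' : ible P u.
  apply/integrableP; split; first exact/measurable_EFinP.
  rewrite (eq_integral (fun x => (u x)%:E)).
    by rewrite (le_lt_trans h)// ltry.
  by move=> x _; rewrite gee0_abs// lee_fin.
split=> //; rewrite -lee_fin; rewrite fineK//; exact: integrable_fin_num.
Unshelve. all: by end_near. Qed.

Lemma Rintegral_ae (f g : T -> R) : measurable_fun setT f -> measurable_fun setT g ->
  {ae P, forall x, f x = g x} -> \int[P]_x f x = \int[P]_x g x.
Proof.
move=> mf mg fg; congr fine; apply: ae_eq_integral => //; [exact/measurable_EFinP|exact/measurable_EFinP|].
by apply: filterS fg => x -> _.
Qed.

Lemma ible_ae (f g : T -> R) : measurable_fun setT f -> measurable_fun setT g ->
  {ae P, forall x, f x = g x} -> ible P f -> ible P g.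
Proof.
move=> mf mg fg /integrableP[_ i1].
apply/integrableP; (split; first exact/measurable_EFinP).
rewrite (ae_eq_integral (fun x => `|(f x)%:E|)%E)//.
- exact/measurableT_comp/measurable_EFinP.
- exact/measurableT_comp/measurable_EFinP.
- by apply: filterS fg => x -> _.
Qed.

Lemma n2_le (f g : T -> R[i]) : l2 P f -> l2 P g ->
  {ae P, forall x, N (f x) <= N (g x)} -> n2 P f <= n2 P g.
Proof.
move=> [mf lf] [mg lg] fg; rewrite /n2.
(* The comparison holds only almost everywhere; truncating by the minimum changes the integrand on a
   null set and makes it hold at every point. *)
have -> : \int[P]_x (N (f x) ^+ 2) = \int[P]_x (Num.min (N (f x) ^+ 2) (N (g x) ^+ 2)).
  apply: Rintegral_ae.
  - exact: measurable_normc_sqr.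
  - by apply: measurable_minr; exact: measurable_normc_sqr.
  - by apply: filterS fg => x fg; rewrite min_l// lerXn2r// nnegrE normc_ge0.
apply: le_Rintegral => //.
- apply: (ible_le (v := fun x => N (f x) ^+ 2)) => //.
    by apply: measurable_minr; exact: measurable_normc_sqr.
  by move=> x; rewrite ger0_norm ?ge_min ?lexx// le_min !sqr_ge0.
- by move=> x _; rewrite ge_min lexx orbT.
Qed.

End limit_integral.

(** * Summable families tested on finite sets *)

Section finite_tails.
Context {R : realType} {I : choiceType}.

(* [bnd v C] says that the nonnegative family [v] is summable with sum at most [C]. *)
Definition bnd (v : I -> R) (C : R) :=
  forall K : seq I, uniq K -> \sum_(k <- K) v k <= C.

(** Some finite set [K] nearly attains the supremum of the partial sums, and a set disjoint from [K]
    can only add what is left. *)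
Lemma bnd_tail (v : I -> R) (C e : R) : bnd v C -> 0 < e ->
  exists2 K : seq I, uniq K &
    forall L, uniq L -> (forall k, k \in L -> k \notin K) -> \sum_(k <- L) v k <= e.
Proof.
move=> vC e0; pose E := [set s : R | exists2 K : seq I, uniq K & s = \sum_(k <- K) v k].
have supE : has_sup E.
  split; first by exists 0, [::] => //; rewrite big_nil.
  by exists C => _ [K uK ->]; exact: vC.
have [_ [K uK ->] hK] := sup_adherent e0 supE.
exists K => // L uL LK.
have : \sum_(k <- K ++ L) v k <= sup E.
  apply: ub_le_sup; first by case: supE.
  exists (K ++ L) => //; rewrite cat_uniq uK uL andbT/=.
  by apply/hasPn => k; exact: LK.
by rewrite big_cat/=; lra.
Qed.

(** The list [b] may have repetitions: in [sum_prod_le] it is the image of [signed_row], where zero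
    entries occur with both signs. *)
Lemma bnd_cat (v : I -> R) (a b : seq I) : (forall k, 0 <= v k) -> uniq a -> {subset a <= b} ->
  \sum_(k <- a) v k <= \sum_(k <- b) v k.
Proof.
move=> v0; elim: a b => [|x a IH] b /=.
  by move=> _ _; rewrite big_nil sumr_ge0.
move=> /andP[xa ua] ab; rewrite big_cons.
have xb : x \in b by apply: ab; rewrite mem_head.
rewrite (perm_big _ (perm_to_rem xb)) big_cons lerD2l; apply: IH => // y ya.
have := ab y; rewrite inE ya orbT => /(_ isT).
rewrite (perm_mem (perm_to_rem xb)) inE => /predU1P[yx|//].
by move: xa; rewrite -yx ya.
Qed.

End finite_tails.

Section orthonormal_system.
Context {R : realType} {dT : measure_display} {T : measurableType dT}.
Variable P : probability T R.
Context {I : choiceType}.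
Variable e : I -> T -> R[i].
Hypothesis e_meas : forall k, cmeas (e k).
Hypothesis e_norm : forall k x, N (e k x) = 1.
Hypothesis e_orth : forall k l, cint P (fun x => e k x * (e l x)^*) = (k == l)%:R.

(** The system is unimodular, not merely normalised, so the coefficients make sense for every
    integrable function and are bounded by its L^1 norm. *)
Definition fco f k := cint P (fun x => f x * (e k x)^*).
Definition tpoly (K : seq I) (a : I -> R[i]) x := \sum_(k <- K) a k * e k x.

Lemma e_l2 k : l2 P (e k).
Proof. by apply: (@l2_bounded _ _ _ _ _ 1) => // x; rewrite e_norm. Qed.

Lemma tpoly_l2 K a : l2 P (tpoly K a).
Proof. by apply: l2_sum => k; apply: l2Z; exact: e_l2. Qed.

Lemma cibleM_e f k : cible P f -> cible P (fun x => f x * (e k x)^*).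
Proof.
move=> if_; apply: (cible_le (u := fun x => N (f x))); last exact: ible_normc.
- by apply: cmeasM; [exact: cible_meas if_|apply: cmeas_conj].
- by move=> x; rewrite Normc.normcM normc_conj e_norm mulr1.
Qed.

Lemma fcoD f g k : cible P f -> cible P g ->
  fco (fun x => f x + g x) k = fco f k + fco g k.
Proof.
move=> if_ ig; rewrite /fco -cintD; [|exact: cibleM_e..].
by congr cint; apply/funext => x; rewrite mulrDl.
Qed.

Lemma fcoZ c f k : cible P f -> fco (fun x => c * f x) k = c * fco f k.
Proof.
move=> if_; rewrite /fco -cintZ; [|exact: cibleM_e].
by congr cint; apply/funext => x; rewrite mulrA.
Qed.

Lemma fcoB f g k : cible P f -> cible P g ->
  fco (fun x => f x - g x) k = fco f k - fco g k.
Proof.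
move=> if_ ig; rewrite -mulN1r -fcoZ// -fcoD//; last exact: cibleZ.
by congr fco; apply/funext => x; rewrite mulN1r.
Qed.

Lemma fco_tpoly K a l : uniq K -> fco (tpoly K a) l = if l \in K then a l else 0.
Proof.
move=> uK; rewrite /fco /tpoly; under eq_fun do rewrite mulr_suml.
have ie k : cible P (fun x => a k * e k x * (e l x)^*).
  by apply: cibleM_e; apply: cibleZ; exact: l2_cible (e_l2 k).
rewrite cint_sum//.
transitivity (\sum_(k <- K) a k * (k == l)%:R).
  apply: eq_bigr => k _; rewrite -e_orth -cintZ; last exact/cibleM_e/l2_cible/e_l2.
  by congr cint; apply/funext => x; rewrite mulrA.
case: ifPn => lK.
  rewrite (bigD1_seq l)//= eqxx mulr1 big1 ?addr0// => k /negbTE->.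
  by rewrite mulr0.
rewrite big_seq big1// => k kK; case: eqP => [kl|_]; last by rewrite mulr0.
by rewrite -kl kK in lK.
Qed.

Lemma normc_fco f k : cible P f -> N (fco f k) <= \int[P]_x N (f x).
Proof.
move=> if_; apply: (le_trans (normc_cint (cibleM_e k if_))).
rewrite le_eqVlt; apply/orP; left; apply/eqP; apply: eq_Rintegral => x _.
by rewrite Normc.normcM normc_conj e_norm mulr1.
Qed.

Lemma cintM_tpoly g K a : l2 P g ->
  cint P (fun x => g x * (tpoly K a x)^*) = \sum_(k <- K) (a k)^* * fco g k.
Proof.
move=> lg; rewrite /tpoly.
transitivity (cint P (fun x => \sum_(k <- K) (a k)^* * (g x * (e k x)^*))).
  congr cint; apply/funext => x; rewrite rmorph_sum mulr_sumr; apply: eq_bigr => k _.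
  by rewrite rmorphM mulrCA.
have ik k : cible P (fun x => g x * (e k x)^*) by exact/cibleM_e/l2_cible.
rewrite cint_sum; last by move=> k; exact: cibleZ.
by apply: eq_bigr => k _; rewrite cintZ.
Qed.

Lemma n2E f : l2 P f -> (n2 P f)%:C = cint P (fun x => f x * (f x)^*).
Proof.
move=> lf; apply: complex_eq; rewrite /= /n2.
  by apply: eq_Rintegral => x _; rewrite mulc_conj.
under eq_fun do rewrite mulc_conj /=.
by rewrite /Rintegral integral0.
Qed.

Lemma n2_tpoly K a : uniq K -> n2 P (tpoly K a) = \sum_(k <- K) N (a k) ^+ 2.
Proof.
move=> uK; apply: (@complexI R); rewrite n2E; last exact: tpoly_l2.
rewrite cintM_tpoly; last exact: tpoly_l2.
rewrite rmorph_sum/= big_seq [RHS]big_seq; apply: eq_bigr => k kK.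
by rewrite fco_tpoly// kK mulrC mulc_conj.
Qed.

(** Pythagoras: the remainder is orthogonal to each [e k] with [k] in [K], hence to the partial sum,
    and both cross terms vanish. *)
Lemma n2_sub_tpoly f K : l2 P f -> uniq K ->
  n2 P (fun x => f x - tpoly K (fco f) x) = n2 P f - \sum_(k <- K) N (fco f k) ^+ 2.
Proof.
move=> lf uK; set S := tpoly K _; pose g x := f x - S x.
have lS : l2 P S by exact: tpoly_l2.
have lg : l2 P g by exact: l2B.
have gk k : k \in K -> fco g k = 0.
  by move=> kK; rewrite fcoB; [|exact: l2_cible..]; rewrite fco_tpoly// kK subrr.
have gS : cint P (fun x => g x * (S x)^*) = 0.
  by rewrite cintM_tpoly// big_seq big1// => k kK; rewrite gk// mulr0.
have Sg : cint P (fun x => S x * (g x)^*) = 0.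
  rewrite -[RHS]conjc0 -gS -cint_conj; last by apply: l2_cibleM => //; exact: l2_conj.
  by congr cint; apply/funext => x; rewrite rmorphM/= conjcK mulrC.
apply: (@complexI R); rewrite rmorphB/= -(n2_tpoly (fco f) uK) !n2E// -/S.
have -> : cint P (fun x => f x * (f x)^*) = cint P (fun x => (g x * (g x)^* + g x * (S x)^*) +
    (S x * (g x)^* + S x * (S x)^*)).
  congr cint; apply/funext => x; rewrite -mulrDr -mulrDr -mulrDl -rmorphD.
  by rewrite /g subrK.
have i1 u v : l2 P u -> l2 P v -> cible P (fun x => u x * (v x)^*).
  by move=> lu lv; apply: l2_cibleM => //; exact: l2_conj.
rewrite cintD; [|by apply: cibleD; exact: i1..].
rewrite !cintD; [|exact: i1..].
by rewrite gS Sg add0r addr0 addrK.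
Qed.

Lemma bessel f : l2 P f -> bnd (fun k => N (fco f k) ^+ 2) (n2 P f).
Proof.
by move=> lf K uK; rewrite -subr_ge0 -n2_sub_tpoly// n2_ge0.
Qed.

End orthonormal_system.

(** * The Riesz-Fischer theorem *)

Section riesz_fischer.
Context {R : realType} {dT : measure_display} {T : measurableType dT}.
Variable P : probability T R.
Context {I : choiceType}.
Variable e : I -> T -> R[i].
Hypothesis e_meas : forall k, cmeas (e k).
Hypothesis e_norm : forall k x, N (e k x) = 1.
Hypothesis e_orth : forall k l, cint P (fun x => e k x * (e l x)^*) = (k == l)%:R.
Local Notation fco := (fco P e).
Local Notation tpoly := (tpoly e).

(* Only the coefficients in the symmetric difference survive. *)
Lemma n2_tpolyB (c : I -> R[i]) (K L : seq I) (a b : R) : uniq K -> uniq L ->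
  (forall M, uniq M -> (forall k, k \in M -> k \notin K) -> \sum_(k <- M) N (c k) ^+ 2 <= a) ->
  (forall M, uniq M -> (forall k, k \in M -> k \notin L) -> \sum_(k <- M) N (c k) ^+ 2 <= b) ->
  n2 P (fun x => tpoly K c x - tpoly L c x) <= 2 * (a + b).
Proof.
move=> uK uL Ka Lb.
pose A := [seq k <- K | k \notin L]; pose B := [seq k <- L | k \notin K].
have KL : [seq k <- K | k \in L] =i [seq k <- L | k \in K].
  by move=> k; rewrite !mem_filter andbC.
have pKL := uniq_perm (filter_uniq _ uK) (filter_uniq _ uL) KL.
have -> : (fun x => tpoly K c x - tpoly L c x) = (fun x => tpoly A c x - tpoly B c x).
  apply/funext => x; rewrite /tpoly.
  rewrite (bigID (mem L)) [X in _ - X](bigID (mem K))/= /A /B !big_filter.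
  have -> : \sum_(k <- K | k \in L) c k * e k x = \sum_(k <- L | k \in K) c k * e k x.
    by rewrite -big_filter (perm_big _ pKL) big_filter.
  ring.
have nA : n2 P (tpoly A c) <= b.
  rewrite n2_tpoly ?filter_uniq//; apply: Lb; rewrite ?filter_uniq// => k.
  by rewrite mem_filter => /andP[].
have nB : n2 P (tpoly B c) <= a.
  rewrite n2_tpoly ?filter_uniq//; apply: Ka; rewrite ?filter_uniq// => k.
  by rewrite mem_filter => /andP[].
have lA : l2 P (tpoly A c) by exact: tpoly_l2.
have lB : l2 P (tpoly B c) by exact: tpoly_l2.
apply: (@le_trans _ _ (2 * n2 P (tpoly A c) + 2 * n2 P (tpoly B c))); last by lra.
exact: n2B_le.
Qed.

Lemma half_gt0 n : 0 < 2^-1 ^+ n :> R.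
Proof. by rewrite exprn_gt0. Qed.

(** The integrals have a finite sum, so the sum of the series is an integrable function and is
    therefore finite almost everywhere. *)
Lemma ae_summable (D : nat -> T -> R) : (forall n x, 0 <= D n x) -> (forall n, ible P (D n)) ->
  (forall n, \int[P]_x D n x <= 5 * 2^-1 ^+ n) ->
  {ae P, forall x, cvgn (series (fun n => D n x))}.
Proof.
move=> D0 iD ID; pose s x := (\sum_(0 <= n <oo) (D n x)%:E)%E.
have sD0 n x : (0 <= (D n x)%:E)%E by rewrite lee_fin.
have ms : measurable_fun setT s.
  apply: ge0_emeasurable_sum => [n x _ _|n _]; first exact: sD0.
  by apply/measurable_EFinP; exact: ible_meas.
have Is : (\int[P]_x s x < +oo)%E.
  rewrite integral_nneseries//; last first.
    by move=> n; apply/measurable_EFinP; exact: ible_meas.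
  (* 10 is the sum of 5 / 2^n over n, in the form 10 / 2^(n+1) that [epsilon_trick0] sums. *)
  apply: (@le_lt_trans _ _ (10%:R)%:E); last by rewrite ltry.
  apply: le_trans (epsilon_trick0 (eps := 10) xpredT _); last by [].
  apply: lee_nneseries => [n _ _|n _]; first exact: integral_ge0.
  have -> : (\int[P]_x (D n x)%:E)%E = (\int[P]_x D n x)%:E.
    by rewrite fineK//; exact: (integrable_fin_num _ (iD n)).
  rewrite lee_fin (le_trans (ID n))// exprVn natrX exprS invfM.
  by rewrite le_eqVlt; apply/orP; left; apply/eqP; field; rewrite expf_neq0.
have is1 : P.-integrable setT s.
  apply/integrableP; split=> //; rewrite (eq_integral s)// => x _.
  by rewrite gee0_abs//; apply: nneseries_ge0.
apply: filterS (integrable_ae measurableT is1) => x /(_ Logic.I) fs.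
apply: nondecreasing_is_cvgn.
  apply/nondecreasing_seqP => n.
  by rewrite /series/= big_nat_recr//= lerDl.
exists (fine (s x)) => _ [n _ <-] /=.
rewrite -lee_fin fineK//.
apply: (@le_trans _ _ (\sum_(0 <= k < n) (D k x)%:E)%E); first by rewrite sumEFin.
exact: nneseries_lim_ge.
Qed.

(* Fatou's lemma identifies the limit along a rapidly convergent sequence. *)
Lemma l2_complete (S : nat -> T -> R[i]) : (forall n, l2 P (S n)) ->
  (forall n m, (n <= m)%N -> n2 P (fun x => S m x - S n x) <= 4 * 2^-1 ^+ n ^+ 2) ->
  exists2 g, l2 P g & forall f C, l2 P f ->
    (\forall n \near \oo, n2 P (fun x => S n x - f x) <= C) ->
    n2 P (fun x => g x - f x) <= C.
Proof.
move=> lS SS; pose q n : R := 2^-1 ^+ n.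
have q0 n : 0 < q n by exact: half_gt0.
pose D n x := S n.+1 x - S n x.
have lD n : l2 P (D n) by exact: l2B.
have iD n : ible P (fun x => N (D n x)) by apply: ible_normc; exact: l2_cible.
(* AM-GM gives |D| <= |D|^2 / q + q; the square costs at most 4 q^2, hence 4 q + q. *)
have ID n : \int[P]_x N (D n x) <= 5 * q n.
  apply: (@le_trans _ _ (\int[P]_x ((q n)^-1 * N (D n x) ^+ 2 + q n * 1))).
    apply: Rint_le => //.
      by apply: ibleD; apply: ibleZ; [case: (lD n)|exact: ible_cst].
    move=> x; rewrite -(@ler_pM2l _ (q n))// mulrDr !mulrA mulfV ?gt_eqF// mul1r.
    have := normc_ge0 (D n x); move: (N _) (q0 n) => a q1 a0.
    have : 0 <= (a - q n)^+2 by rewrite sqr_ge0.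
    have : 0 <= a * q n by rewrite mulr_ge0// ltW.
    nra.
  rewrite RintD; [|by apply: ibleZ; case: (lD n)|by apply: ibleZ; exact: ible_cst].
  rewrite Rint_cst mulr1 RintZ; last by case: (lD n).
  have := SS n n.+1 (leqnSn _); rewrite -/(D n) -/(n2 P (D n)) => h.
  have : (q n)^-1 * n2 P (D n) <= (q n)^-1 * (4 * q n ^+ 2) by rewrite ler_pM2l ?invr_gt0.
  rewrite (_ : _^-1 * (4 * _) = 4 * q n); last first.
    by rewrite mulrCA expr2 mulKf ?gt_eqF.
  rewrite -/(n2 P (D n)); lra.
have [B [mB B0 DB]] := ae_summable (fun n x => normc_ge0 (D n x)) iD ID.
pose A := ~` B.
have mA : measurable A by exact: measurableC.
have AD x : A x -> cvgn (series (fun n => N (D n x))).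
  by move=> Ax; apply: contrapT => /DB.
have aeA : {ae P, forall x, A x}.
  by exists B; split=> // x /=; rewrite /A => /contrapT.
(* [pr] stands for the real or the imaginary part. Off the null set [S n x] telescopes into a series
   dominated by the convergent one of the [N (D n x)]. *)
have cvgA (pr : R[i] -> R) x : (forall z w, pr (z - w) = pr z - pr w) ->
    (forall z, `|pr z| <= N z) -> A x -> cvgn (fun n => pr (S n x)).
  move=> prB prN Ax.
  have cs : cvgn (series (fun n => pr (D n x))).
    apply: normed_cvg; apply: (series_le_cvg (v_ := fun n => N (D n x))) => [n|n|n|] /=.
    - exact: normr_ge0.
    - exact: normc_ge0.
    - exact: prN.
    - exact: AD.
  rewrite (_ : (fun n => _) = (fun n => pr (S 0%N x) + series (fun n => pr (D n x)) n)); last first.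
    apply/funext => n; elim: n => [|n IH]; first by rewrite /series/= big_geq ?addr0.
    by rewrite /series/= big_nat_recr//= addrA -IH prB addrC subrK.
  by apply: is_cvgD => //; exact: is_cvg_cst.
(* Replacing [S n] by 0 on the exceptional set makes the sequence converge at every point, so that
   its limit is measurable. *)
pose X n x : R[i] := if x \in A then S n x else 0.
have mX n : cmeas (X n).
  have [m1 m2] := (lS n).1.
  have mbA : measurable_fun setT (fun x => x \in A).
    by apply: (measurable_fun_bool true); rewrite setTI (_ : _ @^-1` _ = A)//;
      apply/seteqP; split=> x /=; [move/set_mem|move/mem_set].
  split.
    rewrite (_ : (fun x => _) = (fun x => if x \in A then Re (S n x) else 0)).
      by apply: measurable_fun_ifT.
    by apply/funext => x; rewrite /X; case: ifP.
  rewrite (_ : (fun x => _) = (fun x => if x \in A then Im (S n x) else 0)).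
    by apply: measurable_fun_ifT.
  by apply/funext => x; rewrite /X; case: ifP.
have XS n : {ae P, forall x, X n x = S n x}.
  by apply: filterS aeA => x /mem_set Ax; rewrite /X Ax.
have cvgX (pr : R[i] -> R) x : (forall z w, pr (z - w) = pr z - pr w) ->
    (forall z, `|pr z| <= N z) -> cvgn (fun n => pr (X n x)).
  move=> prB prN; rewrite /X; case: (boolP (x \in A)) => [/set_mem xA|_]; first exact: cvgA.
  exact: is_cvg_cst.
have ReB z w : Re (z - w) = Re z - Re w :> R by rewrite !ReImE.
have ImB z w : Im (z - w) = Im z - Im w :> R by rewrite !ReImE.
pose g x := limn (fun n => Re (X n x)) +i* limn (fun n => Im (X n x)).
have cR x : (fun n => Re (X n x)) @ \oo --> Re (g x).
  by apply: cvgX => //; exact: le_Re_normc.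
have cI x : (fun n => Im (X n x)) @ \oo --> Im (g x).
  by apply: cvgX => //; exact: le_Im_normc.
have mg : cmeas g.
  split.
    apply: (measurable_fun_cvg (h := fun n x => Re (X n x))) => [n|x _]; last exact: cR.
    by case: (mX n).
  apply: (measurable_fun_cvg (h := fun n x => Im (X n x))) => [n|x _]; last exact: cI.
  by case: (mX n).
have lX n : l2 P (X n).
  apply: (l2_le (c := 1) _ (lS n)) => // x; rewrite mul1r /X; case: ifP => // _.
  by rewrite Normc.normc0 normc_ge0.
have fat f C : l2 P f -> (\forall n \near \oo, n2 P (fun x => S n x - f x) <= C) ->
    ible P (fun x => N (g x - f x) ^+ 2) /\ n2 P (fun x => g x - f x) <= C.
  move=> lf SC; apply: (fatou_le (u_ := fun n x => N (X n x - f x) ^+ 2)) => [n|n x|x|].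
  - by have [] := l2B (lX n) lf.
  - by rewrite sqr_ge0.
  - rewrite normc_sqr ReB ImB.
    rewrite (_ : (fun n => _) = (fun n => (Re (X n x) - Re (f x)) ^+ 2 + (Im (X n x) - Im (f x)) ^+ 2)); last first.
      by apply/funext => n; rewrite normc_sqr ReB ImB.
    have c1 : (fun n => Re (X n x) - Re (f x)) @ \oo --> Re (g x) - Re (f x).
      by apply: cvgB; [exact: cR|exact: cvg_cst].
    have c2 : (fun n => Im (X n x) - Im (f x)) @ \oo --> Im (g x) - Im (f x).
      by apply: cvgB; [exact: cI|exact: cvg_cst].
    rewrite !expr2; apply: cvgD; exact: cvgM.
  - apply: filterS SC => n; apply: le_trans.
    apply: n2_le; [exact: l2B|exact: l2B|].
    by apply: filterS (XS n) => x ->.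
have lg : l2 P g.
  have [] := fat (S 0%N) (4 * q 0%N ^+ 2) (lS 0%N) _.
    by apply: nearW => n; exact: SS.
  move=> i1 _; have lgS : l2 P (fun x => g x - S 0%N x).
    by split=> //; apply: cmeasD => //; apply: cmeasN; case: (lS 0%N).
  have := l2D lgS (lS 0%N); rewrite (_ : (fun x => _) = g)//.
  by apply/funext => x; rewrite subrK.
by exists g => // f C lf /(fat _ _ lf)[].
Qed.

(** Partial sums over sets whose tails are at most 4^-n converge at the rate asked by [l2_complete],
    since two tails give 2 (4^-m + 4^-n) <= 4 * 4^-n for n <= m. *)
Lemma riesz_fischer (c : I -> R[i]) (C : R) : bnd (fun k => N (c k) ^+ 2) C ->
  exists2 g, l2 P g & (forall k, fco g k = c k) /\ n2 P g <= C.
Proof.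
move=> cC; pose q n : R := 2^-1 ^+ n.
have q0 n : 0 < q n by exact: half_gt0.
have /choice[K_ /all_and2[uK tK]] (n : nat) : exists K : seq I, uniq K /\
    forall L, uniq L -> (forall k, k \in L -> k \notin K) ->
      \sum_(k <- L) N (c k) ^+ 2 <= q n ^+ 2.
  by have [|K uK tK] := bnd_tail (e := q n ^+ 2) cC; [exact: exprn_gt0|exists K].
pose S n := tpoly (K_ n) c.
have lS n : l2 P (S n) by exact: tpoly_l2.
have qle n m : (n <= m)%N -> q m <= q n.
  by move=> nm; rewrite /q ler_wiXn2l ?invr_ge0// invf_le1 ?ler1n.
have SS n m : (n <= m)%N -> n2 P (fun x => S m x - S n x) <= 4 * q n ^+ 2.
  move=> nm; apply: (le_trans (n2_tpolyB (uK m) (uK n) (tK m) (tK n))).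
  have : q m ^+ 2 <= q n ^+ 2 by rewrite lerXn2r ?nnegrE ?(ltW (q0 _))// qle.
  lra.
have [g lg gS] := l2_complete lS SS.
exists g => //; split; last first.
  have := gS (fun=> 0) C (l2_cst P 0); rewrite (_ : (fun x => g x - 0) = g); last first.
    by apply/funext => x; rewrite subr0.
  apply; apply: nearW => n; rewrite (_ : (fun x => _ - 0) = S n); last first.
    by apply/funext => x; rewrite subr0.
  by rewrite n2_tpoly//; exact: cC.
move=> k.
(* Passing from [g] to [S n] costs 5 q by [cintM_le] with weight 1 / q. Passing from [S n] to [c]
   costs nothing if [k] is in [K_ n], and otherwise [c k] belongs to the tail. *)
have key n : N (fco g k - c k) <= 10 * q n.
  have nY : n2 P (fun x => g x - S n x) <= 4 * q n ^+ 2.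
    by apply: gS => //; exists n => // m /= nm; exact: SS.
  have lY := l2B lg (lS n).
  have iY : cible P (fun x => g x - S n x) by exact: l2_cible.
  have h1 : N (fco g k - fco (S n) k) <= 5 * q n.
    rewrite -(fcoB e_meas e_norm k (l2_cible lg) (l2_cible (lS n))).
    have le := l2_conj (e_l2 P e_meas e_norm k).
    have qV : 0 < (q n)^-1 by rewrite invr_gt0.
    apply: (le_trans (cintM_le qV lY le)).
    rewrite invrK {2}/n2; under [X in q n * X]eq_Rintegral do rewrite normc_conj e_norm expr1n.
    rewrite Rint_cst mulr1.
    have : (q n)^-1 * n2 P (fun x => g x - S n x) <= (q n)^-1 * (4 * q n ^+ 2) by rewrite ler_pM2l ?invr_gt0.
    rewrite (_ : _^-1 * (4 * _) = 4 * q n); last by rewrite mulrCA expr2 mulKf ?gt_eqF.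
    lra.
  have h3 : N (fco (S n) k - c k) <= q n.
    rewrite fco_tpoly//; case: ifPn => kK; first by rewrite subrr Normc.normc0 ltW.
    rewrite sub0r complex.normcN -(@ler_pXn2r _ 2)// ?nnegrE ?normc_ge0 ?(ltW (q0 n))//.
    have := tK n [:: k]; rewrite big_seq1; apply=> // l.
    by rewrite inE => /eqP ->.
  have -> : fco g k - c k = (fco g k - fco (S n) k) + (fco (S n) k - c k) by ring.
  apply: (le_trans (complex.le_normcD _ _)); have := q0 n; lra.
apply/eqP; rewrite -subr_eq0; apply/eqP/Normc.eq0_normc/eqP.
rewrite eq_le normc_ge0 andbT.
have : (fun n => 10 * q n) @ \oo --> (10 * 0 : R).
  by apply: cvgMr; apply: cvg_expr; rewrite ger0_norm// invf_lt1 ?ltr1n.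
rewrite mulr0 => /(ler_cvg_to (@cvg_cst _ _ _ _ _)); apply.
exact: nearW.
Qed.

End riesz_fischer.

(** * Orthonormality of the characters *)

Section circle.
Context {R : realType}.

Lemma sin_cos_add_int (x : R) (m : int) :
  cos (x + m%:~R * (2 * pi)) = cos x /\ sin (x + m%:~R * (2 * pi)) = sin x.
Proof.
have nat_case (n : nat) y : cos (y + n%:R * (2 * pi)) = cos y :> R /\ sin (y + n%:R * (2 * pi)) = sin y.
  elim: n y => [|n IH] y; first by rewrite mul0r addr0.
  have -> : y + n.+1%:R * (2 * pi) = (y + n%:R * (2 * pi)) + pi + pi :> R.
    by rewrite -natr1; ring.
  by rewrite !cosDpi !sinDpi !opprK.
case: m => n; first exact: nat_case.
have [c s] := nat_case n.+1 (x + (Negz n)%:~R * (2 * pi)).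
have e : x + (Negz n)%:~R * (2 * pi) + n.+1%:R * (2 * pi) = x.
  by rewrite NegzE mulrNz -pmulrn mulNr subrK.
by rewrite e in c s.
Qed.

(** Adding 1 keeps the integrand nonnegative, as the uniform integral and Tonelli's theorem ask. The
    phase [t] will absorb the other coordinates of the torus. *)
Lemma integral_circle_cos (m : int) (t : R) : m != 0 ->
  (\int[circle_prob]_x (1 + cos (m%:~R * (x : R) + t))%:E = 1)%E.
Proof.
move=> m0; have mR : m%:~R != 0 :> R by rewrite intr_eq0.
have cc : continuous (fun x : R => 1 + cos (m%:~R * x + t)).
  move=> x; apply: cvgD; first exact: cvg_cst.
  apply: continuous_cvg; first exact: continuous_cos.
  apply: cvgD; last exact: cvg_cst.
  by apply: cvgM; [exact: cvg_cst|exact: cvg_id].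
rewrite integral_uniform; first last.
- by move=> x; rewrite lee_fin; have := cos_geN1 (m%:~R * x + t); lra.
- by apply/measurable_EFinP; exact: continuous_measurable_fun.
pose F (x : R) : R := x + m%:~R^-1 * sin (m%:~R * x + t).
have dF (x : R) : is_derive x 1 F (1 + cos (m%:~R * x + t)).
  have h1 := is_deriveD (is_deriveZ m%:~R (is_derive_id x 1)) (is_derive_cst t x 1).
  have h2 := @is_derive1_comp _ sin (m%:~R \*: id + cst t) x _ _ (is_derive_sin _) h1.
  have h3 := is_deriveD (is_derive_id x 1) (is_deriveZ m%:~R^-1 h2).
  apply: (is_derive_eq h3); rewrite /GRing.scale/= addr0 mulr1.
  by rewrite mulrCA mulVf ?mulr1.
rewrite (@continuous_FTC2 _ _ F)//.
- rewrite /F -EFinB -EFinM; congr EFin.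
  rewrite subr0 mulr0 !add0r (addrC (_ * _) t) (sin_cos_add_int t m).2 addrK.
  by rewrite mulVf// gt_eqF// mulr_gt0// pi_gt0.
- by rewrite mulr_gt0// pi_gt0.
- by apply: continuous_subspaceT => x; exact: cc.
- have cF x : F y @[y --> x] --> F x.
    by apply: differentiable_continuous; apply/derivable1_diffP; case: (dF x).
  split.
  + by move=> x _; case: (dF x).
  + exact/cvg_at_right_filter/cF.
  + exact/cvg_at_left_filter/cF.
- by move=> x _; rewrite derive1E; have [_] := dF x.
Qed.

(** Discarding the endpoints makes sin (x / 2) strictly positive, which [null_set_ray] relies on. *)
Lemma circle_prob_ae : circle_prob (~` [set x : R | 0 < x < 2 * pi]) = 0%E.
Proof.
rewrite /circle_prob/= /uniform_prob integral_uniform_pdf.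
have mS (x : R) : measurable ([set x] : set R) by exact: measurable_set1.
have mI : measurable [set x : R | 0 < x < 2 * pi].
  rewrite (_ : [set x | _] = `]0, 2 * pi[%classic); first exact: measurable_itv.
  by apply/seteqP; split => x /=; rewrite in_itv.
apply: null_set_integral.
- by apply: measurableI => //; exact: measurableC.
- apply: measurable_funTS; apply/measurable_EFinP; exact: measurable_uniform_pdf.
- apply/eqP; rewrite eq_le measure_ge0 andbT.
  apply: (@le_trans _ _ (lebesgue_measure ([set 0] `|` [set 2 * pi] : set R))).
    apply: le_measure; rewrite ?inE.
    + by apply: measurableI => //; exact: measurableC.
    + exact: measurableU.
    + move=> x /= [/negP]; rewrite in_itv/= negb_and -!leNgt => /orP[] h /andP[h1 h2].
        by left; apply/eqP; rewrite eq_le h h1.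
      by right; apply/eqP; rewrite eq_le h h2.
  apply: (le_trans (measureU2 _ _ _)) => //.
  rewrite -[leRHS]adde0; apply: leeD.
    by rewrite (_ : _ [set _] = 0%E)//; exact: lebesgue_measure_set1.
  by rewrite (_ : _ [set _] = 0%E)//; exact: lebesgue_measure_set1.
Qed.

End circle.

Section torus.
Context {R : realType}.

Definition dotk {d} (k : 'rV[int]_d) (x : torus R d) : R :=
  \sum_(j < d) (k 0 j)%:~R * (tnth x j : R).

Lemma measurable_dotk d (k : 'rV[int]_d) : measurable_fun setT (@dotk d k).
Proof.
apply: measurable_sum => j; apply: measurable_funM; first exact: measurable_cst.
exact: measurable_tnth.
Qed.

Lemma measurable_cos_dotk d (k : 'rV[int]_d) t : measurable_fun setT (fun x => cos (dotk k x + t)).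
Proof.
apply: (measurableT_comp (f := cos)).
  by apply: continuous_measurable_fun; exact: continuous_cos.
by apply: measurable_funD; [exact: measurable_dotk|exact: measurable_cst].
Qed.

Lemma torus_probS_ge0 d (f : torus R d.+1 -> \bar R) : measurable_fun setT f ->
  (forall x, 0 <= f x)%E ->
  (\int[torus_prob d.+1]_x f x = \int[circle_prob]_a \int[torus_prob d]_x f (tcons (a, x)))%E /\
  (\int[torus_prob d.+1]_x f x = \int[torus_prob d]_x \int[circle_prob]_a f (tcons (a, x)))%E.
Proof.
move=> mf f0.
have mft : measurable_fun setT (f \o @tcons R d).
  by apply: measurableT_comp => //; exact: measurable_tcons.
have e : (\int[torus_prob d.+1]_x f x = \int[circle_prob]_a \int[torus_prob d]_x f (tcons (a, x)))%E.
  rewrite /= ge0_integral_distribution//=.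
  exact: (fubini_tonelli1 (f \o @tcons R d) mft (fun z => f0 _)).
split=> //; rewrite e.
exact: (fubini_tonelli (f \o @tcons R d) mft (fun z => f0 _)).
Qed.

(** If the tail of [k] is nonzero, it is integrated first and the first coordinate goes into the
    phase. Otherwise the first entry is nonzero and the circle integral comes first. *)
Lemma integral_torus_cos d (k : 'rV[int]_d) t : k != 0 ->
  (\int[torus_prob d]_x (1 + cos (dotk k x + t))%:E = 1)%E.
Proof.
elim: d k t => [|d IH] k t k0.
  by rewrite (_ : k = 0) ?eqxx// in k0; apply/rowP => -[].
have dE (a : R) (x : torus R d) :
    dotk k (tcons (a, x)) = (k 0 ord0)%:~R * a + dotk (\row_j k 0 (lift ord0 j)) x.
  rewrite /dotk big_ord_recl; congr (_ * _ + _).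
  by apply: eq_bigr => j _; rewrite mxE tnthS.
have mf : measurable_fun setT (fun x : torus R d.+1 => (1 + cos (dotk k x + t))%:E).
  apply/measurable_EFinP; apply: measurable_funD; first exact: measurable_cst.
  exact: measurable_cos_dotk.
have f0 (x : torus R d.+1) : (0 <= (1 + cos (dotk k x + t))%:E)%E.
  by rewrite lee_fin; have := cos_geN1 (dotk k x + t); lra.
have [e1 e2] := torus_probS_ge0 mf f0.
have [k'0|k'0] := eqVneq (\row_j k 0 (lift ord0 j)) 0; last first.
  rewrite e1 (eq_integral (fun=> 1%E)); last first.
    move=> a _; rewrite -[RHS](IH _ ((k 0 ord0)%:~R * a + t) k'0).
    by apply: eq_integral => x _; rewrite ?dE; congr (_ + cos _)%:E; ring.
  by rewrite integral_cst//= probability_setT mule1.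
have k00 : k 0 ord0 != 0.
  apply: contraNneq k0 => k00; apply/eqP/rowP => j; rewrite mxE.
  have [j' ->|->//] := unliftP ord0 j.
  by have /rowP/(_ j') := k'0; rewrite !mxE.
rewrite e2 (eq_integral (fun=> 1%E)); first by rewrite integral_cst//= probability_setT mule1.
move=> x _; rewrite -[RHS](integral_circle_cos (dotk (\row_j k 0 (lift ord0 j)) x + t) k00).
by apply: eq_integral => a _; rewrite dE addrA.
Qed.

Lemma torus_ae d (j : 'I_d) : {ae torus_prob d, forall x : torus R d, 0 < (tnth x j : R) < 2 * pi}.
Proof.
have mI : measurable [set x : R | 0 < x < 2 * pi].
  rewrite (_ : [set x | _] = `]0, 2 * pi[%classic); first exact: measurable_itv.
  by apply/seteqP; split => x /=; rewrite in_itv.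
suff h : torus_prob d ((fun x : torus R d => tnth x j) @^-1` (~` [set x : R | 0 < x < 2 * pi])) = 0%E.
  exists ((fun x : torus R d => tnth x j) @^-1` (~` [set x : R | 0 < x < 2 * pi])); split => //.
  rewrite -[_ @^-1` _]setTI; apply: measurable_tnth => //; exact: measurableC.
elim: d j => [|d IH] j; first by case: j.
set B := ~` _; have mB : measurable (B : set (measurableTypeR R)) by exact: measurableC.
rewrite /= /distribution /pushforward/=.
have [j'|] := unliftP ord0 j => [->|->].
  rewrite (_ : _ @^-1` _ = setT `*` ((fun x : torus R d => tnth x j') @^-1` B)).
    rewrite product_measure1E//; last first.
      by rewrite -[_ @^-1` _]setTI; exact: measurable_tnth.
    by rewrite -[RHS](mule0 (circle_prob setT)); congr (_ * _)%E; exact: IH.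
  by apply/seteqP; split=> -[a x] /=; rewrite /B/= tnthS//; case.
rewrite (_ : _ @^-1` _ = B `*` setT).
  by rewrite product_measure1E//= circle_prob_ae mul0e.
by apply/seteqP; split=> -[a x] //= [].
Qed.

End torus.

(** * Completeness of the characters *)

Section completeness.
Context {R : realType} {d : nat}.
Local Notation P := (@torus_prob R d).
Implicit Types (f g h : torus R d -> R) (k l : 'rV[int]_d).

(** Letting the phase range over all reals covers sines and cosines at once. *)
Definition fourier_null f :=
  ible P f /\ forall k t, \int[P]_x (f x * cos (dotk k x + t)) = 0.

Definition bounded_meas g := measurable_fun setT g /\ exists B, forall x, `|g x| <= B.

(** Completeness is a monotone class argument on these functions. They form an algebra that contains
    the trigonometric polynomials and is closed under bounded pointwise limits; it is shown to
    contain the indicators of rays, hence of all measurable sets. A Fourier-null function then has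
    zero integral over every measurable set. *)
Definition null_multiplier g :=
  bounded_meas g /\ forall f, fourier_null f -> fourier_null (fun x => f x * g x).

Lemma ible_bounded f g : ible P f -> bounded_meas g -> ible P (fun x => f x * g x).
Proof.
move=> if_ [mg [B gB]]; apply: (ible_le (v := fun x => B * `|f x|)).
- by apply: measurable_funM => //; exact: ible_meas if_.
- by move=> x; rewrite normrM mulrC ler_wpM2r.
- by apply: ibleZ; exact: ible_norm.
Qed.

Lemma bounded_cos k t : bounded_meas (fun x => cos (dotk k x + t)).
Proof.
split; first exact: measurable_cos_dotk.
by exists 1 => x; rewrite ler_norml cos_geN1 cos_le1.
Qed.

Lemma dotkD k l (x : torus R d) : dotk (k + l) x = dotk k x + dotk l x.
Proof.
by rewrite -big_split/=; apply: eq_bigr => j _; rewrite mxE rmorphD mulrDl.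
Qed.

Lemma dotkN k (x : torus R d) : dotk (- k) x = - dotk k x.
Proof.
by rewrite -sumrN; apply: eq_bigr => j _; rewrite mxE rmorphN mulNr.
Qed.

(** The product-to-sum formula turns a product of two cosines into cosines at the frequencies k + l
    and k - l, against which [f] integrates to zero. *)
Lemma null_multiplier_cos l s : null_multiplier (fun x => cos (dotk l x + s)).
Proof.
split; first exact: bounded_cos.
move=> f [if_ nf]; split; first by apply: ible_bounded => //; exact: bounded_cos.
move=> k t.
have e x : f x * cos (dotk l x + s) * cos (dotk k x + t) =
    2^-1 * (f x * cos (dotk (k + l) x + (t + s))) + 2^-1 * (f x * cos (dotk (k - l) x + (t - s))).
  rewrite !dotkD dotkN.
  rewrite (_ : dotk k x + dotk l x + (t + s) = (dotk k x + t) + (dotk l x + s)); last by ring.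
  rewrite (_ : dotk k x - dotk l x + (t - s) = (dotk k x + t) - (dotk l x + s)); last by ring.
  by move: (dotk k x + t) (dotk l x + s) => u v; rewrite cosD cosB; field.
under eq_fun do rewrite e.
have i1 m r : ible P (fun x => f x * cos (dotk m x + r)).
  by apply: ible_bounded => //; exact: bounded_cos.
by rewrite RintD ?RintZ//; [rewrite !nf !mulr0 addr0|exact: ibleZ..].
Qed.

Lemma null_multiplier_cst c : null_multiplier (fun=> c).
Proof.
split; first by split; [exact: measurable_cst|exists `|c|].
move=> f [if_ nf]; split; first by under eq_fun do rewrite mulrC; exact: ibleZ.
move=> k t; under eq_fun do rewrite mulrAC mulrC.
rewrite RintZ ?nf ?mulr0//.
by apply: ible_bounded => //; exact: bounded_cos.
Qed.

Lemma null_multiplierM g h : null_multiplier g -> null_multiplier h ->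
  null_multiplier (fun x => g x * h x).
Proof.
move=> [[mg [B gB]] ng] [[mh [C hC]] nh]; split.
  split; first exact: measurable_funM.
  by exists (B * C) => x; rewrite normrM ler_pM.
move=> f /ng/nh; by under eq_fun do rewrite -mulrA.
Qed.

Lemma null_multiplierD g h : null_multiplier g -> null_multiplier h ->
  null_multiplier (fun x => g x + h x).
Proof.
move=> [[mg [B gB]] ng] [[mh [C hC]] nh]; split.
  split; first exact: measurable_funD.
  by exists (B + C) => x; rewrite (le_trans (ler_normD _ _))// lerD.
move=> f nf; have [ig fg] := ng _ nf; have [ih fh] := nh _ nf.
under eq_fun do rewrite mulrDr; split; first exact: ibleD.
move=> k t; under eq_fun do rewrite mulrDl.
rewrite RintD ?fg ?fh ?addr0//; apply: ible_bounded => //; exact: bounded_cos.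
Qed.

Lemma null_multiplier_prod (g_ : nat -> torus R d -> R) n :
  (forall i, null_multiplier (g_ i)) -> null_multiplier (fun x => \prod_(i < n) g_ i x).
Proof.
move=> gn; elim: n => [|n IH].
  by under eq_fun do rewrite big_ord0; exact: null_multiplier_cst.
by under eq_fun do rewrite big_ord_recr; exact: null_multiplierM.
Qed.

Lemma null_multiplierB g h : null_multiplier g -> null_multiplier h ->
  null_multiplier (fun x => g x - h x).
Proof.
move=> ng nh; apply: null_multiplierD => //; under eq_fun do rewrite -mulN1r.
by apply: null_multiplierM => //; exact: null_multiplier_cst.
Qed.

Lemma null_multiplier_ae g h : bounded_meas h -> {ae P, forall x, g x = h x} ->
  null_multiplier g -> null_multiplier h.
Proof.
move=> bh gh [[mg bg] ng]; split=> // f nf.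
have [ig fg] := ng _ nf; have mf := ible_meas nf.1.
have mcos k t := (bounded_cos k t).1.
have mh := bh.1.
split; first by apply: ible_bounded => //; exact: nf.1.
move=> k t; rewrite -(fg k t); apply: Rintegral_ae.
- by apply: measurable_funM => //; exact: measurable_funM.
- by apply: measurable_funM => //; exact: measurable_funM.
- by apply: filterS gh => x ->.
Qed.

(** Dominated convergence, with B |f| as dominating function. *)
Lemma null_multiplier_cvg (g_ : nat -> torus R d -> R) g B :
  (forall n, null_multiplier (g_ n)) -> (forall n x, `|g_ n x| <= B) ->
  (forall x, g_ ^~ x @ \oo --> g x) -> null_multiplier g.
Proof.
move=> ng gB cg.
have mg_ n : measurable_fun setT (g_ n) by case: (ng n) => -[].
have mg : measurable_fun setT g by apply: measurable_fun_cvg => // x _; exact: cg.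
have bg x : `|g x| <= B.
  have cn : (fun n => `|g_ n x|) @ \oo --> `|g x| by apply: cvg_norm; exact: cg.
  by apply: (ler_cvg_to cn (@cvg_cst _ _ _ _ _)); exact: nearW.
split; first by split=> //; exists B.
move=> f nf; have mf := ible_meas nf.1.
split; first by apply: ible_bounded nf.1 _; split=> //; exists B.
move=> k t; set c := fun x => cos (dotk k x + t).
have [mc bc] : bounded_meas c by exact: bounded_cos.
have c1 x : `|c x| <= 1 by rewrite ler_norml cos_geN1 cos_le1.
have B0 : 0 <= B by exact: le_trans (normr_ge0 _) (bg point).
have mn n : measurable_fun setT (fun x => (f x * g_ n x * c x)%:E).
  by apply/measurable_EFinP; apply: measurable_funM => //; exact: measurable_funM.
have ml : measurable_fun setT (fun x => (f x * g x * c x)%:E).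
  by apply/measurable_EFinP; apply: measurable_funM => //; exact: measurable_funM.
have iG : P.-integrable setT (EFin \o (fun x => B * `|f x|)).
  by apply: ibleZ; exact: ible_norm nf.1.
have [] := @dominated_convergence _ _ _ P setT measurableT _ _ _ mn ml _ iG _.
- apply: aeW => x _; apply: cvg_EFin; first exact: nearW.
  by apply: cvgM; [apply: cvgM; [exact: cvg_cst|exact: cg]|exact: cvg_cst].
- apply: aeW => x n _ /=; rewrite lee_fin !normrM mulrAC mulrC ler_pM//.
  by rewrite ler_piMr.
move=> _ _ cI.
have z n : (\int[P]_x (f x * g_ n x * c x)%:E = 0)%E.
  have [ifg fg] := (ng n).2 _ nf.
  have := fg k t; rewrite /Rintegral -/(c _) => e.
  rewrite -[LHS]fineK ?e//; apply: integrable_fin_num => //.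
  by apply: (ible_bounded ifg); exact: bounded_cos.
have := cvg_lim _ cI; rewrite /Rintegral -/c => <-//.
under eq_fun do rewrite z.
by rewrite lim_cst.
Qed.

(** The Newton-Schulz iteration for the sign function. *)
Definition sgn_step (y : R) : R := (3 * y - y ^+ 3) / 2.

Lemma sgn_step_bound y : `|y| <= 1 -> `|sgn_step y| <= 1.
Proof.
rewrite !ler_norml /sgn_step => /andP[h1 h2].
(* These are 2 (1 - s) and 2 (1 + s) for s = [sgn_step y], each with a double root at an
   endpoint. *)
have h3 : 0 <= (1 - y) ^+ 2 * (2 + y) by rewrite mulr_ge0 ?sqr_ge0//; lra.
have h4 : 0 <= (1 + y) ^+ 2 * (2 - y) by rewrite mulr_ge0 ?sqr_ge0//; lra.
apply/andP; split.
  rewrite -subr_ge0 (_ : _ - _ = 2^-1 * ((1 + y) ^+ 2 * (2 - y))); last by field.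
  by rewrite mulr_ge0.
rewrite -subr_ge0 (_ : _ - _ = 2^-1 * ((1 - y) ^+ 2 * (2 + y))); last by field.
by rewrite mulr_ge0.
Qed.

Lemma iter_sgn_step_bound n y : `|y| <= 1 -> `|iter n sgn_step y| <= 1.
Proof. by elim: n => //= n IH /IH/sgn_step_bound. Qed.

Lemma iter_sgn_stepN n y : iter n sgn_step (- y) = - iter n sgn_step y.
Proof. by elim: n => //= n ->; rewrite /sgn_step; field. Qed.

(* The iterates of [(3 y - y^3) / 2] stay in [-1, 1] and converge to the sign, so the
   sign of a trigonometric polynomial is a bounded limit of trigonometric polynomials. *)
Lemma iter_sgn_step_cvg y : `|y| <= 1 -> (fun n => iter n sgn_step y) @ \oo --> Num.sg y.
Proof.
have pos z : 0 < z -> z <= 1 -> (fun n => iter n sgn_step z) @ \oo --> (1 : R).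
  move=> z0 z1.
  have b n : z <= iter n sgn_step z <= 1.
    elim: n => [|n /=]; first by rewrite /= lexx z1.
    move: (iter n _ _) => w /andP[zw w1].
    have := @sgn_step_bound w; rewrite ler_norml w1 andbT ler_norml (le_trans _ (le_trans (ltW z0) zw)) ?oppr_le0// => /(_ isT)/andP[_ ->].
    rewrite andbT (le_trans zw)// -subr_ge0 /sgn_step.
    rewrite (_ : _ - _ = 2^-1 * w * ((1 - w) * (1 + w))); last by field.
    by rewrite !mulr_ge0//; lra.
  have inc n : iter n sgn_step z <= iter n.+1 sgn_step z.
    have /= := b n; move: (iter n _ _) => w /andP[zw w1].
    rewrite -subr_ge0 /sgn_step.
    rewrite (_ : _ - _ = 2^-1 * w * ((1 - w) * (1 + w))); last by field.
    by rewrite !mulr_ge0//; lra.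
  have cv : cvgn (fun n => iter n sgn_step z).
    apply: nondecreasing_is_cvgn; first exact/nondecreasing_seqP.
    by exists 1 => _ [n _ <-]; case/andP: (b n).
  set l := limn _ in cv; have cl : (fun n => iter n sgn_step z) @ \oo --> l by [].
  have zl : z <= l.
    by apply: (ler_cvg_to (@cvg_cst _ _ _ _ _) cl); apply: nearW => n; case/andP: (b n).
  have l1 : l <= 1.
    by apply: (ler_cvg_to cl (@cvg_cst _ _ _ _ _)); apply: nearW => n; case/andP: (b n).
  have cl' : (fun n => iter n.+1 sgn_step z) @ \oo --> sgn_step l.
    rewrite /= /sgn_step; apply: cvgM; last exact: cvg_cst.
    apply: cvgB; first by apply: cvgM => //; exact: cvg_cst.
    by rewrite !exprS expr0 mulr1; under eq_fun do rewrite !exprS expr0 mulr1; apply: cvgM => //; exact: cvgM.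
  have cS : (fun n => iter n.+1 sgn_step z) @ \oo --> l by rewrite (cvg_shiftS (fun n => iter n sgn_step z)).
  have e : sgn_step l = l by exact: cvg_unique cl' cS.
  suff -> : (1 : R) = l by [].
  (* The fixed points of the iteration are 0, 1 and -1; the bounds z <= l with 0 < z leave only
     1. *)
  have : l * ((1 - l) * (1 + l)) = 0.
    have -> : l * ((1 - l) * (1 + l)) = 2 * (sgn_step l - l) by rewrite /sgn_step; field.
    by rewrite e subrr mulr0.
  move/eqP; rewrite !mulf_eq0 => /or3P[] /eqP; lra.
move=> y1; have [y0|y0|->] := ltgtP y 0.
- have h := @pos (- y); rewrite ltr0_sg//.
  have : (fun n => iter n sgn_step (- y)) @ \oo --> (1 : R).
    by apply: h; [rewrite oppr_gt0|move: y1; rewrite ler_norml => /andP[]; lra].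
  move=> /cvgN; under eq_fun do rewrite iter_sgn_stepN.
  by rewrite (_ : - _ = fun n => iter n sgn_step y)//; apply/funext => n /=; rewrite /GRing.opp/= opprK.
- by rewrite gtr0_sg//; apply: pos => //; move: y1; rewrite ler_norml => /andP[].
- rewrite sgr0 (_ : (fun n => _) = fun=> 0); first exact: cvg_cst.
  by apply/funext; elim=> //= n ->; rewrite /sgn_step expr0n/=; lra.
Qed.

Lemma null_multiplier_sg h : null_multiplier h -> (forall x, `|h x| <= 1) ->
  null_multiplier (fun x => Num.sg (h x)).
Proof.
move=> nh h1; apply: (@null_multiplier_cvg (fun n x => iter n sgn_step (h x)) _ 1).
- elim=> [//|n IH] /=; rewrite /sgn_step.
  apply: null_multiplierM; last exact: null_multiplier_cst.
  apply: null_multiplierB; first by apply: null_multiplierM => //; exact: null_multiplier_cst.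
  under eq_fun do rewrite !exprS expr0 mulr1.
  by apply: null_multiplierM => //; exact: null_multiplierM.
- by move=> n x; exact: iter_sgn_step_bound.
- by move=> x; exact: iter_sgn_step_cvg.
Qed.

Definition null_set (A : set (torus R d)) := measurable A /\ null_multiplier (\1_A).

Lemma bounded_indic (A : set (torus R d)) : measurable A -> bounded_meas (\1_A).
Proof.
move=> mA; split; first exact: measurable_indic.
by exists 1 => x; rewrite indicE; case: (_ \in _); rewrite ?normr1 ?normr0.
Qed.

(** Countable unions go through complements: the indicator of a countable intersection is the limit
    of the finite products of indicators, which stay between 0 and 1. *)
Lemma sigma_algebra_null_set : sigma_algebra setT null_set.
Proof.
have C A : null_set A -> null_set (~` A).
  move=> [mA nA]; split; first exact: measurableC.
  rewrite (_ : \1_(~` A) = fun x => 1 - \1_A x).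
    by apply: null_multiplierB => //; exact: null_multiplier_cst.
  by apply/funext => x; rewrite !indicE in_setC; case: (_ \in _); rewrite ?subr0 ?subrr.
split.
- split=> //; rewrite indic0; exact: null_multiplier_cst.
- by move=> A; rewrite setTD; exact: C.
- move=> F nF; rewrite -[X in null_set X]setCK; apply: (C _); rewrite setC_bigcup; split.
    by apply: bigcapT_measurable => n; apply: measurableC; case: (nF n).
  apply: (@null_multiplier_cvg (fun n x => \prod_(i < n) \1_(~` F i) x) _ 1).
  + by move=> n; apply: (null_multiplier_prod (g_ := fun i => \1_(~` F i))) => i; exact: (C _ (nF i)).2.
  + move=> n x; rewrite normr_prod; elim/big_rec: _ => // i y _ y1.
    by rewrite indicE; case: (_ \in _); rewrite ?normr1 ?normr0 ?mul1r ?mul0r.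
  + move=> x; have [[i Fi]|xF'] := pselect (exists i, F i x); last first.
      have xF n : (~` F n) x by move=> Fn; apply: xF'; exists n.
      rewrite indicE mem_set; last by move=> n _; exact: xF.
      rewrite (_ : (fun n => _) = fun=> 1); first exact: cvg_cst.
      by apply/funext => n; rewrite big1// => i _; rewrite indicE mem_set//; exact: xF.
    rewrite indicE memNset; last by move=> /(_ i Logic.I).
    apply: cvg_near_cst.
    exists i.+1 => // n /= ni; rewrite (bigD1 (Ordinal ni))//= indicE memNset ?mul0r//.
Qed.

(** On (0, 2 pi) the condition y < a is the positivity of the trigonometric polynomial cos (y - a /
    2) - cos (a / 2) = 2 sin (y / 2) sin ((a - y) / 2), whose sign is a null multiplier. *)
Lemma null_set_ray (j : 'I_d) (a : R) : null_set ((fun x : torus R d => tnth x j) @^-1` `]-oo, a[).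
Proof.
have mA : measurable ((fun x : torus R d => tnth x j : R) @^-1` `]-oo, a[).
  by rewrite -[_ @^-1` _]setTI; apply: measurable_tnth => //; exact: measurable_itv.
split=> //; set A := _ @^-1` _ in mA *.
have bA := bounded_indic mA.
have [a0|a0] := leP a 0.
  apply: null_multiplier_ae bA _ (null_multiplier_cst 0).
  apply: filterS (torus_ae j) => x /andP[x0 _]; rewrite indicE memNset// /A/= in_itv/=.
  by apply/negP; rewrite -leNgt (le_trans a0)// ltW.
have [a2|a2] := leP (2 * pi) a.
  apply: null_multiplier_ae bA _ (null_multiplier_cst 1).
  apply: filterS (torus_ae j) => x /andP[_ x0]; rewrite indicE mem_set// /A/= in_itv/=.
  exact: lt_le_trans x0 a2.
pose ej : 'rV[int]_d := \row_i (i == j)%:R.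
have dE (x : torus R d) : dotk ej x = tnth x j.
  rewrite /dotk (bigD1 j)//= mxE eqxx mul1r big1 ?addr0// => i /negbTE ij.
  by rewrite mxE ij mul0r.
(* The factor 1 / 2 brings [h] into [-1, 1], where the iteration converges to the sign. *)
pose h (x : torus R d) : R := 2^-1 * (cos (dotk ej x + - (a / 2)) - cos (a / 2)).
have nh : null_multiplier h.
  apply: null_multiplierM; first exact: null_multiplier_cst.
  by apply: null_multiplierB; [exact: null_multiplier_cos|exact: null_multiplier_cst].
have h1 x : `|h x| <= 1.
  rewrite ler_norml /h; have := cos_geN1 (a / 2); have := cos_le1 (a / 2).
  have := cos_geN1 (dotk ej x + - (a / 2)); have := cos_le1 (dotk ej x + - (a / 2)).
  lra.
have nsg := null_multiplier_sg nh h1.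
(* (s^2 + s) / 2 sends the sign 1 to 1 and both 0 and -1 to 0, so the endpoint y = a falls outside
   the open ray. *)
have : null_multiplier (fun x => 2^-1 * (Num.sg (h x) * Num.sg (h x) + Num.sg (h x))).
  apply: null_multiplierM; first exact: null_multiplier_cst.
  by apply: null_multiplierD => //; exact: null_multiplierM.
apply: null_multiplier_ae bA _.
apply: filterS (torus_ae j) => x /andP[x0 x2].
have hE : h x = sin ((tnth x j : R) / 2) * sin ((a - (tnth x j : R)) / 2).
  rewrite /h dE; set y : R := tnth x j.
  rewrite (_ : y + - (a / 2) = y / 2 - (a - y) / 2); last by field.
  rewrite (_ : a / 2 = y / 2 + (a - y) / 2); last by field.
  by rewrite cosB cosD; field.
have s1 : 0 < sin ((tnth x j : R) / 2) by apply: sin_gt0_pi; lra.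
rewrite indicE; have [ya|ya] := ltP (tnth x j : R) a.
  rewrite mem_set; last by rewrite /A/= in_itv.
  rewrite gtr0_sg; first by rewrite (_ : true%:R = 1 :> R)//; field.
  by rewrite hE mulr_gt0//; apply: sin_gt0_pi; lra.
rewrite memNset; last by rewrite /A/= in_itv/=; apply/negP; rewrite -leNgt.
move: ya; rewrite le_eqVlt => /predU1P[ya|ya].
  by rewrite hE -ya subrr mul0r sin0 mulr0 sgr0 !mulr0 addr0 mulr0.
rewrite ltr0_sg; first by rewrite mulrNN mulr1 subrr mulr0.
rewrite hE pmulr_rlt0// -oppr_gt0 -sinN; apply: sin_gt0_pi; lra.
Qed.

Lemma measurable_null_set (A : set (torus R d)) : measurable A -> null_set A.
Proof.
move=> mA; apply: (smallest_sub sigma_algebra_null_set _ mA).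
have s0 := sigma_algebra_null_set.
move=> B; rewrite -bigcup_seq /= => -[j _] /= [C mC <-]; rewrite setTI.
have := mC; rewrite RGenInftyO.measurableE.
move=> mC'.
apply: (@smallest_sub _ (sigma_algebra setT) (@RGenInftyO.G R)
  [set C : set R | null_set ((fun x : torus R d => tnth x j) @^-1` C)] _ _ _ mC').
- case: s0 => s0 sC sU; split.
  + by rewrite /= preimage_set0.
  + by move=> E /= /sC; rewrite !setTD preimage_setC.
  + by move=> F nF /=; rewrite preimage_bigcup; exact: sU.
- by move=> _ [a ->] /=; exact: null_set_ray.
Qed.

(** Multiplied by the indicator of a measurable set, [f] remains Fourier-null; frequency 0 and phase
    0 then give its integral over that set. *)
Lemma fourier_null_ae f : fourier_null f -> {ae P, forall x, f x = 0}.
Proof.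
move=> nf.
have := @integral_ae_eq _ _ _ P setT measurableT (cst 0%E) (EFin \o f) nf.1 _ _.
case=> [|E _ mE|B [mB B0 hB]].
- exact: measurable_cst.
- have [iE hE] := (measurable_null_set mE).2.2 _ nf.
  rewrite integral0 integral_mkcond.
  have := hE 0 0; rewrite /Rintegral.
  rewrite (_ : (fun x => _) = (fun x => ((EFin \o f) \_ E) x)); last first.
    apply/funext => x; rewrite /dotk big1; last by move=> i _; rewrite mxE mul0r.
    rewrite add0r cos0 mulr1 patchE indicE; case: ifP => _; first by rewrite mulr1.
    by rewrite mulr0.
  move=> h; rewrite -[LHS]fineK ?h//; apply: integrable_fin_num => //.
  apply: eq_integrable iE => // x _ /=.
  by rewrite patchE indicE; case: ifP => _; rewrite ?mulr1 ?mulr0.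
- exists B; split=> // x nx; apply: hB => /= h; apply: nx.
  by have [] := h Logic.I.
Qed.

End completeness.

Local Arguments Normc.normc {R} x : simpl never.
Local Arguments fourier : simpl never.
Local Arguments character : simpl never.
Local Arguments cexp : simpl never.
Local Arguments phi1 : simpl never.
Local Arguments phi2 : simpl never.

(** * Fourier series *)

Section torus_fourier.
Context {R : realType} {d : nat}.
Local Notation P := (@torus_prob R d).
Local Notation I := 'rV[int]_d.
Local Notation fc := (@fourier R d).
Implicit Types (f g h : torus R d -> R[i]) (k l : I).

Lemma characterE k (x : torus R d) : character k x = cos (dotk k x) +i* sin (dotk k x).
Proof.
rewrite /character /cexp -/(dotk k x) cReM cImM /= !mul0r !mul1r subr0 add0r expR0.
by rewrite (_ : 1%:C = 1)// mul1r.
Qed.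

Lemma normc_character k (x : torus R d) : N (character k x) = 1.
Proof. by rewrite characterE /Normc.normc cos2Dsin2 sqrtr1. Qed.

Lemma measurable_character k : cmeas (character k : torus R d -> R[i]).
Proof.
split; under eq_fun do rewrite characterE/=.
  by under eq_fun do rewrite -[dotk _ _]addr0; exact: measurable_cos_dotk.
under eq_fun do rewrite -cosBpihalf; exact: measurable_cos_dotk.
Qed.

Lemma characterD k l (x : torus R d) : character (k + l) x = character k x * character l x.
Proof.
by rewrite !characterE dotkD cosD sinD; apply: complex_eq; rewrite ?ReImE/= // addrC.
Qed.

Lemma characterN k (x : torus R d) : character (- k) x = (character k x)^*.
Proof. by rewrite !characterE dotkN cosN sinN. Qed.

Lemma Rintegral_torus_cos k t : k != 0 -> \int[P]_x cos (dotk k x + t) = 0 :> R.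
Proof.
move=> k0; have := integral_torus_cos (R := R) t k0 => e.
have ic : ible P (fun x => cos (dotk k x + t)).
  have := ible_bounded (ible_cst P 1) (bounded_cos k t).
  by under eq_fun do rewrite mul1r.
have : \int[P]_x (1 + cos (dotk k x + t)) = 1 by rewrite /Rintegral e.
rewrite RintD//; last exact: ible_cst.
rewrite Rint_cst; lra.
Qed.

Lemma character_orth k l : cint P (fun x => character k x * (character l x)^*) = (k == l)%:R.
Proof.
under eq_fun do rewrite -characterN -characterD characterE.
have [->|kl] := eqVneq k l.
  apply: complex_eq; rewrite /= subrr.
    rewrite -[RHS](Rint_cst P 1); apply: eq_Rintegral => x _.
    by rewrite /dotk big1 ?cos0// => i _; rewrite mxE mul0r.
  rewrite -[RHS](Rint_cst P 0); apply: eq_Rintegral => x _.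
  by rewrite /dotk big1 ?sin0// => i _; rewrite mxE mul0r.
have kl0 : k - l != 0 by rewrite subr_eq0.
apply: complex_eq => /=.
  by rewrite -[RHS](Rintegral_torus_cos 0 kl0); apply: eq_Rintegral => x _; rewrite addr0.
by rewrite -[RHS](Rintegral_torus_cos (- (pi / 2)) kl0); apply: eq_Rintegral => x _; rewrite cosBpihalf.
Qed.

Lemma fourierE f k : fc f k = fco P character f k.
Proof. by []. Qed.

Lemma fourierD f g k : cible P f -> cible P g -> fc (fun x => f x + g x) k = fc f k + fc g k.
Proof. exact: (fcoD measurable_character normc_character). Qed.

Lemma fourierB f g k : cible P f -> cible P g -> fc (fun x => f x - g x) k = fc f k - fc g k.
Proof. exact: (fcoB measurable_character normc_character). Qed.

Lemma fourierZ c f k : cible P f -> fc (fun x => c * f x) k = c * fc f k.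
Proof. exact: (fcoZ measurable_character normc_character). Qed.

Lemma normc_fourier f k : cible P f -> N (fc f k) <= \int[P]_x N (f x).
Proof. exact: (normc_fco measurable_character normc_character). Qed.

Lemma fourier_conj f k : cible P f -> fc (conj_fun f) k = (fc f (- k))^*.
Proof.
move=> if_; rewrite /fourier /cintegral -/(cint P _) -/(cint P (fun x => f x * _)) -cint_conj.
  by congr cint; apply/funext => x; rewrite characterN conjcK; exact: esym (rmorphM (@conjc R) (f x) (character k x)).
exact: (cibleM_e measurable_character normc_character).
Qed.

(** Each complex coefficient mixes the real and imaginary parts of [f]. Comparing the frequencies
    [k] and [- k], under which cosines are even and sines odd, separates them. *)
Lemma fourier_eq0 f : cible P f -> (forall k, fc f k = 0) -> {ae P, forall x, f x = 0}.
Proof.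
move=> [i1 i2] f0; set c := fun k (x : torus R d) => cos (dotk k x + 0).
set s := fun k (x : torus R d) => cos (dotk k x + - (pi / 2)).
have ic u k t : ible P u -> ible P (fun x => u x * cos (dotk k x + t)).
  by move=> iu; apply: ible_bounded => //; exact: bounded_cos.
have cE k (x : torus R d) : cos (dotk k x) = c k x by rewrite /c addr0.
have sE k (x : torus R d) : sin (dotk k x) = s k x by rewrite /s cosBpihalf.
have eR k : \int[P]_x (Re (f x) * c k x) + \int[P]_x (Im (f x) * s k x) = 0.
  have <- : Re (fc f k) = 0 by rewrite f0.
  rewrite -RintD; [|exact: ic..].
  change (\int[P]_x (Re (f x) * c k x + Im (f x) * s k x) = \int[P]_x Re (f x * conjc (character k x))).
  by apply: eq_Rintegral => x _; rewrite characterE ReImE/= cE sE mulrN opprK.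
have eI k : \int[P]_x (Im (f x) * c k x) - \int[P]_x (Re (f x) * s k x) = 0.
  have <- : Im (fc f k) = 0 by rewrite f0.
  rewrite -mulN1r -RintZ; last exact: ic.
  rewrite -RintD; [|exact: ic|by apply: ibleZ; exact: ic].
  change (\int[P]_x (Im (f x) * c k x + -1 * (Re (f x) * s k x)) = \int[P]_x Im (f x * conjc (character k x))).
  by apply: eq_Rintegral => x _; rewrite characterE ReImE/= cE sE mulN1r mulrN addrC.
have cN k (x : torus R d) : c (- k) x = c k x by rewrite -!cE dotkN cosN.
have sN k (x : torus R d) : s (- k) x = - s k x by rewrite -!sE dotkN sinN.
have IN u k : ible P u -> \int[P]_x (u x * s (- k) x) = - \int[P]_x (u x * s k x).
  move=> iu; rewrite -mulN1r -RintZ; last exact: ic.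
  by apply: eq_Rintegral => x _; rewrite sN mulN1r mulrN.
have IC u k : \int[P]_x (u x * c (- k) x) = \int[P]_x (u x * c k x).
  by apply: eq_Rintegral => x _; rewrite cN.
have nul u : ible P u -> (forall k, \int[P]_x (u x * c k x) = 0) ->
    (forall k, \int[P]_x (u x * s k x) = 0) -> fourier_null u.
  move=> iu uc us; split=> // k t.
  rewrite -[RHS](_ : cos t * \int[P]_x (u x * c k x) + - sin t * \int[P]_x (u x * s k x) = 0).
    rewrite -!RintZ; [|exact: ic..]; rewrite -RintD; [|by apply: ibleZ; exact: ic..].
    by apply: eq_Rintegral => x _; rewrite -cE -sE cosD; ring.
  by rewrite uc us !mulr0 addr0.
have h1 k : \int[P]_x (Re (f x) * c k x) = 0.
  have := eR k; have := eR (- k); rewrite IN// IC; lra.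
have h2 k : \int[P]_x (Im (f x) * s k x) = 0 by have := eR k; rewrite h1 add0r.
have h3 k : \int[P]_x (Im (f x) * c k x) = 0.
  have := eI k; have := eI (- k); rewrite IN// IC; lra.
have h4 k : \int[P]_x (Re (f x) * s k x) = 0.
  have := eI k; rewrite h3; lra.
have a1 := fourier_null_ae (nul _ i1 h1 h4).
have a2 := fourier_null_ae (nul _ i2 h3 h2).
by apply: filterS2 a1 a2 => x e1 e2; exact: complex_eq.
Qed.

Lemma fourier_inj f g : cible P f -> cible P g -> (forall k, fc f k = fc g k) ->
  {ae P, forall x, f x = g x}.
Proof.
move=> if_ ig fg.
have ifg : cible P (fun x => f x - g x).
  by apply: cibleD => //; under eq_fun do rewrite -mulN1r; exact: cibleZ.
have : forall k, fc (fun x => f x - g x) k = 0 by move=> k; rewrite fourierB// fg subrr.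
by move=> /(fourier_eq0 ifg); apply: filterS => x /eqP; rewrite subr_eq0 => /eqP.
Qed.

Lemma bessel_torus f : l2 P f -> bnd (fun k => N (fc f k) ^+ 2) (n2 P f).
Proof. exact: (bessel measurable_character normc_character character_orth). Qed.

Lemma riesz_fischer_torus (c : I -> R[i]) C : bnd (fun k => N (c k) ^+ 2) C ->
  exists2 g, l2 P g & (forall k, fc g k = c k) /\ n2 P g <= C.
Proof. exact: (riesz_fischer measurable_character normc_character character_orth). Qed.

Lemma l2_ae f g : cmeas g -> {ae P, forall x, f x = g x} -> l2 P f -> l2 P g /\ n2 P f = n2 P g.
Proof.
move=> mg fg [mf if_].
have e : {ae P, forall x, N (f x) ^+ 2 = N (g x) ^+ 2} by apply: filterS fg => x ->.
have m1 := measurable_normc_sqr mf; have m2 := measurable_normc_sqr mg.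
split; last exact: Rintegral_ae.
by split=> //; exact: ible_ae e if_.
Qed.

(** Only integrability is assumed: Riesz-Fischer supplies a square integrable function with the same
    coefficients, and completeness identifies it with [f] almost everywhere. *)
Lemma parseval f C : cible P f -> bnd (fun k => N (fc f k) ^+ 2) C ->
  l2 P f /\ n2 P f <= C.
Proof.
move=> if_ fC; have [g lg [gf gC]] := riesz_fischer_torus fC.
have [] := @l2_ae g f (cible_meas if_) _ lg; last by move=> l2f <-.
exact: (fourier_inj (l2_cible lg) if_).
Qed.

Lemma n2_sub_tpoly_le f K e : l2 P f -> uniq K ->
  (forall L, uniq L -> (forall k, k \in L -> k \notin K) -> \sum_(k <- L) N (fc f k) ^+ 2 <= e) ->
  n2 P (fun x => f x - tpoly character K (fc f) x) <= e.
Proof.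
move=> lf uK Ke; set S := tpoly _ _ _.
have lS : l2 P S by exact: (tpoly_l2 P measurable_character normc_character).
have lfS := l2B lf lS.
apply: (parseval (l2_cible lfS) _).2 => L uL.
rewrite (bigID (mem K))/= big1 ?add0r.
  rewrite -big_filter.
  have LK k : k \in [seq k <- L | k \notin K] -> k \notin K by rewrite mem_filter => /andP[].
  apply: le_trans (Ke _ (filter_uniq _ uL) LK).
  rewrite big_seq [leRHS]big_seq; apply: ler_sum => k /LK kK.
  rewrite fourierB; [|exact: l2_cible..].
  rewrite [fc S k](fco_tpoly measurable_character normc_character character_orth)//.
  by rewrite (negbTE kK) subr0.
move=> k kK; rewrite fourierB; [|exact: l2_cible..].
rewrite [fc S k](fco_tpoly measurable_character normc_character character_orth)// kK subrr.
by rewrite Normc.normc0 expr0n.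
Qed.

(** The partial sums are bounded by [b] everywhere, so the excess of |f| over [b] is at most |f - S|
    for each partial sum S; as S tends to [f] in L^2, the excess vanishes almost everywhere. *)
Lemma sup_bound f b : l2 P f -> bnd (fun k => N (fc f k)) b -> {ae P, forall x, N (f x) <= b}.
Proof.
move=> lf fb; pose v x : R := Num.max 0 (N (f x) - b).
have mv : measurable_fun setT v.
  apply: measurable_maxr; first exact: measurable_cst.
  by apply: measurable_funB; [exact: measurable_normc lf.1|exact: measurable_cst].
have v0 x : 0 <= v x by rewrite le_max lexx.
have vf x : v x <= `|b| + N (f x).
  have b0 := ler_norm (- b); rewrite normrN in b0; have N0 := normc_ge0 (f x).
  by rewrite /v ge_max; apply/andP; split; [have := normr_ge0 b|]; lra.
have key e : 0 < e -> \int[P]_x (v x ^+ 2) <= e.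
  move=> e0; have [K uK tK] := bnd_tail (bessel_torus lf) e0.
  have hS := n2_sub_tpoly_le lf uK tK.
  apply: le_trans hS.
  have lS : l2 P (fun x => f x - tpoly character K (fc f) x).
    by apply: l2B => //; exact: (tpoly_l2 P measurable_character normc_character).
  have vS x : v x <= N (f x - tpoly character K (fc f) x).
    rewrite ge_max normc_ge0 lerBlDr.
    have Sb : N (tpoly character K (fc f) x) <= b.
      apply: (le_trans (normc_sum _ _ _)).
      under eq_bigr do rewrite Normc.normcM normc_character mulr1.
      exact: fb.
    apply: (le_trans _ (lerD (lexx _) Sb)).
    by rewrite -{1}(subrK (tpoly character K (fc f) x) (f x)) complex.le_normcD.
  have vS2 x : v x ^+ 2 <= N (f x - tpoly character K (fc f) x) ^+ 2.
    by rewrite lerXn2r ?nnegrE ?v0 ?normc_ge0 ?vS.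
  apply: Rint_le => //; last by case: lS.
  apply: ible_le (_ : ible P (fun x => N (f x - tpoly character K (fc f) x) ^+ 2)) => [|x|].
  - exact: measurable_funX.
  - by rewrite ger0_norm ?sqr_ge0.
  - by case: lS.
have iv : ible P (fun x => v x ^+ 2).
  have [mf if_] := lf.
  apply: (ible_le (v := fun x => 2 * `|b| ^+ 2 + 2 * N (f x) ^+ 2)) => [|x|].
  - exact: measurable_funX.
  - rewrite ger0_norm ?sqr_ge0//; have := vf x; have := v0 x; have := normr_ge0 b; have := normc_ge0 (f x).
    move: (v x) (`|b|) (N _) => p q r r0 q0 p0 pqr.
    have : 0 <= (q - r) ^+ 2 by rewrite sqr_ge0.
    nra.
  - by apply: ibleD; [exact: ible_cst|exact: ibleZ].
have z : \int[P]_x (v x ^+ 2) = 0.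
  apply/eqP; rewrite eq_le Rintegral_ge0 ?andbT//; last by move=> x _; rewrite sqr_ge0.
  by apply/ler_addgt0Pl => e e0; rewrite addr0 key.
have mv2 : measurable_fun setT (fun x => (v x ^+ 2)%:E).
  by apply/measurable_EFinP; exact: measurable_funX.
have : (\int[P]_x `|(v x ^+ 2)%:E| = 0)%E.
  under eq_integral do rewrite gee0_abs ?lee_fin ?sqr_ge0//.
  by rewrite -[LHS]fineK ?[fine _]z//; exact: integrable_fin_num.
move=> /(ae_eq_integral_abs P measurableT mv2).
apply: filterS => x /(_ Logic.I) [] /eqP; rewrite sqrf_eq0 => /eqP vx.
have : N (f x) - b <= v x by rewrite le_max lexx orbT.
by rewrite vx subr_le0.
Qed.

End torus_fourier.

(** * Lattice sums *)

Section lattice_sums.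
Context {R : realType} {d : nat}.
Local Notation I := 'rV[int]_d.
Implicit Types (k l : I).

(** The square of the Japanese bracket: the squared H^s norm has weight [jap k] to the power s. *)
Definition jap k : R := 1 + freq2 k.

Lemma freq2_ge0 k : 0 <= freq2 k :> R.
Proof. by apply: sumr_ge0 => j _; rewrite sqr_ge0. Qed.

Lemma jap_ge1 k : 1 <= jap k.
Proof. by rewrite lerDl freq2_ge0. Qed.

Lemma jap_gt0 k : 0 < jap k.
Proof. exact: lt_le_trans ltr01 (jap_ge1 k). Qed.

Lemma freq2N k : freq2 (- k) = freq2 k :> R.
Proof. by apply: eq_bigr => j _; rewrite mxE rmorphN sqrrN. Qed.

Lemma japN k : jap (- k) = jap k.
Proof. by rewrite /jap freq2N. Qed.

Lemma freq2_coord k j : ((absz (k ord0 j))%:R : R) ^+ 2 <= freq2 k.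
Proof.
rewrite /freq2 (bigD1 j)//= -[leLHS]addr0 lerD//.
  by rewrite natr_absz intr_norm real_normK// num_real.
by apply: sumr_ge0 => i _; rewrite sqr_ge0.
Qed.

Lemma jap_triangle k1 k2 k3 : jap (k1 + k2 + k3) <= 3 * (jap k1 + jap k2 + jap k3).
Proof.
have : freq2 (k1 + k2 + k3) <= 3 * (freq2 k1 + freq2 k2 + freq2 k3) :> R.
  rewrite /freq2 -!big_split/= mulr_sumr; apply: ler_sum => j _.
  rewrite !mxE !rmorphD/=; move: (_%:~R) (_%:~R) (_%:~R) => a b c.
  rewrite -subr_ge0 (_ : _ - _ = (a - b) ^+ 2 + (b - c) ^+ 2 + (a - c) ^+ 2); last by ring.
  by rewrite !addr_ge0 ?sqr_ge0.
by rewrite /jap; lra.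
Qed.

Definition signed_row n (f : {ffun 'I_d -> bool * 'I_n.+1}) : I :=
  \row_j (if (f j).1 then (f j).2%:Z else - (f j).2%:Z).

(** Duplicates must be removed because a zero entry is produced with either sign. *)
Definition box n : seq I := undup [seq signed_row f | f : {ffun 'I_d -> bool * 'I_n.+1}].

Lemma mem_signed_row n k : (forall j, (absz (k ord0 j) <= n)%N) ->
  k \in [seq signed_row f | f : {ffun 'I_d -> bool * 'I_n.+1}].
Proof.
move=> kn; apply/mapP.
exists [ffun j => (0 <= k ord0 j, inord (absz (k ord0 j)))]; first by rewrite mem_enum.
apply/rowP => j; rewrite mxE ffunE/= inordK ?ltnS//.
by case: ifPn => [/gez0_abs->//|]; rewrite -ltNge => /ltz0_abs ->; rewrite opprK.
Qed.

Lemma box_uniq n : uniq (box n).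
Proof. exact: undup_uniq. Qed.

Lemma notin_box n k : k \notin box n -> 1 + n%:R ^+ 2 <= jap k.
Proof.
move=> kn; have [j nj] : exists j, (n < absz (k ord0 j))%N.
  apply: contrapT => h; move: kn; rewrite mem_undup mem_signed_row// => j.
  by rewrite leqNgt; apply/negP => nj; apply: h; exists j.
rewrite lerD2l (le_trans _ (freq2_coord k j))//.
by rewrite lerXn2r ?nnegrE ?ler0n// ler_nat ltnW.
Qed.

(** A sum of products over a box is a product of sums over the coordinates; the factor 2 counts the
    two signs of an entry. *)
Lemma sum_prod_le (p : nat -> R) (S : R) n (K : seq I) : (forall m, 0 <= p m) ->
  \sum_(m < n.+1) p m <= S -> uniq K ->
  (forall k, k \in K -> forall j, (absz (k ord0 j) <= n)%N) ->
  \sum_(k <- K) \prod_(j < d) p (absz (k ord0 j)) <= (2 * S) ^+ d.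
Proof.
move=> p0 pS uK Kn.
apply: (le_trans (@bnd_cat _ _ (fun k => \prod_(j < d) p (absz (k ord0 j))) _ _ _ uK
    (_ : {subset K <= [seq signed_row f | f : {ffun 'I_d -> bool * 'I_n.+1}]}))).
- by move=> k; apply: prodr_ge0.
- by move=> k kK; apply: mem_signed_row => j; exact: Kn.
rewrite big_map big_enum/=.
have -> : \sum_(f in {ffun 'I_d -> bool * 'I_n.+1}) \prod_(j < d) p (absz (signed_row f ord0 j)) =
    \sum_(f : {ffun 'I_d -> bool * 'I_n.+1}) \prod_(j < d) p (f j).2.
  apply: eq_bigr => f _; apply: eq_bigr => j _; rewrite mxE; congr (p _).
  by case: ifP => _; rewrite ?abszN.
rewrite -(bigA_distr_bigA (fun (j : 'I_d) (b : bool * 'I_n.+1) => p b.2))/=.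
rewrite prodr_const card_ord lerXn2r ?nnegrE ?sumr_ge0//.
  by rewrite mulr_ge0// (le_trans _ pS)// sumr_ge0.
rewrite -(pair_big xpredT xpredT (fun (b : bool) (m : 'I_n.+1) => p m))/=.
by rewrite big_bool/= mulr_natl mulr2n lerD.
Qed.

Lemma ler_powR2 (x y r : R) : 0 <= r -> 0 <= x -> x <= y -> x `^ r <= y `^ r.
Proof. by move=> r0 x0 xy; apply: ge0_ler_powR => //; rewrite nnegrE// (le_trans x0). Qed.

Lemma powR_ge1 (x r : R) : 1 <= x -> 0 <= r -> 1 <= x `^ r.
Proof. by move=> x1 r0; have := ler_powR2 r0 ler01 x1; rewrite powR1. Qed.

(** Each 1 + k_j^2 is at most [jap k]. This turns negative powers of [jap] into products over the
    coordinates, and lattice sums into one-dimensional ones. *)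
Lemma prod_powR_le r k : 0 <= r ->
  \prod_(j < d) (1 + ((absz (k ord0 j))%:R : R) ^+ 2) `^ r <= jap k `^ (d%:R * r).
Proof.
move=> r0; rewrite mulrC powRrM powR_mulrn ?powR_ge0//.
rewrite -[X in _ ^+ X]card_ord -prodr_const; apply: ler_prod => j _.
rewrite powR_ge0/=; apply: ler_powR2; rewrite ?lerD2l ?freq2_coord//.
Qed.

Lemma jap_powR_inv_le r k : 0 <= r ->
  (jap k `^ (d%:R * r))^-1 <= \prod_(j < d) ((1 + ((absz (k ord0 j))%:R : R) ^+ 2) `^ r)^-1.
Proof.
move=> r0; rewrite prodfV lef_pV2 ?posrE; first exact: prod_powR_le.
  by rewrite powR_gt0 ?jap_gt0.
by apply: prodr_gt0 => j _; rewrite powR_gt0// ltr_wpDr ?sqr_ge0.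
Qed.

Let base_gt0 m : 0 < 1 + (m%:R : R) ^+ 2.
Proof. by rewrite ltr_wpDr ?sqr_ge0. Qed.

(** The exponent 2/3 is the share of each coordinate in [jap]^-2 when d = 3. With q = m^(1/3) the
    terms are below q^-4, which is dominated by three times a telescoping difference of 1 / q. The
    bound 5 adds 1 for m = 0, 1 for m = 1 and 3 for the rest. *)
Lemma sum_inv_powR23 n :
  \sum_(m < n.+1) ((1 + (m%:R : R) ^+ 2) `^ (2 / 3))^-1 <= 5.
Proof.
pose q (m : nat) : R := m%:R `^ (1 / 3).
have q3 m : q m ^+ 3 = m%:R.
  by rewrite /q -powR_mulrn ?powR_ge0// -powRrM (_ : 1 / 3 * 3%:R = 1) ?powRr1//; field.
have q0 m : (0 < m)%N -> 0 < q m by move=> m0; rewrite powR_gt0 ?ltr0n.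
have qE m : q m ^+ 4 = ((m%:R : R) ^+ 2) `^ (2 / 3).
  rewrite -[LHS]powR_mulrn ?powR_ge0// /q -powRrM -[in RHS]powR_mulrn// -powRrM.
  by congr (_ `^ _); field.
have term m : (0 < m)%N -> ((1 + (m%:R : R) ^+ 2) `^ (2 / 3))^-1 <= (q m ^+ 4)^-1.
  move=> m0; rewrite qE lef_pV2 ?posrE ?powR_gt0 ?exprn_gt0 ?ltr0n ?base_gt0//.
  by rewrite ler_powR2 ?sqr_ge0 ?lerDr.
have step m : (0 < m)%N -> (q m.+1 ^+ 4)^-1 <= 3 * ((q m)^-1 - (q m.+1)^-1).
  move=> m0; have a0 := q0 _ m0; have b0 := q0 m.+1 isT.
  have e : q m.+1 ^+ 3 - q m ^+ 3 = 1 by rewrite !q3 -natr1; ring.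
  have ab : q m <= q m.+1 by apply: ler_powR2 => //; rewrite ler_nat.
  move: (q m) (q m.+1) a0 b0 e ab => a b a0 b0 e ab.
  (* The cubes differ by 1, which makes the increment of the cube roots explicit. *)
  have ba : b - a = (b ^+ 2 + b * a + a ^+ 2)^-1.
    have s0 : b ^+ 2 + b * a + a ^+ 2 != 0 by rewrite gt_eqF// !addr_gt0 ?exprn_gt0 ?mulr_gt0.
    by apply: (mulIf s0); rewrite mulVf// -e; ring.
  rewrite (_ : a^-1 - b^-1 = (b - a) / (a * b)); last by field; rewrite !gt_eqF.
  rewrite ba -invfM -[3]invrK -invfM lef_pV2 ?posrE ?exprn_gt0//; last first.
    by rewrite !mulr_gt0 ?invr_gt0// !addr_gt0 ?exprn_gt0 ?mulr_gt0.
  rewrite ler_pdivrMl//.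
  have h1 : a * b <= b * b by rewrite ler_wpM2r// ltW.
  have h2 : b ^+ 2 + b * a + a ^+ 2 <= 3 * (b * b).
    have : a * a <= b * b by apply: ler_pM => //; exact: ltW.
    rewrite !expr2 (mulrC b a); lra.
  rewrite (_ : 3 * b ^+ 4 = (3 * (b * b)) * (b * b)); last by ring.
  by rewrite ler_pM// ?mulr_ge0 ?ltW// !addr_gt0 ?exprn_gt0 ?mulr_gt0.
have f01 : ((1 + (0%:R : R) ^+ 2) `^ (2 / 3))^-1 = 1.
  by rewrite expr0n/= addr0 powR1 invr1.
case: n => [|n]; first by rewrite big_ord_recl big_ord0/= f01 addr0; lra.
apply: (@le_trans _ _ (5 - 3 * (q n.+1)^-1)); last first.
  by rewrite gerBl mulr_ge0// invr_ge0 ltW// q0.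
elim: n => [|n IH].
  rewrite !big_ord_recl big_ord0/= f01 addr0 /bump/= add1n.
  have := term 1%N isT; rewrite /q powR1 expr1n invr1; lra.
rewrite big_ord_recr/=; have := term n.+2 isT; have := step n.+1 isT; lra.
Qed.

(** The terms are below m^(-1/2), which is at most 2 (sqrt m - sqrt (m - 1)); the sum diverges, and
    its growth rate is what [sum_rho_inv] uses. *)
Lemma sum_inv_powR14 n :
  \sum_(m < n.+1) ((1 + (m%:R : R) ^+ 2) `^ (1 / 4))^-1 <= 1 + 2 * Num.sqrt n%:R.
Proof.
have term m : (0 < m)%N -> ((1 + (m%:R : R) ^+ 2) `^ (1 / 4))^-1 <= (Num.sqrt m%:R)^-1.
  move=> m0; rewrite lef_pV2 ?posrE ?sqrtr_gt0 ?ltr0n ?powR_gt0 ?base_gt0//.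
  rewrite -powR12_sqrt// (_ : 2^-1 = 2%:R * (1 / 4)); last by field.
  by rewrite powRrM powR_mulrn//; apply: ler_powR2; rewrite ?sqr_ge0// lerDr.
have step m : (Num.sqrt m.+1%:R)^-1 <= 2 * (Num.sqrt m.+1%:R - Num.sqrt m%:R) :> R.
  have b0 : 0 < Num.sqrt m.+1%:R :> R by rewrite sqrtr_gt0 ltr0n.
  have a0 : 0 <= Num.sqrt m%:R :> R by rewrite sqrtr_ge0.
  have e : Num.sqrt m.+1%:R ^+ 2 - Num.sqrt m%:R ^+ 2 = 1 :> R.
    by rewrite !sqr_sqrtr// -natr1; ring.
  have ab : Num.sqrt m%:R <= Num.sqrt m.+1%:R :> R by rewrite ler_sqrt// ler_nat.
  move: (Num.sqrt _) (Num.sqrt _) a0 b0 e ab => a b a0 b0 e ab.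
  rewrite -[leLHS]mul1r ler_pdivrMr// -e; have : 0 <= (b - a) ^+ 2 by rewrite sqr_ge0.
  nra.
elim: n => [|n IH].
  by rewrite big_ord_recl big_ord0/= expr0n/= !addr0 powR1 invr1 sqrtr0; lra.
rewrite big_ord_recr/=; have := term n.+1 isT; have := step n; lra.
Qed.

(** The restriction d <= 3 enters as 2 d / 3 <= 2; the 10 is twice the one-dimensional bound 5. *)
Lemma sum_jap_inv2 : (d <= 3)%N -> bnd (fun k => (jap k ^+ 2)^-1) (10 ^+ d).
Proof.
move=> d3 K uK.
have [n Kn] : exists n, forall k, k \in K -> forall j, (absz (k ord0 j) <= n)%N.
  exists (\max_(k <- K) \max_(j < d) absz (k ord0 j))%N => k kK j.
  have h1 : (absz (k ord0 j) <= \max_(j < d) absz (k ord0 j))%N.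
    by rewrite (bigD1 j)//= leq_max leqnn.
  by apply: (leq_trans h1); rewrite (big_rem k)//= leq_max leqnn.
pose p (m : nat) : R := ((1 + (m%:R : R) ^+ 2) `^ (2 / 3))^-1.
have p0 m : 0 <= p m by rewrite invr_ge0 powR_ge0.
have := sum_prod_le p0 (sum_inv_powR23 n) uK Kn.
rewrite -natrM; apply: le_trans; apply: ler_sum => k _.
apply: (le_trans _ (jap_powR_inv_le _ _)) => //.
rewrite lef_pV2 ?posrE ?exprn_gt0 ?powR_gt0 ?jap_gt0//.
rewrite -powR_mulrn; last by rewrite ltW ?jap_gt0.
apply: ler_powR; first exact: jap_ge1.
have : d%:R <= 3%:R :> R by rewrite ler_nat.
lra.
Qed.

(** The multiplier whose l^2 norm on coefficients is the H^(d/4) norm. *)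
Definition rho k : R := jap k `^ (d%:R / 8).

Lemma rho_ge1 k : 1 <= rho k.
Proof. by apply: powR_ge1; rewrite ?jap_ge1. Qed.

Lemma rho_sqr k : rho k ^+ 2 = jap k `^ (d%:R / 4).
Proof. by rewrite -powR_mulrn ?powR_ge0// -powRrM; congr (_ `^ _); field. Qed.

(* The borderline lattice sum behind the critical embedding [H^(d/4) -> L^4]. *)
Lemma sum_rho_inv (K : seq I) l : uniq K ->
  \sum_(k <- K | jap k <= jap l) (rho k ^+ 2)^-1 <= 6 ^+ d * rho l ^+ 2.
Proof.
move=> uK; rewrite -big_filter; set L := [seq k <- K | _].
have uL : uniq L by rewrite filter_uniq.
(* [n] is the integer part of the length of [l]: frequencies no longer than [l] have all entries
   bounded by [n]. *)
pose n := Num.truncn (Num.sqrt (freq2 l : R)).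
have sn : n%:R <= Num.sqrt (freq2 l : R) < n.+1%:R.
  by rewrite -(truncn_eq _ _) ?sqrtr_ge0.
have Ln k : k \in L -> forall j, (absz (k ord0 j) <= n)%N.
  rewrite mem_filter => /andP[kl _] j; rewrite leqNgt -(ltr_nat R); apply/negP => nk.
  have : (absz (k ord0 j))%:R <= Num.sqrt (freq2 l : R).
    rewrite -[leLHS]ger0_norm// -sqrtr_sqr ler_sqrt ?freq2_ge0//.
    by apply: (le_trans (freq2_coord k j)); move: kl; rewrite /jap lerD2l.
  case/andP: sn => _ h1 h2.
  have : n.+1%:R <= (absz (k ord0 j))%:R :> R by rewrite ler_nat -(ltr_nat R).
  lra.
pose p (m : nat) : R := ((1 + (m%:R : R) ^+ 2) `^ (1 / 4))^-1.
have p0 m : 0 <= p m by rewrite invr_ge0 powR_ge0.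
have hS : \sum_(m < n.+1) p m <= 3 * jap l `^ (1 / 4).
  apply: (le_trans (sum_inv_powR14 n)).
  have h1 : 1 <= jap l `^ (1 / 4).
    by apply: powR_ge1; rewrite ?jap_ge1.
  have h2 : Num.sqrt n%:R <= jap l `^ (1 / 4).
    rewrite -powR12_sqrt// (_ : 2^-1 = 2%:R * (1 / 4)); last by field.
    rewrite powRrM powR_mulrn//; apply: ler_powR2; rewrite ?sqr_ge0//.
    rewrite /jap ler_wpDl// -[leRHS]sqr_sqrtr ?freq2_ge0//.
    by rewrite lerXn2r ?nnegrE ?sqrtr_ge0 ?ler0n//; case/andP: sn.
  lra.
have := sum_prod_le p0 hS uL Ln.
rewrite mulrA exprMn (_ : 2 * 3 = 6); last by ring.
rewrite -[(_ `^ _) ^+ d]powR_mulrn ?powR_ge0// -powRrM (_ : 1 / 4 * d%:R = d%:R / 4); last by field.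
rewrite -rho_sqr; apply: le_trans; apply: ler_sum => k _.
have r14 : 0 <= 1 / 4 :> R by lra.
by have := jap_powR_inv_le k r14; rewrite mulrA mulr1 rho_sqr.
Qed.

End lattice_sums.

(** * Trilinear estimates *)

Section trilinear_sums.
Context {R : realType} {d : nat}.
Local Notation I := 'rV[int]_d.
Implicit Types (k l : I) (a b c : I -> R) (K J : seq I).

(** Cauchy-Schwarz stated through A^2 <= u v, so that no square roots of the weights appear. *)
Lemma cauchy_sum (J : Type) (s : seq J) (A u v : J -> R) :
  (forall p, 0 <= A p) -> (forall p, 0 <= u p) -> (forall p, 0 <= v p) ->
  (forall p, A p ^+ 2 <= u p * v p) ->
  (\sum_(p <- s) A p) ^+ 2 <= (\sum_(p <- s) u p) * (\sum_(p <- s) v p).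
Proof.
move=> A0 u0 v0 Auv; elim: s => [|p s IH]; first by rewrite !big_nil expr0n mul0r.
rewrite !big_cons.
have S0 : 0 <= \sum_(j <- s) A j by apply: sumr_ge0.
have U0 : 0 <= \sum_(j <- s) u j by apply: sumr_ge0.
have V0 : 0 <= \sum_(j <- s) v j by apply: sumr_ge0.
move: (A p) (u p) (v p) (A0 p) (u0 p) (v0 p) (Auv p) IH S0 U0 V0.
move: (\sum_(j <- s) A j) (\sum_(j <- s) u j) (\sum_(j <- s) v j).
move=> S U V x y z x0 y0 z0 h1 h2 S0 U0 V0.
suff h : 2 * (x * S) <= y * V + z * U by nra.
rewrite -(@ler_pXn2r _ 2)// ?nnegrE ?addr_ge0 ?mulr_ge0//.
have h3 : x ^+ 2 * S ^+ 2 <= (y * z) * (U * V) by rewrite ler_pM ?sqr_ge0.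
have : 0 <= (y * V - z * U) ^+ 2 by rewrite sqr_ge0.
rewrite !exprMn; nra.
Qed.

Definition tri K : seq (I * I * I) := [seq (p, k3) | p <- [seq (k1, k2) | k1 <- K, k2 <- K], k3 <- K].
Definition fsum (p : I * I * I) : I := p.1.1 + p.1.2 + p.2.

Lemma big_tri K (F : I * I * I -> R) :
  \sum_(p <- tri K) F p = \sum_(k1 <- K) \sum_(k2 <- K) \sum_(k3 <- K) F (k1, k2, k3).
Proof. by rewrite big_allpairs_dep big_allpairs_dep. Qed.

Definition conv3 K (A : I * I * I -> R) k := \sum_(p <- tri K | fsum p == k) A p.

Lemma sum_pred1_le K (F : I -> R) k : (forall l, 0 <= F l) -> uniq K ->
  \sum_(l <- K | l == k) F l <= F k.
Proof.
move=> F0 uK; have [kK|kK] := boolP (k \in K).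
  by rewrite (big_rem k)//= eqxx big_seq_cond big1 ?addr0// => l /andP[lK /eqP lk]; move: lK; rewrite lk mem_rem_uniqF.
by rewrite big_seq_cond big1// => l /andP[lK /eqP lk]; rewrite -lk lK in kK.
Qed.

Lemma sum_fiber_le K l k (f : I -> I) (r : R) : uniq K -> (forall x, (f x == k) = (x == l)) ->
  0 <= r -> \sum_(x <- K | f x == k) r <= r.
Proof.
move=> uK fk r0; rewrite (eq_bigl (fun x => x == l))//.
exact: (@sum_pred1_le K (fun=> r)).
Qed.

(** The output frequency and two of the inputs determine the third, so each pair of summation
    indices meets the fibre at most once. *)
Lemma fiber12 K a b k : (forall l, 0 <= a l) -> (forall l, 0 <= b l) -> uniq K ->
  conv3 K (fun p => a p.1.1 * b p.1.2) k <= (\sum_(l <- K) a l) * (\sum_(l <- K) b l).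
Proof.
move=> a0 b0 uK; rewrite /conv3 big_mkcond big_tri/= mulr_suml; apply: ler_sum => k1 _.
rewrite mulr_sumr; apply: ler_sum => k2 _; rewrite -big_mkcond/=.
apply: (@sum_fiber_le K (k - (k1 + k2)) k (fun x => k1 + k2 + x)) => //.
  by move=> x; rewrite [RHS]eq_sym subr_eq eq_sym addrC.
exact: mulr_ge0.
Qed.

Lemma fiber13 K a b k : (forall l, 0 <= a l) -> (forall l, 0 <= b l) -> uniq K ->
  conv3 K (fun p => a p.1.1 * b p.2) k <= (\sum_(l <- K) a l) * (\sum_(l <- K) b l).
Proof.
move=> a0 b0 uK; rewrite /conv3 big_mkcond big_tri/= mulr_suml; apply: ler_sum => k1 _.
rewrite exchange_big/= mulr_sumr; apply: ler_sum => k3 _; rewrite -big_mkcond/=.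
apply: (@sum_fiber_le K (k - (k1 + k3)) k (fun x => k1 + x + k3)) => //.
  by move=> x; rewrite [RHS]eq_sym subr_eq eq_sym addrAC addrC.
exact: mulr_ge0.
Qed.

Lemma fiber23 K a b k : (forall l, 0 <= a l) -> (forall l, 0 <= b l) -> uniq K ->
  conv3 K (fun p => a p.1.2 * b p.2) k <= (\sum_(l <- K) a l) * (\sum_(l <- K) b l).
Proof.
move=> a0 b0 uK; rewrite /conv3 big_mkcond big_tri/= exchange_big/= mulr_suml; apply: ler_sum => k2 _.
rewrite exchange_big/= mulr_sumr; apply: ler_sum => k3 _; rewrite -big_mkcond/=.
apply: (@sum_fiber_le K (k - (k2 + k3)) k (fun x => x + k2 + k3)) => //.
  by move=> x; rewrite [RHS]eq_sym subr_eq eq_sym addrA.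
exact: mulr_ge0.
Qed.

Lemma conv3_total K J (A : I * I * I -> R) : (forall p, 0 <= A p) -> uniq J ->
  \sum_(k <- J) conv3 K A k <= \sum_(p <- tri K) A p.
Proof.
move=> A0 uJ; rewrite /conv3 (exchange_big_dep xpredT)//=; apply: ler_sum => p _.
rewrite (eq_bigl (fun k => k == fsum p)); last by move=> k; rewrite eq_sym.
exact: (@sum_pred1_le J (fun=> A p)).
Qed.

(** Schur's test: Cauchy-Schwarz on each fibre, where [u] is summed along a fibre, uniformly in the
    output, and [v] over all triples. *)
Lemma conv3_schur K J (A u v : I * I * I -> R) X Y : uniq J ->
  (forall p, 0 <= A p) -> (forall p, 0 <= u p) -> (forall p, 0 <= v p) ->
  (forall p, A p ^+ 2 <= u p * v p) ->
  (forall k, conv3 K u k <= X) -> \sum_(p <- tri K) v p <= Y ->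
  \sum_(k <- J) conv3 K A k ^+ 2 <= X * Y.
Proof.
move=> uJ A0 u0 v0 Auv uX vY.
have X0 : 0 <= X by apply: le_trans (uX 0); apply: sumr_ge0.
apply: (@le_trans _ _ (\sum_(k <- J) X * conv3 K v k)).
  apply: ler_sum => k _.
  have := cauchy_sum [seq p <- tri K | fsum p == k] A0 u0 v0 Auv.
  rewrite !big_filter => /le_trans; apply.
  by rewrite ler_wpM2r ?sumr_ge0//; exact: uX.
rewrite -mulr_sumr ler_wpM2l// (le_trans _ vY)//; exact: conv3_total.
Qed.

Lemma sum_tri_prod K (a b c : I -> R) :
  \sum_(p <- tri K) a p.1.1 * b p.1.2 * c p.2 =
  (\sum_(l <- K) a l) * (\sum_(l <- K) b l) * (\sum_(l <- K) c l).
Proof.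
rewrite big_tri/= -mulrA mulr_suml; apply: eq_bigr => k1 _.
rewrite mulr_suml mulr_sumr; apply: eq_bigr => k2 _.
by rewrite mulr_sumr mulr_sumr; apply: eq_bigr => k3 _; rewrite mulrA.
Qed.

Lemma ler_prod3 (x y z X Y Z : R) : 0 <= x -> 0 <= y -> 0 <= z ->
  x <= X -> y <= Y -> z <= Z -> x * y * z <= X * Y * Z.
Proof. by move=> x0 y0 z0 xX yY zZ; rewrite !ler_pM// mulr_ge0. Qed.

Section young.
Variables (K J : seq I) (a b c : I -> R).
Hypotheses (uK : uniq K) (uJ : uniq J).
Hypotheses (a0 : forall l, 0 <= a l) (b0 : forall l, 0 <= b l) (c0 : forall l, 0 <= c l).

Let abc p := a p.1.1 * b p.1.2 * c p.2.
Let abc0 p : 0 <= abc p. Proof. by rewrite !mulr_ge0. Qed.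

(** Young's inequality for an l^2 factor and two l^1 factors, by Schur's test with the splitting (b
    c) (a^2 b c). *)
Lemma young1 X Y Z : \sum_(l <- K) a l ^+ 2 <= X -> \sum_(l <- K) b l <= Y ->
  \sum_(l <- K) c l <= Z -> \sum_(k <- J) conv3 K abc k ^+ 2 <= X * Y ^+ 2 * Z ^+ 2.
Proof.
move=> aX bY cZ.
have Y0 : 0 <= Y by apply: le_trans bY; exact: sumr_ge0.
have Z0 : 0 <= Z by apply: le_trans cZ; exact: sumr_ge0.
have -> : X * Y ^+ 2 * Z ^+ 2 = (Y * Z) * (X * Y * Z) by ring.
apply: (conv3_schur (u := fun p => b p.1.2 * c p.2) (v := fun p => a p.1.1 ^+ 2 * b p.1.2 * c p.2)) => //.
- by move=> p; rewrite mulr_ge0.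
- by move=> p; rewrite !mulr_ge0 ?sqr_ge0.
- by move=> p; rewrite le_eqVlt /abc; apply/orP; left; apply/eqP; ring.
- by move=> k; apply: (le_trans (fiber23 _ _ _ uK)) => //; rewrite ler_pM ?sumr_ge0.
- rewrite (sum_tri_prod K (fun l => a l ^+ 2)).
  by apply: ler_prod3 => //; apply: sumr_ge0 => // l _; rewrite sqr_ge0.
Qed.

Lemma young2 X Y Z : \sum_(l <- K) a l <= X -> \sum_(l <- K) b l ^+ 2 <= Y ->
  \sum_(l <- K) c l <= Z -> \sum_(k <- J) conv3 K abc k ^+ 2 <= X ^+ 2 * Y * Z ^+ 2.
Proof.
move=> aX bY cZ.
have X0 : 0 <= X by apply: le_trans aX; exact: sumr_ge0.
have Z0 : 0 <= Z by apply: le_trans cZ; exact: sumr_ge0.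
have -> : X ^+ 2 * Y * Z ^+ 2 = (X * Z) * (X * Y * Z) by ring.
apply: (conv3_schur (u := fun p => a p.1.1 * c p.2) (v := fun p => a p.1.1 * b p.1.2 ^+ 2 * c p.2)) => //.
- by move=> p; rewrite mulr_ge0.
- by move=> p; rewrite !mulr_ge0 ?sqr_ge0.
- by move=> p; rewrite le_eqVlt /abc; apply/orP; left; apply/eqP; ring.
- by move=> k; apply: (le_trans (fiber13 _ _ _ uK)) => //; rewrite ler_pM ?sumr_ge0.
- rewrite (sum_tri_prod K a (fun l => b l ^+ 2)).
  by apply: ler_prod3 => //; apply: sumr_ge0 => // l _; rewrite sqr_ge0.
Qed.

Lemma young3 X Y Z : \sum_(l <- K) a l <= X -> \sum_(l <- K) b l <= Y ->
  \sum_(l <- K) c l ^+ 2 <= Z -> \sum_(k <- J) conv3 K abc k ^+ 2 <= X ^+ 2 * Y ^+ 2 * Z.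
Proof.
move=> aX bY cZ.
have X0 : 0 <= X by apply: le_trans aX; exact: sumr_ge0.
have Y0 : 0 <= Y by apply: le_trans bY; exact: sumr_ge0.
have -> : X ^+ 2 * Y ^+ 2 * Z = (X * Y) * (X * Y * Z) by ring.
apply: (conv3_schur (u := fun p => a p.1.1 * b p.1.2) (v := fun p => a p.1.1 * b p.1.2 * c p.2 ^+ 2)) => //.
- by move=> p; rewrite mulr_ge0.
- by move=> p; rewrite !mulr_ge0 ?sqr_ge0.
- by move=> p; rewrite le_eqVlt /abc; apply/orP; left; apply/eqP; ring.
- by move=> k; apply: (le_trans (fiber12 _ _ _ uK)) => //; rewrite ler_pM ?sumr_ge0.
- rewrite (sum_tri_prod K a b (fun l => c l ^+ 2)).
  by apply: ler_prod3 => //; apply: sumr_ge0 => // l _; rewrite sqr_ge0.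
Qed.

(* The critical product estimate [H^(d/4) * H^(d/4) -> L^2] with one bounded factor:
   on [jap k1 <= jap k2] the weight [rho k1 ^- 2] is summable up to [rho k2 ^+ 2]. *)
Lemma crit12_half X Y Z : \sum_(l <- K) (rho l * a l) ^+ 2 <= X ->
  \sum_(l <- K) (rho l * b l) ^+ 2 <= Y -> \sum_(l <- K) c l <= Z ->
  \sum_(k <- J) conv3 K (fun p => if jap p.1.1 <= jap p.1.2 :> R then abc p else 0) k ^+ 2 <=
    6 ^+ d * (X * Y * Z ^+ 2).
Proof.
move=> aX bY cZ.
have X0 : 0 <= X by apply: le_trans aX; apply: sumr_ge0 => l _; exact: sqr_ge0.
have Y0 : 0 <= Y by apply: le_trans bY; apply: sumr_ge0 => l _; exact: sqr_ge0.
have Z0 : 0 <= Z by apply: le_trans cZ; exact: sumr_ge0.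
have r0 l : 0 < rho l :> R by exact: lt_le_trans ltr01 (rho_ge1 l).
have -> : 6 ^+ d * (X * Y * Z ^+ 2) = (X * Z) * (6 ^+ d * Y * Z) by ring.
(* The factor rho k1 ^ 2 is moved into [u], where the norm of [a] pays for it; its inverse stays in
   [v], where the sum over k1 has the cutoff [jap k2]. *)
apply: (conv3_schur (u := fun p => (rho p.1.1 * a p.1.1) ^+ 2 * c p.2)
  (v := fun p => if jap p.1.1 <= jap p.1.2 :> R then (rho p.1.1 ^+ 2)^-1 * b p.1.2 ^+ 2 * c p.2 else 0)) => //.
- by move=> p; case: ifP.
- by move=> p; rewrite mulr_ge0 ?sqr_ge0.
- by move=> p; case: ifP => // _; rewrite !mulr_ge0 ?invr_ge0 ?sqr_ge0.
- move=> p; case: ifP => _; last by rewrite expr0n mulr0.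
  rewrite le_eqVlt /abc; apply/orP; left; apply/eqP; field; by rewrite gt_eqF.
- move=> k; apply: (le_trans (fiber13 (a := fun l => (rho l * a l) ^+ 2) _ _ _ uK)) => //.
    by move=> l; exact: sqr_ge0.
  by rewrite ler_pM ?sumr_ge0// => l _; exact: sqr_ge0.
- rewrite big_tri exchange_big/=.
  apply: (@le_trans _ _ (\sum_(k2 <- K) (6 ^+ d * (rho k2 * b k2) ^+ 2 * \sum_(k3 <- K) c k3))).
    apply: ler_sum => k2 _.
    rewrite (eq_bigr (fun k1 => (if jap k1 <= jap k2 :> R then (rho k1 ^+ 2)^-1 else 0) *
        (b k2 ^+ 2 * \sum_(k3 <- K) c k3))); last first.
      move=> k1 _; case: ifP => _; last by rewrite mul0r big1.
      by rewrite -mulr_sumr; exact: esym (mulrA _ _ _).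
    rewrite -mulr_suml -big_mkcond/=.
    rewrite [leRHS](_ : _ = 6 ^+ d * rho k2 ^+ 2 * (b k2 ^+ 2 * \sum_(k3 <- K) c k3)); last by ring.
    by apply: ler_wpM2r; [rewrite mulr_ge0 ?sqr_ge0 ?sumr_ge0|exact: sum_rho_inv].
  rewrite -mulr_suml -mulr_sumr -!mulrA ler_wpM2l ?exprn_ge0//.
  by rewrite ler_pM ?sumr_ge0// => l _; exact: sqr_ge0.
Qed.

End young.

End trilinear_sums.

(** * Trilinear bounds in L^2, H^2 and the critical space *)

Section trilinear_bounds.
Context {R : realType} {d : nat}.
Hypothesis d3 : (d <= 3)%N.
Local Notation I := 'rV[int]_d.
Local Notation jap := (@jap R d).
Local Notation rho := (@rho R d).
Local Notation c0 := (10 ^+ d : R).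
Implicit Types (k l : I) (a b c : I -> R) (K J : seq I).

Lemma c0_ge0 : 0 <= c0. Proof. exact: exprn_ge0. Qed.
Lemma japge0 k : 0 <= jap k. Proof. exact: ltW (jap_gt0 k). Qed.
Lemma rhoge0 k : 0 <= rho k. Proof. by rewrite (le_trans ler01) ?rho_ge1. Qed.
Hint Resolve c0_ge0 japge0 rhoge0 : core.

Lemma japs_ge0 (p : I * I * I) : 0 <= jap p.1.1 + jap p.1.2 + jap p.2.
Proof. exact: addr_ge0 (addr_ge0 (japge0 _) (japge0 _)) (japge0 _). Qed.
Hint Resolve japs_ge0 : core.

(** H^2 embeds into the functions with absolutely summable coefficients: Cauchy-Schwarz against the
    summable weight [jap]^-2. *)
Lemma l1_le K a X : uniq K -> (forall l, 0 <= a l) ->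
  \sum_(l <- K) (jap l * a l) ^+ 2 <= X -> \sum_(l <- K) a l <= Num.sqrt (c0 * X).
Proof.
move=> uK a0 aX.
have X0 : 0 <= X by apply: le_trans aX; apply: sumr_ge0 => l _; exact: sqr_ge0.
rewrite -[leLHS]ger0_norm ?sumr_ge0// -sqrtr_sqr ler_sqrt ?mulr_ge0//.
apply: (le_trans (cauchy_sum K (u := fun l => (jap l ^+ 2)^-1) (v := fun l => (jap l * a l) ^+ 2) a0 _ _ _)).
- by move=> l; rewrite invr_ge0 sqr_ge0.
- by move=> l; rewrite sqr_ge0.
- by move=> l; rewrite exprMn mulKf// gt_eqF// exprn_gt0 ?jap_gt0.
- apply: ler_pM => //; last exact: sum_jap_inv2.
  + by apply: sumr_ge0 => l _; rewrite invr_ge0 sqr_ge0.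
  + by apply: sumr_ge0 => l _; exact: sqr_ge0.
Qed.

Lemma sqr_sum3 (x y z : R) : (x + y + z) ^+ 2 <= 3 * (x ^+ 2 + y ^+ 2 + z ^+ 2).
Proof.
rewrite -subr_ge0 (_ : _ - _ = (x - y) ^+ 2 + (y - z) ^+ 2 + (x - z) ^+ 2); last by ring.
by rewrite !addr_ge0 ?sqr_ge0.
Qed.

Lemma conv3D K (A B : I * I * I -> R) k :
  conv3 K (fun p => A p + B p) k = conv3 K A k + conv3 K B k.
Proof. exact: big_split. Qed.

Lemma conv3_le K (A B : I * I * I -> R) k : (forall p, A p <= B p) -> conv3 K A k <= conv3 K B k.
Proof. by move=> AB; apply: ler_sum. Qed.

Lemma conv3_ge0 K (A : I * I * I -> R) k : (forall p, 0 <= A p) -> 0 <= conv3 K A k.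
Proof. by move=> A0; apply: sumr_ge0. Qed.

Lemma conv3Z K (A : I * I * I -> R) k r : conv3 K (fun p => r * A p) k = r * conv3 K A k.
Proof. by rewrite /conv3 mulr_sumr. Qed.

Lemma conv3_swap12 K (A : I * I * I -> R) k :
  conv3 K (fun p => A (p.1.2, p.1.1, p.2)) k = conv3 K A k.
Proof.
rewrite /conv3 big_mkcond big_tri exchange_big [RHS]big_mkcond big_tri/=.
by do 3 (apply: eq_bigr => ? _); rewrite /fsum/= [X in X + _]addrC.
Qed.

Lemma conv3_swap23 K (A : I * I * I -> R) k :
  conv3 K (fun p => A (p.1.1, p.2, p.1.2)) k = conv3 K A k.
Proof.
rewrite /conv3 big_mkcond big_tri [RHS]big_mkcond big_tri/=.
apply: eq_bigr => k1 _; rewrite exchange_big; apply: eq_bigr => k2 _; apply: eq_bigr => k3 _.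
by rewrite /fsum/= addrAC.
Qed.

Section bounds.
Variables (K J : seq I) (a b c : I -> R) (X Y Z : R).
Hypotheses (uK : uniq K) (uJ : uniq J).
Hypotheses (a0 : forall l, 0 <= a l) (b0 : forall l, 0 <= b l) (c0' : forall l, 0 <= c l).

Let abc p := a p.1.1 * b p.1.2 * c p.2.

(** Each of the three weights stays on its own factor, taken in l^2, while the other two factors are
    taken in l^1. *)
Lemma conv_jap : \sum_(l <- K) (jap l * a l) ^+ 2 <= X -> \sum_(l <- K) (jap l * b l) ^+ 2 <= Y ->
  \sum_(l <- K) (jap l * c l) ^+ 2 <= Z ->
  \sum_(k <- J) conv3 K (fun p => (jap p.1.1 + jap p.1.2 + jap p.2) * abc p) k ^+ 2 <=
    9 * c0 ^+ 2 * (X * Y * Z).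
Proof.
move=> aX bY cZ.
have X0 : 0 <= X by apply: le_trans aX; apply: sumr_ge0 => l _; exact: sqr_ge0.
have Y0 : 0 <= Y by apply: le_trans bY; apply: sumr_ge0 => l _; exact: sqr_ge0.
have Z0 : 0 <= Z by apply: le_trans cZ; apply: sumr_ge0 => l _; exact: sqr_ge0.
have a1 := l1_le uK a0 aX; have b1 := l1_le uK b0 bY; have c1 := l1_le uK c0' cZ.
have ja0 l : 0 <= jap l * a l by rewrite mulr_ge0.
have jb0 l : 0 <= jap l * b l by rewrite mulr_ge0.
have jc0 l : 0 <= jap l * c l by rewrite mulr_ge0.
have sq r : 0 <= r -> Num.sqrt (c0 * r) ^+ 2 = c0 * r by move=> r0; rewrite sqr_sqrtr ?mulr_ge0.
have := young1 uK uJ ja0 b0 c0' aX b1 c1; have := young2 uK uJ a0 jb0 c0' a1 bY c1.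
have := young3 uK uJ a0 b0 jc0 a1 b1 cZ; rewrite !sq//.
set S1 := fun p : I * I * I => jap p.1.1 * a p.1.1 * b p.1.2 * c p.2.
set S2 := fun p : I * I * I => a p.1.1 * (jap p.1.2 * b p.1.2) * c p.2.
set S3 := fun p : I * I * I => a p.1.1 * b p.1.2 * (jap p.2 * c p.2).
move=> h3 h2 h1.
apply: (@le_trans _ _ (\sum_(k <- J) 3 * (conv3 K S1 k ^+ 2 + conv3 K S2 k ^+ 2 + conv3 K S3 k ^+ 2))).
  apply: ler_sum => k _; apply: le_trans (sqr_sum3 _ _ _).
  rewrite -!conv3D le_eqVlt; apply/orP; left; apply/eqP; congr (_ ^+ 2).
  by apply: eq_bigr => p _; rewrite /S1 /S2 /S3 /abc; ring.
rewrite -mulr_sumr !big_split/=.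
rewrite (_ : 9 * c0 ^+ 2 * (X * Y * Z) = 3 * (X * (c0 * Y) * (c0 * Z) + c0 * X * Y * (c0 * Z) + c0 * X * (c0 * Y) * Z)); last by ring.
by rewrite ler_wpM2l// !lerD.
Qed.

(** Triples are split according to which of the first two frequencies is larger, and one half is
    brought to the form of [crit12_half] by exchanging these slots. *)
Lemma crit_bound : \sum_(l <- K) (rho l * (jap l * a l)) ^+ 2 <= X ->
  \sum_(l <- K) (rho l * (jap l * b l)) ^+ 2 <= Y ->
  \sum_(l <- K) (jap l * c l) ^+ 2 <= Z ->
  \sum_(k <- J) conv3 K (fun p => jap p.1.1 * jap p.1.2 * abc p) k ^+ 2 <=
    4 * 6 ^+ d * c0 * (X * Y * Z).
Proof.
move=> aX bY cZ.
have Z0 : 0 <= Z by apply: le_trans cZ; apply: sumr_ge0 => l _; exact: sqr_ge0.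
have c1 := l1_le uK c0' cZ.
have ja0 l : 0 <= jap l * a l by rewrite mulr_ge0.
have jb0 l : 0 <= jap l * b l by rewrite mulr_ge0.
have := crit12_half uK uJ ja0 jb0 c0' aX bY c1.
have := crit12_half uK uJ jb0 ja0 c0' bY aX c1.
rewrite !sqr_sqrtr ?mulr_ge0//.
set S1 := fun p : I * I * I => if jap p.1.1 <= jap p.1.2 then jap p.1.1 * b p.1.1 * (jap p.1.2 * a p.1.2) * c p.2 else 0.
set S2 := fun p : I * I * I => if jap p.1.1 <= jap p.1.2 then jap p.1.1 * a p.1.1 * (jap p.1.2 * b p.1.2) * c p.2 else 0.
move=> h1 h2.
apply: (@le_trans _ _ (\sum_(k <- J) 2 * (conv3 K S1 k ^+ 2 + conv3 K S2 k ^+ 2))).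
  apply: ler_sum => k _; rewrite -(conv3_swap12 K S1).
  set U := conv3 K (fun p => S1 _) k; set V := conv3 K S2 k.
  have UV : conv3 K (fun p => jap p.1.1 * jap p.1.2 * abc p) k <= U + V.
    rewrite -conv3D; apply: conv3_le => p; rewrite /S1 /S2 /abc/=.
    have P0 : 0 <= jap p.1.1 * a p.1.1 * (jap p.1.2 * b p.1.2) * c p.2 by rewrite !mulr_ge0.
    have -> : jap p.1.1 * jap p.1.2 * (a p.1.1 * b p.1.2 * c p.2) =
      jap p.1.1 * a p.1.1 * (jap p.1.2 * b p.1.2) * c p.2 by ring.
    have [h|h] := leP (jap p.1.2) (jap p.1.1).
      by rewrite [X in X + _](_ : _ = jap p.1.1 * a p.1.1 * (jap p.1.2 * b p.1.2) * c p.2) ?lerDl; [case: ifP|ring].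
    by rewrite add0r (ltW h).
  have W0 : 0 <= conv3 K (fun p => jap p.1.1 * jap p.1.2 * abc p) k.
    by apply: conv3_ge0 => p; rewrite /abc !mulr_ge0.
  have U0 : 0 <= U.
    by apply: conv3_ge0 => p; rewrite /S1/=; case: ifP => // _; rewrite !mulr_ge0.
  have V0 : 0 <= V.
    by apply: conv3_ge0 => p; rewrite /S2/=; case: ifP => // _; rewrite !mulr_ge0.
  have : 0 <= (U - V) ^+ 2 by rewrite sqr_ge0.
  by move: W0 UV; move: (conv3 _ _ _) => W; nra.
rewrite -mulr_sumr big_split/=.
rewrite (_ : 4 * 6 ^+ d * c0 * (X * Y * Z) = 2 * (6 ^+ d * (Y * X * (c0 * Z)) + 6 ^+ d * (X * Y * (c0 * Z)))); last by ring.
by rewrite ler_wpM2l// lerD.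
Qed.

End bounds.

(* Convolution with symbol [m] over frequencies in [K]; the conjugated factor of the cubic
   term occupies the third slot. *)
Definition T K (m : I * I * I -> R[i]) (a b c : I -> R[i]) k : R[i] :=
  \sum_(p <- tri K | fsum p == k) m p * (a p.1.1 * b p.1.2 * c p.2).

(* [hb W a X] bounds by [X] the square of the [l^2] norm of [a] with weight [W]; the weights
   [W0], [W2] and [Wr] are those of [L^2], [H^2] and [H^(2 + d/4)]. *)
Definition hb (W : I -> R) (a : I -> R[i]) (X : R) := bnd (fun k => W k * N (a k) ^+ 2) X.
Definition W0 (k : I) : R := 1.
Definition W2 k := jap k ^+ 2.
Definition Wr k := (rho k * jap k) ^+ 2.

Lemma hb_ge0 W (a : I -> R[i]) X : hb W a X -> 0 <= X.
Proof. by move=> /(_ [::] isT); rewrite big_nil. Qed.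

Lemma hb_weight W W' (a : I -> R[i]) X : (forall k, W' k <= W k) -> hb W a X -> hb W' a X.
Proof.
move=> WW aX K uK; apply: le_trans (aX K uK); apply: ler_sum => k _.
by rewrite ler_wpM2r ?sqr_ge0.
Qed.

Lemma W02 k : W0 k <= W2 k.
Proof. by rewrite /W2 exprn_ege1// jap_ge1. Qed.

Lemma W2r k : W2 k <= Wr k.
Proof. by rewrite /Wr exprMn ler_peMl ?sqr_ge0// exprn_ege1// rho_ge1. Qed.

Lemma hbE W (w a : I -> R) (a' : I -> R[i]) X K : (forall k, W k * N (a' k) ^+ 2 = (w k * a k) ^+ 2) -> hb W a' X ->
  uniq K -> \sum_(k <- K) (w k * a k) ^+ 2 <= X.
Proof. by move=> e aX uK; apply: le_trans (aX K uK); apply: ler_sum => k _; rewrite e. Qed.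

Lemma normc_T K m (M : I * I * I -> R) (a b c : I -> R[i]) k : (forall p, N (m p) <= M p) ->
  N (T K m a b c k) <= conv3 K (fun p => M p * (N (a p.1.1) * N (b p.1.2) * N (c p.2))) k.
Proof.
move=> mM; apply: (le_trans (normc_sum _ _ _)); apply: ler_sum => p _.
by rewrite !Normc.normcM ler_wpM2r// !mulr_ge0 ?normc_ge0.
Qed.

Lemma hb_T W K m (M : I * I * I -> R) (a b c : I -> R[i]) X : (forall k, 0 <= W k) ->
  (forall p, N (m p) <= M p) ->
  (forall J, uniq J -> \sum_(k <- J) W k *
    conv3 K (fun p => M p * (N (a p.1.1) * N (b p.1.2) * N (c p.2))) k ^+ 2 <= X) ->
  hb W (T K m a b c) X.
Proof.
move=> Wp mM h J uJ; apply: le_trans (h J uJ); apply: ler_sum => k _.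
rewrite ler_wpM2l// lerXn2r ?nnegrE ?normc_ge0 ?normc_T//.
by apply: conv3_ge0 => p; rewrite !mulr_ge0 ?normc_ge0// (le_trans _ (mM p)) ?normc_ge0.
Qed.

Variables (K : seq I) (m : I * I * I -> R[i]) (a b c : I -> R[i]) (r X Y Z : R).
Hypothesis uK : uniq K.

Let na k := N (a k). Let nb k := N (b k). Let nc k := N (c k).
Let na0 k : 0 <= na k. Proof. exact: normc_ge0. Qed.
Let nb0 k : 0 <= nb k. Proof. exact: normc_ge0. Qed.
Let nc0 k : 0 <= nc k. Proof. exact: normc_ge0. Qed.
Let hb2 (f : I -> R[i]) F : hb W2 f F -> \sum_(l <- K) (jap l * N (f l)) ^+ 2 <= F.
Proof. by move=> fF; apply: (hbE _ fF uK) => k; rewrite exprMn. Qed.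
Let hb0 (f : I -> R[i]) F : hb W0 f F -> \sum_(l <- K) N (f l) ^+ 2 <= F.
Proof. by move=> fF; have := fF K uK; under eq_bigr do rewrite mul1r. Qed.
Let hbr (f : I -> R[i]) F : hb Wr f F -> \sum_(l <- K) (rho l * (jap l * N (f l))) ^+ 2 <= F.
Proof. by move=> fF; apply: (hbE _ fF uK) => k; rewrite mulrA exprMn. Qed.

Lemma hb_T_const (A : I * I * I -> R) D : (forall p, 0 <= A p) -> (forall p, N (m p) <= r * A p) ->
  (forall J, uniq J -> \sum_(k <- J)
    conv3 K (fun p => A p * (na p.1.1 * nb p.1.2 * nc p.2)) k ^+ 2 <= D) ->
  hb W0 (T K m a b c) (r ^+ 2 * D).
Proof.
move=> A0 mA h; apply: (hb_T (M := fun p => r * A p)) => // J uJ.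
apply: le_trans (ler_wpM2l (sqr_ge0 r) (h J uJ)); rewrite mulr_sumr; apply: ler_sum => k _.
rewrite mul1r -exprMn -conv3Z le_eqVlt; apply/orP; left; apply/eqP; congr (_ ^+ 2).
by apply: eq_bigr => p _; rewrite mulrA.
Qed.

(** This lemma and the next two put the L^2 factor in each slot in turn: stability in L^2 needs the
    other two factors in H^2. *)
Lemma T_L2_1 : (forall p, N (m p) <= r) -> hb W0 a X -> hb W2 b Y -> hb W2 c Z ->
  hb W0 (T K m a b c) (r ^+ 2 * (c0 ^+ 2 * (X * Y * Z))).
Proof.
move=> mr aX bY cZ; apply: (hb_T_const (A := fun=> 1)) => [//|p|J uJ]; first by rewrite mulr1.
under eq_bigr => k _ do under [X in conv3 K X k]eq_fun => p do rewrite mul1r.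
have Y0 := hb_ge0 bY; have Z0 := hb_ge0 cZ.
have := young1 uK uJ na0 nb0 nc0 (hb0 aX) (l1_le uK nb0 (hb2 bY)) (l1_le uK nc0 (hb2 cZ)).
rewrite !sqr_sqrtr ?mulr_ge0//; move/le_trans; apply.
by rewrite le_eqVlt; apply/orP; left; apply/eqP; ring.
Qed.

Lemma T_L2_2 : (forall p, N (m p) <= r) -> hb W2 a X -> hb W0 b Y -> hb W2 c Z ->
  hb W0 (T K m a b c) (r ^+ 2 * (c0 ^+ 2 * (X * Y * Z))).
Proof.
move=> mr aX bY cZ; apply: (hb_T_const (A := fun=> 1)) => [//|p|J uJ]; first by rewrite mulr1.
under eq_bigr => k _ do under [X in conv3 K X k]eq_fun => p do rewrite mul1r.
have X0 := hb_ge0 aX; have Z0 := hb_ge0 cZ.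
have := young2 uK uJ na0 nb0 nc0 (l1_le uK na0 (hb2 aX)) (hb0 bY) (l1_le uK nc0 (hb2 cZ)).
rewrite !sqr_sqrtr ?mulr_ge0//; move/le_trans; apply.
by rewrite le_eqVlt; apply/orP; left; apply/eqP; ring.
Qed.

Lemma T_L2_3 : (forall p, N (m p) <= r) -> hb W2 a X -> hb W2 b Y -> hb W0 c Z ->
  hb W0 (T K m a b c) (r ^+ 2 * (c0 ^+ 2 * (X * Y * Z))).
Proof.
move=> mr aX bY cZ; apply: (hb_T_const (A := fun=> 1)) => [//|p|J uJ]; first by rewrite mulr1.
under eq_bigr => k _ do under [X in conv3 K X k]eq_fun => p do rewrite mul1r.
have X0 := hb_ge0 aX; have Y0 := hb_ge0 bY.
have := young3 uK uJ na0 nb0 nc0 (l1_le uK na0 (hb2 aX)) (l1_le uK nb0 (hb2 bY)) (hb0 cZ).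
rewrite !sqr_sqrtr ?mulr_ge0//; move/le_trans; apply.
by rewrite le_eqVlt; apply/orP; left; apply/eqP; ring.
Qed.

Lemma T_jap : (forall p, N (m p) <= r * (jap p.1.1 + jap p.1.2 + jap p.2)) ->
  hb W2 a X -> hb W2 b Y -> hb W2 c Z ->
  hb W0 (T K m a b c) (r ^+ 2 * (9 * c0 ^+ 2 * (X * Y * Z))).
Proof.
move=> mr aX bY cZ; apply: (hb_T_const _ mr) => [p|J uJ]; first exact: japs_ge0.
exact: (conv_jap uK uJ na0 nb0 nc0 (hb2 aX) (hb2 bY) (hb2 cZ)).
Qed.

(** H^2 is an algebra here: [jap_triangle] distributes the weight of the output over the inputs, and
    [conv_jap] applies; 81 is 3^2 times 9. *)
Lemma T_H2 : (forall p, N (m p) <= r) -> hb W2 a X -> hb W2 b Y -> hb W2 c Z ->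
  hb W2 (T K m a b c) (r ^+ 2 * (81 * c0 ^+ 2 * (X * Y * Z))).
Proof.
move=> mr aX bY cZ; apply: (hb_T (M := fun=> r)) => [k|//|J uJ]; first exact: sqr_ge0.
have := conv_jap uK uJ na0 nb0 nc0 (hb2 aX) (hb2 bY) (hb2 cZ).
move=> /(ler_wpM2l (_ : 0 <= 9 * r ^+ 2)).
rewrite (_ : 9 * r ^+ 2 * (9 * _ * _) = r ^+ 2 * (81 * c0 ^+ 2 * (X * Y * Z))); last by ring.
move=> h; apply: le_trans (h _); last by rewrite mulr_ge0// sqr_ge0.
have r0 : 0 <= r by apply: le_trans (mr (0, 0, 0)); exact: normc_ge0.
rewrite mulr_sumr; apply: ler_sum => k _.
rewrite /W2 (_ : 9 * r ^+ 2 = (3 * r) ^+ 2); last by ring.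
rewrite -!exprMn -!conv3Z lerXn2r ?nnegrE//.
- by apply: conv3_ge0 => p; rewrite !mulr_ge0 ?normc_ge0.
- by apply: conv3_ge0 => p; rewrite !mulr_ge0 ?na0 ?nb0 ?nc0.
apply: ler_sum => p /eqP <-.
rewrite [leRHS](_ : _ = 3 * (jap p.1.1 + jap p.1.2 + jap p.2) * (r * (na p.1.1 * nb p.1.2 * nc p.2))); last by ring.
apply: ler_wpM2r; first by rewrite !mulr_ge0 ?na0 ?nb0 ?nc0.
exact: jap_triangle.
Qed.

(** The three products of weights are the three choices of an unweighted slot; permuting the slots
    makes each an instance of [crit_bound]. *)
Lemma T_crit : (forall p, N (m p) <= r * (jap p.1.1 * jap p.1.2 + jap p.1.1 * jap p.2 + jap p.1.2 * jap p.2)) ->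
  hb Wr a X -> hb Wr b Y -> hb Wr c Z ->
  hb W0 (T K m a b c) (r ^+ 2 * (36 * 6 ^+ d * c0 * (X * Y * Z))).
Proof.
move=> mr aX bY cZ; apply: (hb_T_const _ mr) => [p|J uJ]; first by rewrite !addr_ge0 ?mulr_ge0.
have aX2 := hb2 (hb_weight W2r aX); have bY2 := hb2 (hb_weight W2r bY); have cZ2 := hb2 (hb_weight W2r cZ).
have h1 := crit_bound uK uJ na0 nb0 nc0 (hbr aX) (hbr bY) cZ2.
have h2 := crit_bound uK uJ na0 nc0 nb0 (hbr aX) (hbr cZ) bY2.
have h3 := crit_bound uK uJ nb0 nc0 na0 (hbr bY) (hbr cZ) aX2.
set S1 := fun p : I * I * I => jap p.1.1 * jap p.1.2 * (na p.1.1 * nb p.1.2 * nc p.2) in h1.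
set S2 := fun p : I * I * I => jap p.1.1 * jap p.1.2 * (na p.1.1 * nc p.1.2 * nb p.2) in h2.
set S3 := fun p : I * I * I => jap p.1.1 * jap p.1.2 * (nb p.1.1 * nc p.1.2 * na p.2) in h3.
apply: (@le_trans _ _ (\sum_(k <- J) 3 * (conv3 K S1 k ^+ 2 + conv3 K S2 k ^+ 2 + conv3 K S3 k ^+ 2))).
  apply: ler_sum => k _; apply: le_trans (sqr_sum3 _ _ _).
  rewrite -(conv3_swap23 K S2) -(conv3_swap23 K S3) -(conv3_swap12 K (fun p => S3 _)) -!conv3D.
  rewrite le_eqVlt; apply/orP; left; apply/eqP; congr (_ ^+ 2).
  by apply: eq_bigr => p _; rewrite /S1 /S2 /S3/=; ring.
rewrite -mulr_sumr !big_split/=.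
rewrite (_ : 36 * 6 ^+ d * c0 * (X * Y * Z) = 3 * (4 * 6 ^+ d * c0 * (X * Y * Z) + 4 * 6 ^+ d * c0 * (X * Z * Y) + 4 * 6 ^+ d * c0 * (Y * Z * X))); last by ring.
by rewrite ler_wpM2l// !lerD.
Qed.

End trilinear_bounds.

(** * Sobolev norms and products *)

Section norms.
Context {R : realType} {d : nat}.
Local Notation P := (@torus_prob R d).
Local Notation I := 'rV[int]_d.
Local Notation fc := (@fourier R d).
Implicit Types (f g h : torus R d -> R[i]) (k l : I).

Lemma L2normE f : l2 P f -> L2norm f = (Num.sqrt (n2 P f))%:E.
Proof.
move=> [mf if_]; rewrite /L2norm unlock /=.
under eq_integral => x _ do rewrite ger0_norm ?normc_ge0// powR_mulrn ?normc_ge0//.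
rewrite -[X in (X `^ _)%E]fineK; last exact: integrable_fin_num.
by rewrite poweR_EFin powR12_sqrt ?n2_ge0.
Qed.

Lemma L2_l2 f : L2 f -> l2 P f.
Proof.
move=> [m1 m2]; rewrite /L2norm unlock /= => h; split=> //.
have {}h := lty_poweRy (_ : 2^-1 != 0 :> R) h.
apply/integrableP; split.
  by apply/measurable_EFinP; apply: measurable_normc_sqr.
apply: le_lt_trans (h _); last by rewrite invr_eq0.
rewrite le_eqVlt; apply/orP; left; apply/eqP; apply: eq_integral => x _ /=.
by rewrite ger0_norm ?sqr_ge0// ger0_norm ?normc_ge0// powR_mulrn ?normc_ge0.
Qed.

Lemma l2_L2 f : l2 P f -> L2 f.
Proof. by move=> lf; split; [case: lf => -[]|case: lf => -[]|rewrite L2normE// ltry]. Qed.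

Lemma Hnorm_bnd (delta M : R) f : 0 <= M -> (Hnorm delta f <= M%:E)%E ->
  bnd (fun k => (1 + freq2 k) `^ delta * N (fc f k) ^+ 2) (M ^+ 2).
Proof.
move=> M0 hM K uK; rewrite -lee_fin.
have e0 : (0 <= \esum_(k in [set: I]) ((1 + freq2 k) `^ delta * N (fc f k) ^+ 2)%:E)%E.
  by apply: esum_ge0 => k _; rewrite lee_fin mulr_ge0 ?powR_ge0 ?sqr_ge0.
apply: (@le_trans _ _ (\esum_(k in [set: I]) ((1 + freq2 k) `^ delta * N (fc f k) ^+ 2)%:E)).
  apply: esum_ge; exists [set` K]; first by split=> //; exact: finite_seq.
  by rewrite -fsbig_seq// sumEFin.
have := hM; rewrite /Hnorm; move: (\esum_(_ in _) _) e0 => [s||] s0 //; last first.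
  by rewrite /poweR invr_eq0 pnatr_eq0/= leye_eq.
rewrite poweR_EFin !lee_fin powR12_sqrt// => h.
by rewrite -(sqr_sqrtr s0) lerXn2r ?nnegrE ?sqrtr_ge0.
Qed.

(* the Fourier coefficients of the conjugate *)
Definition cb (a : I -> R[i]) k := (a (- k))^*.

Lemma hb_cb (W : I -> R) (a : I -> R[i]) X : (forall k, W (- k) = W k) -> hb W a X -> hb W (cb a) X.
Proof.
move=> WN aX K uK.
have := aX [seq - k | k <- K]; rewrite big_map map_inj_uniq; last exact: oppr_inj.
move=> /(_ uK); apply: le_trans; apply: ler_sum => k _.
by rewrite WN /cb normc_conj.
Qed.

Lemma fourier_conj_fun f : l2 P f -> forall k, fc (conj_fun f) k = cb (fc f) k.
Proof. by move=> lf k; rewrite fourier_conj//; exact: l2_cible. Qed.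

(** [multiplier] is a choice with default value 0, so its coefficients are known only once
    Riesz-Fischer provides a function to choose. *)
Lemma multiplier_spec (m : I -> R[i]) f C : l2 P f ->
  bnd (fun k => N (m k * fc f k) ^+ 2) C ->
  l2 P (multiplier m f) /\ forall k, fc (multiplier m f) k = m k * fc f k.
Proof.
move=> lf mC; have [g lg [gm _]] := riesz_fischer_torus mC.
have ex : exists g, L2 g /\ forall k, fc g k = m k * fc f k by exists g; split=> //; exact: l2_L2.
by have [/L2_l2] := xgetPex (fun=> 0) ex.
Qed.

Lemma multiplier_bounded (m : I -> R[i]) (r : R) f : l2 P f -> (forall k, N (m k) <= r) ->
  l2 P (multiplier m f) /\ forall k, fc (multiplier m f) k = m k * fc f k.
Proof.
move=> lf mr; apply: (@multiplier_spec _ _ (r ^+ 2 * n2 P f)) => // K uK.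
apply: le_trans (ler_wpM2l (sqr_ge0 r) (bessel_torus lf uK)).
rewrite mulr_sumr; apply: ler_sum => k _.
rewrite Normc.normcM exprMn ler_wpM2r ?sqr_ge0// lerXn2r ?nnegrE ?normc_ge0//.
exact: le_trans (normc_ge0 _) (mr k).
Qed.

Lemma hb_mul (W : I -> R) (m a : I -> R[i]) (r X : R) : (forall k, 0 <= W k) ->
  (forall k, N (m k) <= r) -> hb W a X -> hb W (fun k => m k * a k) (r ^+ 2 * X).
Proof.
move=> Wp mr aX K uK; apply: le_trans (ler_wpM2l (sqr_ge0 r) (aX K uK)).
rewrite mulr_sumr; apply: ler_sum => k _.
rewrite Normc.normcM exprMn mulrCA; apply: ler_wpM2r; first by apply: mulr_ge0; rewrite ?sqr_ge0.
by rewrite lerXn2r ?nnegrE ?normc_ge0// (le_trans _ (mr k)) ?normc_ge0.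
Qed.

Lemma hb_ext (W : I -> R) (a b : I -> R[i]) X : (forall k, a k = b k) -> hb W a X -> hb W b X.
Proof. by move=> ab aX K uK; under eq_bigr do rewrite -ab; exact: aX. Qed.

Lemma hb_sum (W : I -> R) (J : Type) (s : seq J) (a : J -> I -> R[i]) (X : J -> R) :
  (forall k, 0 <= W k) -> (forall j, hb W (a j) (X j)) ->
  hb W (fun k => \sum_(j <- s) a j k) ((size s)%:R * \sum_(j <- s) X j).
Proof.
move=> Wp aX K uK.
apply: (@le_trans _ _ (\sum_(k <- K) (size s)%:R * \sum_(j <- s) W k * N (a j k) ^+ 2)).
  apply: ler_sum => k _.
  rewrite [leRHS](_ : _ = W k * ((size s)%:R * \sum_(j <- s) N (a j k) ^+ 2)); last first.
    by rewrite -mulr_sumr mulrCA.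
  apply: ler_wpM2l => //.
  apply: (@le_trans _ _ ((\sum_(j <- s) N (a j k)) ^+ 2)).
    by rewrite lerXn2r ?nnegrE ?normc_ge0 ?sumr_ge0 ?normc_sum// => j _; exact: normc_ge0.
  have -> : (size s)%:R = \sum_(j <- s) 1 :> R by rewrite big_const_seq count_predT iter_addr_0.
  apply: cauchy_sum => [j|//|j|j]; first exact: normc_ge0; first exact: sqr_ge0.
  by rewrite mul1r.
rewrite -mulr_sumr ler_wpM2l// exchange_big/=; apply: ler_sum => j _; exact: aX.
Qed.

Lemma hb_add (W : I -> R) (a b : I -> R[i]) X Y : (forall k, 0 <= W k) ->
  hb W a X -> hb W b Y -> hb W (fun k => a k + b k) (2 * (X + Y)).
Proof.
move=> Wp aX bY.
have := @hb_sum W bool [:: true; false] (fun j => if j then a else b) (fun j => if j then X else Y) Wp _.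
rewrite !big_cons big_nil/= addr0 => h; apply: hb_ext (h _); last by case.
by move=> k; rewrite !big_cons big_nil addr0.
Qed.

Lemma hb_le (W : I -> R) (a : I -> R[i]) X Y : hb W a X -> X <= Y -> hb W a Y.
Proof. by move=> aX XY K uK; exact: le_trans (aX K uK) XY. Qed.

(** On a finite set the total weight is finite, so a uniform error on the coefficients is harmless
    even for unbounded weights. The radius depends on neither [x] nor [y]. *)
Lemma hb_pert (W : I -> R) K X e : (forall k, 0 <= W k) -> 0 <= X -> 0 < e ->
  exists2 r, 0 < r & forall x y : I -> R[i], \sum_(k <- K) W k * N (y k) ^+ 2 <= X ->
    (forall k, N (x k - y k) <= r) -> \sum_(k <- K) W k * N (x k) ^+ 2 <= X + e.
Proof.
move=> Wp X0 e0.
pose S := \sum_(k <- K) W k.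
have S0 : 0 <= S by exact: sumr_ge0.
(* Young's parameter: (1 + t) X exceeds X by at most e / 2, and [r] then makes (1 + 1 / t) r S at
   most e / 2. *)
pose t := e / (2 * (X + 1)).
have t0 : 0 < t by rewrite divr_gt0// mulr_gt0//; lra.
pose r := Num.min 1 (e / (2 * ((1 + t^-1) * (S + 1)))).
have tV0 : 0 < t^-1 by rewrite invr_gt0.
have den : 0 < 2 * ((1 + t^-1) * (S + 1)) by rewrite !mulr_gt0//; lra.
have r0 : 0 < r by rewrite lt_min ltr01 divr_gt0.
have r1 : r <= 1 by rewrite ge_min lexx.
have re : r * (2 * ((1 + t^-1) * (S + 1))) <= e by rewrite -ler_pdivlMr// ge_min lexx orbT.
exists r => // x y hy xy.
have ty : t * X <= e / 2.
  rewrite /t mulrAC ler_pdivrMr; last by rewrite mulr_gt0//; lra.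
  rewrite (_ : e / 2 * (2 * (X + 1)) = e * (X + 1)); last by field.
  by rewrite ler_wpM2l ?ltW//; lra.
apply: (@le_trans _ _ ((1 + t) * \sum_(k <- K) W k * N (y k) ^+ 2 + (1 + t^-1) * r * S)).
  rewrite !mulr_sumr -big_split/=; apply: ler_sum => k _.
  rewrite (_ : _ + _ = W k * ((1 + t) * N (y k) ^+ 2 + (1 + t^-1) * r)); last by ring.
  rewrite ler_wpM2l//.
  have h1 : N (x k) <= N (y k) + N (x k - y k).
    by apply: le_trans (complex.le_normcD _ _); rewrite addrC subrK.
  have h2 : N (x k - y k) ^+ 2 <= r.
    rewrite -[leRHS]mulr1 expr2; apply: ler_pM; rewrite ?normc_ge0 ?xy//.
    exact: le_trans (xy k) r1.
  have := normc_ge0 (x k); have := normc_ge0 (y k); have := normc_ge0 (x k - y k).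
  move: h1 h2; move: (N (x k)) (N (y k)) (N (x k - y k)) => p q s h1 h2 s0 q0 p0.
  have h3 : p ^+ 2 <= (q + s) ^+ 2 by rewrite lerXn2r ?nnegrE ?addr_ge0.
  have h4 : 2 * (q * s) <= t * q ^+ 2 + t^-1 * s ^+ 2.
    rewrite -subr_ge0 (_ : _ - _ = t^-1 * (t * q - s) ^+ 2); last by field; rewrite gt_eqF.
    by rewrite mulr_ge0 ?sqr_ge0// invr_ge0 ltW.
  have h5 : (1 + t^-1) * s ^+ 2 <= (1 + t^-1) * r.
    by rewrite ler_wpM2l// addr_ge0// invr_ge0 ltW.
  apply: (le_trans h3); rewrite (_ : (q + s) ^+ 2 = q ^+ 2 + 2 * (q * s) + s ^+ 2); last by ring.
  lra.
have h1 : (1 + t) * \sum_(k <- K) W k * N (y k) ^+ 2 <= (1 + t) * X.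
  by rewrite ler_wpM2l// addr_ge0// ltW.
have h2 : (1 + t^-1) * r * S <= e / 2.
  rewrite -(@ler_pM2l _ 2)// (_ : 2 * (e / 2) = e); last by field.
  apply: le_trans re; rewrite (_ : 2 * _ = r * (2 * ((1 + t^-1) * S))); last by ring.
  apply: ler_wpM2l; first exact: ltW.
  apply: ler_wpM2l => //; apply: ler_wpM2l; first by lra.
  by lra.
lra.
Qed.

Lemma hb_approx (W : I -> R) (x : I -> R[i]) X : (forall k, 0 <= W k) ->
  (forall e, 0 < e -> exists2 y, hb W y X & forall k, N (x k - y k) <= e) -> hb W x X.
Proof.
move=> Wp h K uK; apply/ler_addgt0Pl => e e0.
have X0 : 0 <= X by have [//|y yX _] := h 1; exact: hb_ge0 yX.
have [r r0 hr] := hb_pert K Wp X0 e0; have [y yX xy] := h r r0.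
by rewrite addrC; exact: hr (yX K uK) xy.
Qed.

Lemma l2_of_hb f X : cible P f -> hb W0 (fc f) X -> l2 P f /\ n2 P f <= X.
Proof.
move=> if_ fX; apply: parseval => // K uK; apply: le_trans (fX K uK).
by apply: ler_sum => k _; rewrite mul1r.
Qed.

End norms.

(** * Products of functions and truncated convolutions *)

Section products.
Context {R : realType} {d : nat}.
Hypothesis d3 : (d <= 3)%N.
Local Notation P := (@torus_prob R d).
Local Notation I := 'rV[int]_d.
Local Notation fc := (@fourier R d).
Local Notation tp n f := (tpoly (@character R d) (@box d n) (fc f)).
Local Notation c0 := (10 ^+ d : R).
Implicit Types (f g h : torus R d -> R[i]) (k l : I).

Lemma hb2_sup f X : l2 P f -> hb W2 (fc f) X -> bnd (fun k => N (fc f k)) (Num.sqrt (c0 * X)).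
Proof.
move=> lf fX K uK; apply: (l1_le d3 uK (a := fun k => N (fc f k))) => [l|]; first exact: normc_ge0.
by apply: le_trans (fX K uK); apply: ler_sum => k _; rewrite exprMn.
Qed.

Lemma tp_le n f X x : l2 P f -> hb W2 (fc f) X -> N (tp n f x) <= Num.sqrt (c0 * X).
Proof.
move=> lf fX; apply: (le_trans (normc_sum _ _ _)).
under eq_bigr do rewrite Normc.normcM normc_character mulr1.
by apply: hb2_sup => //; exact: box_uniq.
Qed.

Lemma tp_l2 n f : l2 P (tp n f).
Proof. exact: (tpoly_l2 P measurable_character normc_character). Qed.

Lemma ae_le f X : l2 P f -> hb W2 (fc f) X -> {ae P, forall x, N (f x) <= Num.sqrt (c0 * X)}.
Proof. by move=> lf fX; apply: sup_bound => //; exact: hb2_sup. Qed.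

Lemma n2_tail n f X : l2 P f -> hb W2 (fc f) X ->
  n2 P (fun x => f x - tp n f x) <= X / (1 + n%:R ^+ 2) ^+ 2.
Proof.
move=> lf fX; have b0 : 0 < (1 + n%:R ^+ 2) :> R by rewrite ltr_wpDr ?sqr_ge0.
apply: n2_sub_tpoly_le => //; first exact: box_uniq.
move=> L uL Ln; rewrite ler_pdivlMr ?exprn_gt0// mulr_suml.
apply: le_trans (fX L uL); rewrite big_seq [leRHS]big_seq; apply: ler_sum => k kL.
rewrite mulrC ler_wpM2r ?sqr_ge0// /W2 lerXn2r ?nnegrE ?(ltW b0) ?(ltW (jap_gt0 _))//.
exact: notin_box (Ln k kL).
Qed.

Lemma Rint_normc_le f c : l2 P f -> 0 < c -> \int[P]_x N (f x) <= c * n2 P f + c^-1.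
Proof.
move=> lf c0; rewrite -[c^-1](Rint_cst P) -RintZ; last by case: lf.
rewrite -RintD; [|by apply: ibleZ; case: lf|exact: ible_cst].
apply: Rint_le; [exact/ible_normc/l2_cible|by apply: ibleD; [apply: ibleZ; case: lf|exact: ible_cst]|].
move=> x; have := normc_ge0 (f x); move: (N _) => a a0.
rewrite -(@ler_pM2l _ c)// mulrDr mulfV ?gt_eqF// mulrA -expr2.
have : 0 <= (c * a - 1) ^+ 2 by rewrite sqr_ge0.
have : 0 <= c * a by rewrite mulr_ge0// ltW.
nra.
Qed.

Lemma l2_le_ae f g c : cmeas f -> l2 P g -> 0 <= c -> {ae P, forall x, N (f x) <= c * N (g x)} -> l2 P f.
Proof.
move=> mf [mg ig] c0' fg; split=> //.
have m1 := measurable_normc_sqr mf; have m2 := measurable_normc_sqr mg.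
have mm : measurable_fun setT (fun x => Num.min (N (f x) ^+ 2) (c ^+ 2 * N (g x) ^+ 2)).
  by apply: measurable_minr => //; apply: measurable_funM => //; exact: measurable_cst.
apply: (@ible_ae _ _ _ P (fun x => Num.min (N (f x) ^+ 2) (c ^+ 2 * N (g x) ^+ 2))) => //.
  apply: filterS fg => x fg; rewrite min_l// -exprMn lerXn2r ?nnegrE ?normc_ge0//.
  by rewrite mulr_ge0 ?normc_ge0.
apply: (ible_le (v := fun x => c ^+ 2 * N (g x) ^+ 2)) => // [x|]; last exact: ibleZ.
have h0 : 0 <= c ^+ 2 * N (g x) ^+ 2 by apply: mulr_ge0; exact: sqr_ge0.
by rewrite ger0_norm ?ge_min ?lexx ?orbT// le_min sqr_ge0 h0.
Qed.

(** Two factors in H^2 are bounded almost everywhere, so the third only needs to be square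
    integrable. *)
Lemma prod3_l2 f g h X : l2 P f -> l2 P g -> l2 P h -> hb W2 (fc g) X -> hb W2 (fc h) X ->
  l2 P (fun x => f x * g x * h x).
Proof.
move=> lf lg lh gX hX; have X0 := hb_ge0 gX; have b0 : 0 <= c0 * X by rewrite mulr_ge0 ?exprn_ge0.
apply: (@l2_le_ae _ f (c0 * X)) => //.
  by apply: cmeasM; [apply: cmeasM; [case: lf|case: lg]|case: lh].
apply: filterS2 (ae_le lg gX) (ae_le lh hX) => x hg hh.
rewrite !Normc.normcM -mulrA mulrC; apply: ler_wpM2r; first exact: normc_ge0.
rewrite -[leRHS]sqr_sqrtr// expr2; apply: ler_pM => //; exact: normc_ge0.
Qed.

Lemma tpoly_prod3 n (a b c : I -> R[i]) (x : torus R d) :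
  tpoly character (box n) a x * tpoly character (box n) b x * tpoly character (box n) c x =
  \sum_(p <- tri (box n)) (a p.1.1 * b p.1.2 * c p.2) * character (fsum p) x.
Proof.
rewrite /tri !big_allpairs_dep/= -mulrA mulr_suml; apply: eq_bigr => k1 _.
rewrite mulr_suml mulr_sumr; apply: eq_bigr => k2 _.
rewrite !mulr_sumr; apply: eq_bigr => k3 _.
by rewrite /fsum/= !characterD; ring.
Qed.

Lemma fourier_tpoly_prod3 n (a b c : I -> R[i]) k :
  fc (fun x => tpoly character (box n) a x * tpoly character (box n) b x * tpoly character (box n) c x) k
  = T (box n) (fun=> 1) a b c k.
Proof.
under [X in fc X]eq_fun do rewrite tpoly_prod3.
have ie l : cible P (character l) by exact/l2_cible/(e_l2 P measurable_character normc_character).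
rewrite fourierE /fco.
transitivity (\sum_(p <- tri (box n)) (a p.1.1 * b p.1.2 * c p.2) * (fsum p == k)%:R).
  under [X in cint _ X]eq_fun do rewrite mulr_suml.
  rewrite cint_sum; last first.
    by move=> p; apply: (cibleM_e measurable_character normc_character); exact: cibleZ.
  apply: eq_bigr => p _; rewrite -character_orth -cintZ; last exact: (cibleM_e measurable_character normc_character).
  by congr cint; apply/funext => x; rewrite mulrA.
rewrite /T [RHS]big_mkcond; apply: eq_bigr => p _; case: (fsum p == k); first by rewrite mulr1 mul1r.
by rewrite mulr0.
Qed.

(** A coefficient is bounded by the L^1 norm. The difference of the two triple products telescopes
    into terms with one tail, small in L^1, and two factors bounded through H^2. *)
Lemma prod3_approx_n n f g h X : 0 <= X -> l2 P f -> l2 P g -> l2 P h ->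
  hb W2 (fc f) X -> hb W2 (fc g) X -> hb W2 (fc h) X -> forall k,
  N (fc (fun x => f x * g x * h x) k - T (box n) (fun=> 1) (fc f) (fc g) (fc h) k) <=
    3 * (c0 * X) * (X + 1) / (1 + n%:R ^+ 2).
Proof.
move=> X0 lf lg lh fX gX hX k; set B := Num.sqrt (c0 * X).
have cX0 : 0 <= c0 * X by rewrite mulr_ge0 ?exprn_ge0.
have B0 : 0 <= B by exact: sqrtr_ge0.
have B2 : B * B = c0 * X by rewrite -expr2 sqr_sqrtr.
have lp := prod3_l2 lf lg lh gX hX.
have lF := tp_l2 n f; have lG := tp_l2 n g; have lH := tp_l2 n h.
have bF x := @tp_le n f X x lf fX; have bG x := @tp_le n g X x lg gX; have bH x := @tp_le n h X x lh hX.
have lP : l2 P (fun x => tp n f x * tp n g x * tp n h x).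
  apply: (@l2_bounded _ _ _ _ _ (B * B * B)).
    by apply: cmeasM; [apply: cmeasM; [case: lF|case: lG]|case: lH].
  by move=> x; rewrite !Normc.normcM; apply: ler_prod3; rewrite ?normc_ge0.
rewrite -fourier_tpoly_prod3 -fourierB; [|exact: l2_cible..].
apply: (le_trans (normc_fourier _ _)); first by apply: l2_cible; exact: l2B.
have l1 := l2B lf lF; have l2' := l2B lg lG; have l3 := l2B lh lH.
pose D x := B * B * (N (f x - tp n f x) + N (g x - tp n g x) + N (h x - tp n h x)).
have iD : ible P D by apply: ibleZ; apply: ibleD; [apply: ibleD|]; exact/ible_normc/l2_cible.
set q : R := 1 + n%:R ^+ 2; have q0 : 0 < q by rewrite ltr_wpDr ?sqr_ge0.
(* AM-GM with weight q: the squared tail X / q^2 contributes X / q and the constant contributes 1 /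
   q. *)
have tail u : l2 P u -> hb W2 (fc u) X -> \int[P]_x N (u x - tp n u x) <= (X + 1) / q.
  move=> lu uX; apply: (le_trans (Rint_normc_le (l2B lu (tp_l2 n u)) q0)).
  have := n2_tail n lu uX; rewrite -/q => /(ler_wpM2l (ltW q0)) h1.
  rewrite (_ : (X + 1) / q = X / q + q^-1) ?lerD2r; last by field; rewrite gt_eqF.
  rewrite (_ : X / q = q * (X / q ^+ 2)); last by field; rewrite gt_eqF.
  exact: h1.
apply: (@le_trans _ _ (\int[P]_x D x)).
  pose S x := f x * g x * h x - tp n f x * tp n g x * tp n h x.
  rewrite -[X in X <= _]/(\int[P]_x N (S x)).
  have mS : measurable_fun setT (fun x => N (S x)) by apply: measurable_normc; exact: (l2B lp lP).1.
  have mD := ible_meas iD.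
  have -> : \int[P]_x N (S x) = \int[P]_x Num.min (N (S x)) (D x).
    apply: Rintegral_ae => //; first exact: measurable_minr.
    apply: filterS2 (ae_le lg gX) (ae_le lh hX) => x hg hh.
    rewrite min_l// /S.
    rewrite (_ : f x * g x * h x - _ = (f x - tp n f x) * (g x * h x) + (g x - tp n g x) * (tp n f x * h x) + (h x - tp n h x) * (tp n f x * tp n g x)); last by ring.
    apply: (le_trans (complex.le_normcD _ _)); rewrite /D mulrDr; apply: lerD.
      apply: (le_trans (complex.le_normcD _ _)); rewrite mulrDr; apply: lerD.
        rewrite Normc.normcM mulrC ler_wpM2r ?normc_ge0// Normc.normcM; apply: ler_pM => //; exact: normc_ge0.
      rewrite Normc.normcM mulrC ler_wpM2r ?normc_ge0// Normc.normcM; apply: ler_pM => //; exact: normc_ge0.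
    rewrite Normc.normcM mulrC ler_wpM2r ?normc_ge0// Normc.normcM; apply: ler_pM => //; exact: normc_ge0.
  apply: Rint_le => //.
    apply: (ible_le (v := D)) => //; first exact: measurable_minr.
    by move=> x; rewrite ger0_norm ?ge_min ?lexx ?orbT// le_min normc_ge0 !mulr_ge0 ?addr_ge0 ?normc_ge0.
  by move=> x; rewrite ge_min lexx orbT.
rewrite /D RintZ; last by apply: ibleD; [apply: ibleD|]; exact/ible_normc/l2_cible.
rewrite RintD; [|by apply: ibleD; exact/ible_normc/l2_cible|exact/ible_normc/l2_cible].
rewrite RintD; [|exact/ible_normc/l2_cible..].
rewrite B2 [leRHS](_ : _ = c0 * X * ((X + 1) / q + (X + 1) / q + (X + 1) / q)); last by field; rewrite gt_eqF.
by rewrite ler_wpM2l// !lerD// tail.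
Qed.

(** The cutoff depends on the H^2 bound and on [e] only. This uniformity allows one truncation for a
    whole time interval. *)
Lemma prod3_approx X e : 0 < e -> exists n0, forall n, (n0 <= n)%N -> forall f g h,
  l2 P f -> l2 P g -> l2 P h -> hb W2 (fc f) X -> hb W2 (fc g) X -> hb W2 (fc h) X -> forall k,
  N (fc (fun x => f x * g x * h x) k - T (box n) (fun=> 1) (fc f) (fc g) (fc h) k) <= e.
Proof.
move=> e0; have [X0|X0] := ltP X 0.
  by exists 0%N => n _ f g h _ _ _ fX; have := hb_ge0 fX; rewrite leNgt X0.
set C := 3 * (c0 * X) * (X + 1); exists (Num.truncn (C / e)).+1 => n n0n f g h lf lg lh fX gX hX k.
apply: (le_trans (prod3_approx_n n X0 lf lg lh fX gX hX k)).
have q0 : 0 < 1 + n%:R ^+ 2 :> R by rewrite ltr_wpDr ?sqr_ge0.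
rewrite -/C ler_pdivrMr// -ler_pdivrMl// mulrC.
have h1 : C / e <= n%:R.
  by rewrite ltW// (lt_le_trans (truncnS_gt _))// ler_nat.
apply: (le_trans h1); have : 1 <= n%:R :> R by rewrite ler1n (leq_trans _ n0n).
move: (n%:R : R) => m m1; nra.
Qed.

Lemma prod3_hb2 f g h X Y Z : l2 P f -> l2 P g -> l2 P h ->
  hb W2 (fc f) X -> hb W2 (fc g) Y -> hb W2 (fc h) Z ->
  hb W2 (fc (fun x => f x * g x * h x)) (81 * c0 ^+ 2 * (X * Y * Z)).
Proof.
move=> lf lg lh fX gY hZ.
pose M := X + Y + Z; have X0 := hb_ge0 fX; have Y0 := hb_ge0 gY; have Z0 := hb_ge0 hZ.
apply: hb_approx => [k|e e0]; first exact: sqr_ge0.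
have [n0 /(_ n0 (leqnn _)) h1] := prod3_approx M e0.
exists (T (box n0) (fun=> 1) (fc f) (fc g) (fc h)).
  have := @T_H2 _ _ d3 (box n0) (fun=> 1) (fc f) (fc g) (fc h) 1 X Y Z (box_uniq n0).
  rewrite expr1n mul1r; apply => // p; by rewrite Normc.normc1.
by apply: h1 => //; [apply: hb_le fX _|apply: hb_le gY _|apply: hb_le hZ _]; rewrite /M; lra.
Qed.

End products.

(** * Complex derivatives and the phi functions *)

Section complex_derivatives.
Context {R : realType}.
Implicit Types (f g : R -> R[i]) (s t w : R) (l m z : R[i]).

Definition cder f s l :=
  is_derive s (1 : R) (fun x => Re (f x)) (Re l) /\ is_derive s (1 : R) (fun x => Im (f x)) (Im l).
Definition ccont f s :=
  continuous_at s (fun x => Re (f x)) /\ continuous_at s (fun x => Im (f x)).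

Lemma cder_ccont f s l : cder f s l -> ccont f s.
Proof.
by move=> [h1 h2]; split; apply/differentiable_continuous/derivable1_diffP; apply: ex_derive.
Qed.

Lemma cder_eq f s l m : cder f s l -> l = m -> cder f s m.
Proof. by move=> ? <-. Qed.

Lemma cder_cst z s : cder (fun=> z) s 0.
Proof. by split; exact: is_derive_cst. Qed.

Lemma cderD f g s l m : cder f s l -> cder g s m -> cder (fun x => f x + g x) s (l + m).
Proof.
move=> [f1 f2] [g1 g2]; split; under eq_fun do rewrite ReImE; rewrite ReImE; exact: is_deriveD.
Qed.

Lemma cderM f g s l m : cder f s l -> cder g s m ->
  cder (fun x => f x * g x) s (l * g s + f s * m).
Proof.
move=> [f1 f2] [g1 g2]; split; under eq_fun do rewrite ReImE; rewrite !ReImE.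
  have h1 := is_deriveM f1 g1; have h2 := is_deriveM f2 g2.
  by apply: (is_derive_eq (is_deriveB h1 h2)); rewrite /GRing.scale/=; ring.
have h1 := is_deriveM f1 g2; have h2 := is_deriveM f2 g1.
by apply: (is_derive_eq (is_deriveD h1 h2)); rewrite /GRing.scale/=; ring.
Qed.

Lemma cderZ f s l z : cder f s l -> cder (fun x => z * f x) s (z * l).
Proof. by move=> h; apply: (cder_eq (cderM (cder_cst z s) h)); rewrite mul0r add0r. Qed.

Lemma cderB f g s l m : cder f s l -> cder g s m -> cder (fun x => f x - g x) s (l - m).
Proof.
move=> h1 h2; have := cderD h1 (cderZ (-1) h2); rewrite mulN1r.
by under eq_fun do rewrite mulN1r.
Qed.

Lemma cder_sum (J : Type) (r : seq J) (Q : pred J) (f : J -> R -> R[i]) s (l : J -> R[i]) :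
  (forall j, cder (f j) s (l j)) ->
  cder (fun x => \sum_(j <- r | Q j) f j x) s (\sum_(j <- r | Q j) l j).
Proof.
move=> h; elim: r => [|j r IH].
  by rewrite big_nil; under eq_fun do rewrite big_nil; exact: cder_cst.
rewrite big_cons; under eq_fun do rewrite big_cons.
by case: (Q j) => //; exact: cderD.
Qed.

Lemma cder_real (p : R -> R) s (q : R) : is_derive s (1 : R) p q -> cder (fun x => (p x)%:C) s q%:C.
Proof. by move=> h; split=> //=; exact: is_derive_cst. Qed.

Lemma cder_comp f (p : R -> R) s l (q : R) : is_derive s (1 : R) p q -> cder f (p s) l ->
  cder (fun x => f (p x)) s (q%:C * l).
Proof.
move=> hp [f1 f2]; split; rewrite !ReImE/= mul0r ?subr0 ?addr0 mulrC.
- exact: (@is_derive1_comp _ (fun x => Re (f x)) p s _ _ f1 hp).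
- exact: (@is_derive1_comp _ (fun x => Im (f x)) p s _ _ f2 hp).
Qed.

Lemma cder_opp f s l : cder f (- s) l -> cder (fun x => f (- x)) s (- l).
Proof. by move=> h; apply: (cder_eq (cder_comp (is_deriveNid s (1:R)) h)); rewrite raddfN mulN1r. Qed.

Lemma cder_ext f g s l : (forall x, f x = g x) -> cder f s l -> cder g s l.
Proof. by move=> /funext ->. Qed.

Lemma ccontD f g s : ccont f s -> ccont g s -> ccont (fun x => f x + g x) s.
Proof.
by move=> [f1 f2] [g1 g2]; split; rewrite /continuous_at; under eq_fun do rewrite ReImE; rewrite ReImE; by [exact: cvgD f1 g1|exact: cvgD f2 g2].
Qed.

Lemma ccontB f g s : ccont f s -> ccont g s -> ccont (fun x => f x - g x) s.
Proof.
by move=> [f1 f2] [g1 g2]; split; rewrite /continuous_at; under eq_fun do rewrite !ReImE; rewrite !ReImE; by [exact: cvgB f1 g1|exact: cvgB f2 g2].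
Qed.

Lemma ccontM f g s : ccont f s -> ccont g s -> ccont (fun x => f x * g x) s.
Proof.
move=> [f1 f2] [g1 g2]; split; rewrite /continuous_at; under eq_fun do rewrite ReImE; rewrite ReImE.
  exact: cvgB (cvgM f1 g1) (cvgM f2 g2).
exact: cvgD (cvgM f1 g2) (cvgM f2 g1).
Qed.

Lemma ccont_comp f (p : R -> R) s : continuous_at s p -> ccont f (p s) -> ccont (fun x => f (p x)) s.
Proof.
by move=> hp [f1 f2]; split;
  [exact: (@continuous_comp _ _ _ p (fun x => Re (f x)))|exact: (@continuous_comp _ _ _ p (fun x => Im (f x)))].
Qed.

Lemma cder_id s : cder (fun x => x%:C) s 1.
Proof. exact: cder_real (is_derive_id s (1 : R)). Qed.

(* The increment is paired with the derivative through Cauchy-Schwarz, which reduces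
   the vector-valued inequality to the scalar mean value theorem. *)
Lemma mvt_sum (I : Type) (K : seq I) (W : I -> R) (V V' : R -> I -> R[i]) (a b X : R) :
  (forall k, 0 <= W k) -> a <= b -> 0 <= X ->
  (forall k s, a <= s <= b -> ccont (V^~ k) s) ->
  (forall k s, a < s < b -> cder (V^~ k) s (V' s k)) ->
  (forall s, a < s < b -> \sum_(k <- K) W k * N (V' s k) ^+ 2 <= X) ->
  \sum_(k <- K) W k * N (V b k - V a k) ^+ 2 <= X * (b - a) ^+ 2.
Proof.
move=> Wp ab X0 cV dV V'X.
have [ab'|ba'|e] := ltgtP a b; last 1 first.
- by rewrite e subrr expr0n mulr0 big1// => k _; rewrite subrr Normc.normc0 expr0n mulr0.
- pose h k := V b k - V a k.
  pose G s := \sum_(k <- K) ((W k)%:C * (h k)^* ) * V s k.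
  pose G' s := \sum_(k <- K) ((W k)%:C * (h k)^* ) * V' s k.
  pose S := \sum_(k <- K) W k * N (h k) ^+ 2.
  have GE : Re (G b) - Re (G a) = S.
    have -> : Re (G b) - Re (G a) = Re (G b - G a) by rewrite !ReImE.
    rewrite /G -sumrB [X in Re X](_ : _ = S%:C)//.
    rewrite /S rmorph_sum; apply: eq_bigr => k _.
    by rewrite -mulrBr -/(h k) -mulrA [X in _ * X]mulrC mulc_conj -rmorphM.
  have S0 : 0 <= S by apply: sumr_ge0 => k _; rewrite mulr_ge0 ?sqr_ge0.
  have [c cab Gc] : exists2 c, c \in `]a, b[%R & Re (G b) - Re (G a) = Re (G' c) * (b - a).
    apply: (@MVT _ (fun s => Re (G s)) (fun s => Re (G' s))) => //.
      move=> x; rewrite in_itv/= => xab.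
      by have [] : cder G x (G' x) by apply: cder_sum => k; apply: cderZ; exact: dV.
    apply: continuous_in_subspaceT => x /set_mem/=; rewrite in_itv/= => xab.
    have [//] : ccont G x.
    rewrite /G; elim: (K) => [|k K' IH].
      rewrite (_ : (fun s => _) = fun=> 0); last by apply/funext => s; rewrite big_nil.
      by apply: cder_ccont (cder_cst _ _).
    rewrite (_ : (fun s => _) = fun s => (W k)%:C * (h k)^* * V s k + \sum_(k <- K') (W k)%:C * (h k)^* * V s k); last first.
      by apply/funext => s; rewrite big_cons.
    apply: ccontD => //; apply: ccontM; last exact: cV.
    exact: cder_ccont (cder_cst _ _).
  move: cab; rewrite in_itv/= => cab.
  have hG : Re (G' c) ^+ 2 <= S * X.
    apply: (@le_trans _ _ ((\sum_(k <- K) W k * (N (h k) * N (V' c k))) ^+ 2)).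
      rewrite -[leLHS]real_normK ?num_real// lerXn2r ?nnegrE ?normr_ge0//.
        by apply: sumr_ge0 => k _; rewrite !mulr_ge0 ?normc_ge0.
      apply: le_trans (le_Re_normc _) _; apply: le_trans (normc_sum _ _ _) _.
      apply: ler_sum => k _; rewrite !Normc.normcM normc_conj normc_real ger0_norm//.
      by rewrite mulrA.
    apply: le_trans (ler_wpM2l S0 (V'X c cab)).
    apply: cauchy_sum => k; rewrite ?mulr_ge0 ?normc_ge0 ?sqr_ge0//.
    by rewrite le_eqVlt; apply/orP; left; apply/eqP; ring.
  rewrite -/S; have := Gc; rewrite GE => SE.
  (* [S] is both the increment of the pairing and the quantity to be bounded, so a factor of [S]
     cancels. *)
  have : S ^+ 2 <= S * (X * (b - a) ^+ 2).
    rewrite {1}SE exprMn mulrA; apply: ler_wpM2r => //; exact: sqr_ge0.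
  have [->|Sn0] := eqVneq S 0; first by rewrite mulr_ge0// sqr_ge0.
  by rewrite expr2 ler_pM2l// lt_def Sn0.
- by move: ab; rewrite leNgt ba'.
Qed.

Lemma mvt_normc f (f' : R -> R[i]) (a b r : R) : a <= b -> 0 <= r ->
  (forall s, a <= s <= b -> cder f s (f' s)) -> (forall s, a <= s <= b -> N (f' s) <= r) ->
  N (f b - f a) <= r * (b - a).
Proof.
move=> ab r0 df f'r.
have := @mvt_sum unit [:: tt] (fun=> 1) (fun s _ => f s) (fun s _ => f' s) a b (r ^+ 2).
rewrite !big_cons !big_nil !mul1r !addr0 => h.
rewrite -(@ler_pXn2r _ 2) ?nnegrE ?normc_ge0 ?mulr_ge0 ?subr_ge0// exprMn; apply: h => //.
- exact: sqr_ge0.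
- by move=> _ s sab; exact: cder_ccont (df s sab).
- by move=> _ s /andP[/ltW ? /ltW ?]; apply: df; apply/andP.
- move=> s /andP[/ltW ? /ltW ?]; rewrite big_cons big_nil mul1r addr0 lerXn2r ?nnegrE ?normc_ge0//.
  by apply: f'r; apply/andP.
Qed.

End complex_derivatives.

(** * Phases and the phi functions on the imaginary axis *)

Section phases.
Context {R : realType}.
Implicit Types (s t w x y z : R).

Definition E t : R[i] := cos t +i* sin t.

Lemma cexpE t : cexp ('i%C * t%:C) = E t.
Proof.
rewrite /cexp (_ : 'i%C * t%:C = 0 +i* t); last by apply: complex_eq; rewrite /= ?mul0r ?mul1r ?mulr0 ?subr0 ?add0r ?addr0.
by rewrite /= expR0 mul1r.
Qed.

Lemma E0 : E 0 = 1. Proof. by rewrite /E cos0 sin0. Qed.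

Lemma ED x y : E (x + y) = E x * E y.
Proof. by apply: complex_eq; rewrite /= ?cosD ?sinD; ring. Qed.

Lemma EN x : E (- x) = (E x)^*.
Proof. by apply: complex_eq; rewrite /= ?cosN ?sinN. Qed.

Lemma normc_E x : N (E x) = 1.
Proof. by rewrite /E /Normc.normc cos2Dsin2 sqrtr1. Qed.

Lemma mulEN x : E x * E (- x) = 1.
Proof. by rewrite -ED subrr E0. Qed.

Lemma normci : N ('i%C : R[i]) = 1.
Proof. by rewrite /Normc.normc expr0n expr1n add0r sqrtr1. Qed.

Lemma cder_E w s : cder (fun x => E (x * w)) s ('i%C * w%:C * E (s * w)).
Proof.
have hw : is_derive s (1 : R) ( *%R^~ w) w.
  have := is_deriveM (is_derive_id s (1 : R)) (is_derive_cst w s (1:R)).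
  by move=> h; apply: (is_derive_eq h); rewrite scaler0 add0r /GRing.scale/= mulr1.
have hE : cder E (s * w) ('i%C * E (s * w)).
  split; rewrite !ReImE/=.
    by apply: (is_derive_eq (is_derive_cos _)); ring.
  by apply: (is_derive_eq (is_derive_sin _)); ring.
by apply: (cder_eq (cder_comp hw hE)); rewrite mulrCA mulrA.
Qed.

Lemma cder_E1 s : cder E s ('i%C * E s).
Proof.
have := @cder_E 1 s; rewrite !mulr1.
by under eq_fun do rewrite mulr1.
Qed.

(* [P1 x s = s phi1(isx)] and [P2 x s = s^2 phi2(isx)]: antiderivatives in [s] of [E (s x)]
   and [s E (s x)], which makes the bounds on [phi1] and [phi2] cases of the mean value inequality. *)
Definition P1 x s : R[i] := if x == 0 then s%:C else (E (s * x) - 1) / ('i%C * x%:C).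
Definition P2 x s : R[i] := if x == 0 then (s%:C) ^+ 2 / 2 else (s%:C * E (s * x) - P1 x s) / ('i%C * x%:C).

Lemma cderP1 x s : cder (P1 x) s (E (s * x)).
Proof.
rewrite /P1; case: eqP => [->|/eqP x0]; first by rewrite mulr0 E0; exact: cder_id.
have h := cderZ ('i%C * x%:C)^-1 (cderB (cder_E x s) (cder_cst 1 s)).
apply: cder_ext (cder_eq h _) => [u|]; first by rewrite mulrC.
rewrite subr0 mulrA mulVf ?mul1r// mulf_neq0 ?neq0Ci//.
by rewrite -[0]/((0:R)%:C) (inj_eq (@complexI _)).
Qed.

Lemma cderP2 x s : cder (P2 x) s (s%:C * E (s * x)).
Proof.
rewrite /P2; case: eqP => [->|/eqP x0].
  rewrite mulr0 E0 mulr1; have := cderZ (2^-1) (cderM (cder_id s) (cder_id s)) => h.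
  apply: cder_ext (cder_eq h _) => [u|]; first by rewrite mulrC expr2.
  by rewrite mulr1 mul1r -mulr2n -[X in _ * X]mulr_natl mulKf// pnatr_eq0.
have h := cderZ ('i%C * x%:C)^-1 (cderB (cderM (cder_id s) (cder_E x s)) (cderP1 x s)).
apply: cder_ext (cder_eq h _) => [u|]; first by rewrite mulrC.
rewrite mul1r [X in _ * X]addrAC subrr add0r mulrCA; congr (_ * _).
rewrite mulrA mulVf ?mul1r// mulf_neq0 ?neq0Ci//.
by rewrite -[0]/((0:R)%:C) (inj_eq (@complexI _)).
Qed.

Lemma P1_phi1 x s : P1 x s = s%:C * phi1 ('i%C * (s * x)%:C).
Proof.
rewrite /P1 /phi1; have [->|x0] := eqVneq x 0.
  by rewrite mulr0 mulr0 eqxx mulr1.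
have [->|s0] := eqVneq s 0; first by rewrite mul0r E0 subrr !mul0r.
have i0 : 'i%C != 0 :> R[i] by exact: neq0Ci.
have X0 : x%:C != 0 :> R[i] by rewrite -[0]/((0:R)%:C) (inj_eq (@complexI _)).
have S0 : s%:C != 0 :> R[i] by rewrite -[0]/((0:R)%:C) (inj_eq (@complexI _)).
rewrite rmorphM/= !mulf_eq0 (negPf i0) (negPf X0) (negPf S0)/= -rmorphM/= cexpE rmorphM/=.
by field; rewrite i0 X0 S0.
Qed.

Lemma P2_phi2 x s : P2 x s = s%:C ^+ 2 * phi2 ('i%C * (s * x)%:C).
Proof.
rewrite /P2 P1_phi1 /phi2; have [->|x0] := eqVneq x 0.
  by rewrite mulr0 mulr0 eqxx.
have [->|s0] := eqVneq s 0; first by rewrite !mul0r subrr mul0r expr0n/= mul0r.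
have i0 : 'i%C != 0 :> R[i] by exact: neq0Ci.
have X0 : x%:C != 0 :> R[i] by rewrite -[0]/((0:R)%:C) (inj_eq (@complexI _)).
have S0 : s%:C != 0 :> R[i] by rewrite -[0]/((0:R)%:C) (inj_eq (@complexI _)).
rewrite ifF; last by rewrite rmorphM/= !mulf_eq0 (negPf i0) (negPf X0) (negPf S0).
rewrite cexpE; move: (phi1 _) => p; rewrite rmorphM/=.
by field; rewrite i0 X0 S0.
Qed.

Lemma normcE1 y : N (E y - 1) <= `|y|.
Proof.
wlog y0 : y / 0 <= y => [h|].
  have [/h//|/ltW y0] := leP 0 y.
  rewrite -normrN -(opprK y) EN -[1]conjc1 -rmorphB normc_conj opprK; apply: h; lra.
have := @mvt_normc _ E (fun s => 'i%C * E s) 0 y 1 y0 ler01 (fun s _ => cder_E1 s).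
by rewrite E0 mul1r subr0 ger0_norm//; apply => s _; rewrite Normc.normcM normci normc_E mulr1.
Qed.

Lemma normcE2 y : N (E y - 1) <= 2.
Proof. by apply: (le_trans (normcB _ _)); rewrite normc_E Normc.normc1. Qed.

(** The mean value inequality with derivative i (E s - 1), bounded on [0, y] by its endpoint bound
    y; hence y^2 instead of y^2 / 2. *)
Lemma normcE_taylor y : N (E y - 1 - 'i%C * y%:C) <= y ^+ 2.
Proof.
wlog y0 : y / 0 <= y => [h|].
  have [/h//|/ltW y0] := leP 0 y.
  rewrite -sqrrN -normc_conj; have := h (- y); rewrite EN => h'.
  apply: le_trans (h' _); last by lra.
  rewrite le_eqVlt; apply/orP; left; apply/eqP; congr N; apply: complex_eq; rewrite /=; ring.
have := @mvt_normc _ (fun s => E s - 'i%C * s%:C) (fun s => 'i%C * (E s - 1)) 0 y y y0 y0.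
rewrite E0 mulr0 !subr0 expr2 => h.
rewrite addrAC; apply: h => s /andP[s0 sy].
  rewrite mulrBr; apply: cderB; first exact: cder_E1.
  by apply: cderZ; exact: cder_id.
rewrite Normc.normcM normci mul1r; apply: (le_trans (normcE1 s)).
by rewrite ger0_norm.
Qed.

Lemma normc_P1 x s : 0 <= s -> N (P1 x s) <= s.
Proof.
move=> s0; have := @mvt_normc _ (P1 x) (fun s => E (s * x)) 0 s 1 s0 ler01 (fun s _ => cderP1 x s).
have -> : P1 x 0 = 0 by rewrite P1_phi1 mul0r.
rewrite !subr0 mul1r; apply => u _.
by rewrite normc_E.
Qed.

Lemma normc_P2 x s : 0 <= s -> N (P2 x s) <= s ^+ 2.
Proof.
move=> s0; have := @mvt_normc _ (P2 x) (fun s => s%:C * E (s * x)) 0 s s s0 s0 (fun s _ => cderP2 x s).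
have -> : P2 x 0 = 0 by rewrite P2_phi2 expr0n mul0r.
rewrite !subr0 -expr2; apply => u /andP[u0 us].
by rewrite Normc.normcM normc_E mulr1 normc_real ger0_norm.
Qed.

Lemma normc_phi1 z : N (phi1 ('i%C * z%:C)) <= 1.
Proof. by have := @normc_P1 z 1 ler01; rewrite P1_phi1 mul1r mul1r. Qed.

Lemma normc_phi2 z : N (phi2 ('i%C * z%:C)) <= 1.
Proof. by have := @normc_P2 z 1 ler01; rewrite P2_phi2 !expr1n !mul1r. Qed.

Lemma normc_phi1_sub1 z : N (phi1 ('i%C * z%:C) - 1) <= `|z|.
Proof.
have := @mvt_normc _ (fun s => P1 z s - s%:C) (fun s => E (s * z) - 1) 0 1 `|z| ler01 (normr_ge0 _).
rewrite !P1_phi1 !mul0r !mul1r !subr0 mulr1; apply => s /andP[s0 s1].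
  by apply: cderB; [exact: cderP1|exact: cder_id].
apply: (le_trans (normcE1 _)); rewrite normrM ger0_norm// -[leRHS]mul1r.
by rewrite ler_wpM2r.
Qed.

End phases.

(** * Symbols of the exact flow and of the scheme *)

Section multipliers.
Context {R : realType} {d : nat}.
Hypothesis d3 : (d <= 3)%N.
Local Notation I := 'rV[int]_d.
Local Notation fr := (@freq2 R d).
Local Notation jap := (@jap R d).
Local Notation rho := (@rho R d).
Implicit Types (p : I * I * I) (s t tau : R).

(* the resonance function [phL] and its splitting into [2 |k3|^2] and the remainder [phy] *)
Definition phx p : R := 2 * fr p.2.
Definition phy p : R := fr (fsum p) - fr p.1.1 - fr p.1.2 - fr p.2.
Definition phL p : R := fr (fsum p) - fr p.1.1 - fr p.1.2 + fr p.2.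
Definition jsum p : R := jap p.1.1 + jap p.1.2 + jap p.2.

Lemma phLE p : phL p = phx p + phy p.
Proof. rewrite /phL /phx /phy; ring. Qed.

Lemma freq2_jap (k : I) : fr k = jap k - 1.
Proof. by rewrite /Convergence.jap addrC addKr. Qed.

Lemma fsum_jsum p : fr (fsum p) <= 3 * jsum p.
Proof.
have := @jap_triangle R d p.1.1 p.1.2 p.2; rewrite -/(jsum p) -/(fsum p) => h.
by rewrite freq2_jap (le_trans _ h)// gerBl.
Qed.

Lemma normr_phL p : `|phL p| <= 4 * jsum p.
Proof.
have h := fsum_jsum p; have h0 := @freq2_ge0 R d (fsum p).
have := @freq2_ge0 R d p.1.1; have := @freq2_ge0 R d p.1.2; have := @freq2_ge0 R d p.2.
rewrite /phL ler_norml; move: h; rewrite /jsum /Convergence.jap => *; apply/andP; split; lra.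
Qed.

Lemma normr_phy p : `|phy p| <= 4 * jsum p.
Proof.
have h := fsum_jsum p; have h0 := @freq2_ge0 R d (fsum p).
have := @freq2_ge0 R d p.1.1; have := @freq2_ge0 R d p.1.2; have := @freq2_ge0 R d p.2.
rewrite /phy ler_norml; move: h; rewrite /jsum /Convergence.jap => *; apply/andP; split; lra.
Qed.

Lemma normr_phx p : `|phx p| <= 2 * jsum p.
Proof.
have := @freq2_ge0 R d p.1.1; have := @freq2_ge0 R d p.1.2; have := @freq2_ge0 R d p.2.
rewrite /phx ler_norml /jsum /Convergence.jap => *; apply/andP; split; lra.
Qed.

Definition dot (k l : I) : R := \sum_(j < d) (k ord0 j)%:~R * (l ord0 j)%:~R.

Lemma dot_sqr k l : dot k l ^+ 2 <= fr k * fr l.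
Proof.
rewrite -[dot k l ^+ 2]real_normK ?num_real//.
apply: (@le_trans _ _ ((\sum_(j < d) `|(k ord0 j)%:~R * (l ord0 j)%:~R|) ^+ 2)).
  by rewrite lerXn2r ?nnegrE ?normr_ge0 ?sumr_ge0 ?ler_norm_sum.
apply: cauchy_sum => j; rewrite ?normr_ge0 ?sqr_ge0//.
by rewrite real_normK ?num_real// exprMn.
Qed.

(** Expanding the square of the sum cancels the individual squares and leaves the inner products of
    distinct slots: no slot ever carries the full weight alone. *)
Lemma phy_dot p : phy p = 2 * (dot p.1.1 p.1.2 + dot p.1.1 p.2 + dot p.1.2 p.2).
Proof.
rewrite /phy /freq2 /dot -!big_split/= -!sumrB mulr_sumr; apply: eq_bigr => j _.
by rewrite /fsum !mxE !rmorphD/=; ring.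
Qed.

Lemma phy_sqr p : phy p ^+ 2 <=
  12 * (jap p.1.1 * jap p.1.2 + jap p.1.1 * jap p.2 + jap p.1.2 * jap p.2).
Proof.
rewrite phy_dot exprMn (_ : 2 ^+ 2 = 4 :> R); last by ring.
have := sqr_sum3 (dot p.1.1 p.1.2) (dot p.1.1 p.2) (dot p.1.2 p.2).
have := dot_sqr p.1.1 p.1.2; have := dot_sqr p.1.1 p.2; have := dot_sqr p.1.2 p.2.
have h k l : fr k * fr l <= jap k * jap l.
  by apply: ler_pM; rewrite ?freq2_ge0//; rewrite /Convergence.jap lerDr.
have := h p.1.1 p.1.2; have := h p.1.1 p.2; have := h p.1.2 p.2.
lra.
Qed.

(** As d / 4 <= 1, min (1, z) <= z^(d/4). By [phy_sqr], |y| is at most 6 times the square root of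
    the product of the three [jap], whose power d / 4 is the product of the three [rho]. *)
Lemma phy_rho tau p : 0 <= tau ->
  Num.min 1 (tau * `|phy p|) <= 6 * tau `^ (d%:R / 4) * (rho p.1.1 * rho p.1.2 * rho p.2).
Proof.
move=> t0.
have jg k : 1 <= jap k by exact: jap_ge1.
have j0 k : 0 <= jap k by exact: japge0.
pose J := jap p.1.1 * jap p.1.2 * jap p.2.
have J0 : 0 <= J by rewrite /J !mulr_ge0.
have hy : `|phy p| <= 6 * Num.sqrt J.
  rewrite -(@ler_pXn2r _ 2) ?nnegrE ?normr_ge0 ?mulr_ge0 ?sqrtr_ge0// exprMn sqr_sqrtr// real_normK ?num_real//.
  apply: le_trans (phy_sqr p) _; rewrite (_ : 6 ^+ 2 = 36 :> R); last by ring.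
  have e1 : jap p.1.1 * jap p.1.2 <= J by rewrite /J ler_peMr// mulr_ge0.
  have e2 : jap p.1.1 * jap p.2 <= J by rewrite /J mulrAC ler_peMr// mulr_ge0.
  have e3 : jap p.1.2 * jap p.2 <= J by rewrite /J -mulrA ler_peMl// mulr_ge0.
  lra.
have e4 : d%:R / 4 <= 1 :> R.
  rewrite ler_pdivrMr// mul1r (le_trans (_ : _ <= 3%:R))// ?ler_nat// ; lra.
have e0 : 0 <= d%:R / 4 :> R by rewrite divr_ge0.
have mz (z : R) : 0 <= z -> Num.min 1 z <= z `^ (d%:R / 4).
  move=> z0; have [z1|z1] := leP 1 z; first exact: powR_ge1.
  rewrite -[leLHS](powRr1 z0); have [->|zn0] := eqVneq z 0.
    by rewrite powRr1// powR_ge0.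
  by apply: ger_powR; rewrite // lt_def zn0 z0 ltW.
apply: (le_trans (mz _ _)); first by rewrite mulr_ge0.
apply: (@le_trans _ _ ((tau * (6 * Num.sqrt J)) `^ (d%:R / 4))).
  by rewrite ge0_ler_powR ?nnegrE ?mulr_ge0 ?sqrtr_ge0// ler_wpM2l.
rewrite !powRM ?mulr_ge0 ?sqrtr_ge0// mulrCA -mulrA.
rewrite -powR12_sqrt// -powRrM.
have -> : 2^-1 * (d%:R / 4) = d%:R / 8 :> R by field.
rewrite /J !powRM ?mulr_ge0// -/(rho _) -/(rho _) -/(rho _).
apply: ler_wpM2r; first by rewrite !mulr_ge0 ?powR_ge0 ?rhoge0.
rewrite -[leRHS]powRr1//; apply: ler_powR => //; lra.
Qed.

Definition mE s p : R[i] := E (s * phL p).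
Definition twoRe (z : R[i]) : R[i] := z + z^*.
(* In the interaction picture [tau] times the symbol of the scheme is [mm tau tau]. As
   [mm tau 0 = 0] and [mq tau s] is the [s]-derivative of [mm tau s], the local error is the
   integral over [0 <= s <= tau] of the convolutions with [mE s], [mE (- s)] and [- mq tau s]. *)
Definition mq tau s p : R[i] :=
  twoRe (E (s * phx p) * (1 + (s / tau)%:C * (E (tau * phy p) - 1))).
Definition mm tau s p : R[i] :=
  twoRe (P1 (phx p) s + (tau^-1)%:C * (P2 (phx p) s * (E (tau * phy p) - 1))).

Lemma normc_twoRe z : N (twoRe z) <= 2 * N z.
Proof. by apply: le_trans (complex.le_normcD _ _) _; rewrite normc_conj mulr_natl mulr2n. Qed.

Lemma twoReB (z w : R[i]) : twoRe (z - w) = twoRe z - twoRe w.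
Proof. by rewrite /twoRe rmorphB; ring. Qed.

Lemma cder_conj f (s : R) l : cder f s l -> cder (fun x => (f x)^* ) s l^*.
Proof.
move=> [h1 h2]; split; under eq_fun do rewrite ReImE; rewrite ReImE //.
exact: is_deriveN.
Qed.

Lemma cder_twoRe f (s : R) l : cder f s l -> cder (fun x => twoRe (f x)) s (twoRe l).
Proof. by move=> h; apply: cderD => //; exact: cder_conj. Qed.

Lemma cder_mm tau s p : cder (fun s => mm tau s p) s (mq tau s p).
Proof.
apply: cder_twoRe; apply: cder_eq (cderD (cderP1 _ _) (cderZ _ (cderM (cderP2 _ _) (cder_cst _ _)))) _.
by rewrite mulr0 addr0 rmorphM/=; ring.
Qed.

Lemma mm0 tau p : mm tau 0 p = 0.
Proof. by rewrite /mm P1_phi1 P2_phi2 expr0n !mul0r mulr0 addr0 /twoRe conjc0 addr0. Qed.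

Lemma normc_mE s p : N (mE s p) <= 1.
Proof. by rewrite normc_E. Qed.

Lemma normc_mEB s t p : N (mE s p - mE t p) <= 4 * `|s - t| * jsum p.
Proof.
have -> : mE s p - mE t p = E (t * phL p) * (E ((s - t) * phL p) - 1).
  by rewrite /mE mulrBr -ED mulr1; congr (E _ - _); ring.
rewrite Normc.normcM normc_E mul1r; apply: (le_trans (normcE1 _)).
rewrite normrM -mulrA mulrCA ler_wpM2l//; exact: normr_phL.
Qed.

Lemma mE_twoRe s p : mE s p + mE (- s) p = twoRe (mE s p).
Proof. by rewrite /mE /twoRe mulNr EN. Qed.

(** The error of interpolating E (s y) linearly in [s] between 0 and tau. The scheme integrates the
    factor E (s x) exactly, so this is its only defect. *)
Let D tau s y : R[i] := E (s * y) - 1 - (s / tau)%:C * (E (tau * y) - 1).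

Let mE_mq tau s p : 
  mE s p + mE (- s) p - mq tau s p = twoRe (E (s * phx p) * D tau s (phy p)).
Proof.
by rewrite mE_twoRe /mq /mE phLE mulrDr ED -twoReB; congr twoRe; rewrite /D; ring.
Qed.

(** Interpolation is exact on affine functions, so both terms may be reduced by their first-order
    Taylor polynomials. The constant is 2 for [twoRe], 2 for the two terms and 12 from [phy_sqr]. *)
Lemma mE_mq_crit tau s p : 0 < tau -> 0 <= s <= tau -> N (mE s p + mE (- s) p - mq tau s p) <=
  48 * tau ^+ 2 * (jap p.1.1 * jap p.1.2 + jap p.1.1 * jap p.2 + jap p.1.2 * jap p.2).
Proof.
move=> t0 /andP[s0 st]; rewrite mE_mq; apply: le_trans (normc_twoRe _) _.
rewrite Normc.normcM normc_E mul1r.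
have h := phy_sqr p; set S := (_ + _ + _) in h *.
apply: (@le_trans _ _ (4 * (tau ^+ 2 * phy p ^+ 2))); last first.
  by have := ler_wpM2l (sqr_ge0 tau) h; lra.
have -> : D tau s (phy p) = (E (s * phy p) - 1 - 'i%C * (s * phy p)%:C)
     - (s / tau)%:C * (E (tau * phy p) - 1 - 'i%C * (tau * phy p)%:C).
  have e : (s * phy p)%:C = (s / tau)%:C * (tau * phy p)%:C :> R[i].
    by rewrite -rmorphM; congr (_%:C); field; rewrite gt_eqF.
  by rewrite /D e; ring.
have h1 : N (E (s * phy p) - 1 - 'i%C * (s * phy p)%:C) <= tau ^+ 2 * phy p ^+ 2.
  apply: le_trans (normcE_taylor _) _; rewrite exprMn ler_wpM2r ?sqr_ge0//.
  by rewrite lerXn2r ?nnegrE// ltW.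
have h2 : N ((s / tau)%:C * (E (tau * phy p) - 1 - 'i%C * (tau * phy p)%:C)) <= tau ^+ 2 * phy p ^+ 2.
  rewrite Normc.normcM normc_real ger0_norm ?divr_ge0 ?(ltW t0)// -[leRHS]mul1r.
  apply: ler_pM; rewrite ?divr_ge0 ?normc_ge0 ?(ltW t0)//; first by rewrite ler_pdivrMr// mul1r.
  by apply: le_trans (normcE_taylor _) _; rewrite exprMn.
have := normcB (E (s * phy p) - 1 - 'i%C * (s * phy p)%:C) ((s / tau)%:C * (E (tau * phy p) - 1 - 'i%C * (tau * phy p)%:C)).
lra.
Qed.

(** Each |E (z y) - 1| is at most 2 min (1, tau |y|); two such terms, the factor 2 of [twoRe] and
    the 6 of [phy_rho] give 48. *)
Lemma mE_mq_rho tau s p : 0 < tau -> 0 <= s <= tau -> N (mE s p + mE (- s) p - mq tau s p) <=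
  48 * tau `^ (d%:R / 4) * (rho p.1.1 * rho p.1.2 * rho p.2).
Proof.
move=> t0 /andP[s0 st]; rewrite mE_mq; apply: le_trans (normc_twoRe _) _.
rewrite Normc.normcM normc_E mul1r.
have := phy_rho p (ltW t0); set m := Num.min _ _ => h.
have e (z : R) : 0 <= z <= tau -> N (E (z * phy p) - 1) <= 2 * m.
  move=> /andP[z0 zt]; rewrite /m; case: (leP 1 (tau * `|phy p|)) => _; first by rewrite mulr1 normcE2.
  apply: (le_trans (normcE1 _)); rewrite normrM ger0_norm//.
  have := ler_wpM2r (normr_ge0 (phy p)) zt; have : 0 <= tau * `|phy p| by rewrite mulr_ge0// ltW.
  lra.
have h1 : N (E (s * phy p) - 1) <= 2 * m by apply: e; rewrite s0.
have h2 : N ((s / tau)%:C * (E (tau * phy p) - 1)) <= 2 * m.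
  rewrite Normc.normcM normc_real ger0_norm ?divr_ge0 ?(ltW t0)// -[leRHS]mul1r.
  apply: ler_pM; rewrite ?divr_ge0 ?normc_ge0 ?(ltW t0)//; first by rewrite ler_pdivrMr// mul1r.
  by apply: e; rewrite lexx ltW.
have := normcB (E (s * phy p) - 1) ((s / tau)%:C * (E (tau * phy p) - 1)).
rewrite -/(D _ _ _); lra.
Qed.

(* The symbol of the first step. *)
Definition mg tau p : R[i] :=
  phi1 ('i%C * (tau * phx p)%:C) + phi2 ('i%C * (tau * phx p)%:C) * (E (tau * phy p) - 1).

Lemma normc_mg tau p : N (mg tau p) <= 3.
Proof.
apply: le_trans (complex.le_normcD _ _) _; rewrite Normc.normcM.
have := normc_phi1 (tau * phx p); have := normc_phi2 (tau * phx p); have := normcE2 (tau * phy p).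
have := normc_ge0 (phi2 ('i%C * (tau * phx p)%:C)); have := normc_ge0 (E (tau * phy p) - 1).
nra.
Qed.

(** Both symbols equal 1 to leading order in tau, and the first correction costs one power of tau
    and one of [jsum]. *)
Lemma mE_mg tau s p : 0 < tau -> 0 <= s <= tau -> N (mE s p - mg tau p) <= 10 * tau * jsum p.
Proof.
move=> t0 /andP[s0 st].
have -> : mE s p - mg tau p = (mE s p - mE 0 p) - (phi1 ('i%C * (tau * phx p)%:C) - 1)
   - phi2 ('i%C * (tau * phx p)%:C) * (E (tau * phy p) - 1).
  by rewrite /mg /mE mul0r E0; ring.
have J0 : 0 <= jsum p by exact: japs_ge0.
have h1 : N (mE s p - mE 0 p) <= 4 * tau * jsum p.
  by apply: (le_trans (normc_mEB _ _ _)); rewrite subr0 ger0_norm// ler_wpM2r// ler_wpM2l.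
have h2 : N (phi1 ('i%C * (tau * phx p)%:C) - 1) <= tau * (2 * jsum p).
  apply: (le_trans (normc_phi1_sub1 _)); rewrite normrM ger0_norm ?(ltW t0)//.
  by rewrite ler_wpM2l ?(ltW t0) ?normr_phx.
have h3 : N (phi2 ('i%C * (tau * phx p)%:C) * (E (tau * phy p) - 1)) <= tau * (4 * jsum p).
  rewrite Normc.normcM -[leRHS]mul1r; apply: ler_pM; rewrite ?normc_ge0 ?normc_phi2//.
  apply: (le_trans (normcE1 _)); rewrite normrM ger0_norm ?(ltW t0)//.
  by rewrite ler_wpM2l ?(ltW t0) ?normr_phy.
apply: le_trans (normcB _ _) _; apply: (le_trans (lerD (normcB _ _) (lexx _))).
lra.
Qed.

End multipliers.

(** * Cubic terms: differences and linearisation *)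

Section telescoping.
Context {R : realType} {d : nat}.
Hypothesis d3 : (d <= 3)%N.
Local Notation I := 'rV[int]_d.
Local Notation c0 := (10 ^+ d : R).
Local Notation rho := (@rho R d).
Local Notation jap := (@jap R d).
Implicit Types (a b c u v w : I -> R[i]) (m : I * I * I -> R[i]) (K : seq I) (W : I -> R) (k : I).

Lemma W0_ge0 (k : I) : 0 <= W0 k :> R. Proof. exact: ler01. Qed.
Lemma W2_ge0 (k : I) : 0 <= W2 k :> R. Proof. exact: sqr_ge0. Qed.
Hint Resolve W0_ge0 W2_ge0 : core.

Lemma hb_add3 W a b c X Y Z : (forall k, 0 <= W k) ->
  hb W a X -> hb W b Y -> hb W c Z -> hb W (fun k => a k + b k + c k) (4 * (X + Y + Z)).
Proof.
move=> Wp aX bY cZ; have Z0 := hb_ge0 cZ.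
by apply: hb_le (hb_add Wp (hb_add Wp aX bY) cZ) _; lra.
Qed.

Lemma hb_opp W a X : hb W a X -> hb W (fun k => - a k) X.
Proof. by move=> aX K uK; apply: le_trans (aX K uK); apply: ler_sum => k _; rewrite complex.normcN. Qed.

Lemma hb_sub W a b X Y : (forall k, 0 <= W k) ->
  hb W a X -> hb W b Y -> hb W (fun k => a k - b k) (2 * (X + Y)).
Proof. by move=> Wp aX bY; apply: hb_add => //; exact: hb_opp. Qed.

Lemma hb_scale W a X (z : R[i]) r : (forall k, 0 <= W k) -> N z <= r -> hb W a X ->
  hb W (fun k => z * a k) (r ^+ 2 * X).
Proof. by move=> Wp zr; apply: hb_mul. Qed.

Lemma hb_W20 a X : hb W2 a X -> hb W0 a X.
Proof. exact/hb_weight/W02. Qed.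

Lemma cbB a b k : cb (fun k => a k - b k) k = cb a k - cb b k.
Proof. by rewrite /cb rmorphB. Qed.

Lemma hb_cb0 a X : hb W0 a X -> hb W0 (cb a) X.
Proof. exact: hb_cb. Qed.

Lemma hb_cb2 a X : hb W2 a X -> hb W2 (cb a) X.
Proof. by apply: hb_cb => k; rewrite /W2 japN. Qed.

Definition T3 K m v k : R[i] := T K m v v (cb v) k.

(* [Tel] telescopes a difference of cubic terms; [Quad] is the part beyond the linearisation
   at [w]. *)
Definition Tel K m u v w k : R[i] :=
  T K m u v (cb v) k + T K m w u (cb v) k + T K m w w (cb u) k.

Definition Quad K m u w k : R[i] :=
  T K m u u (cb w) k + T K m u w (cb u) k + T K m w u (cb u) k + T K m u u (cb u) k.

Lemma T3_sub K m v w k : T3 K m v k - T3 K m w k = Tel K m (fun k => v k - w k) v w k.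
Proof.
rewrite /T3 /Tel /T -!sumrB -!big_split/=; apply: eq_bigr => p _.
by rewrite cbB; ring.
Qed.

Lemma T3_quad K m v w k : T3 K m v k - T3 K m w k =
  Tel K m (fun k => v k - w k) w w k + Quad K m (fun k => v k - w k) w k.
Proof.
rewrite /T3 /Tel /Quad /T -!sumrB -!big_split/=; apply: eq_bigr => p _.
by rewrite cbB; ring.
Qed.

Lemma TelD K m u u' w k : Tel K m (fun k => u k + u' k) w w k = Tel K m u w w k + Tel K m u' w w k.
Proof.
rewrite /Tel /T -!big_split/=; apply: eq_bigr => p _; rewrite /cb rmorphD/=; ring.
Qed.

Lemma TelBm K m m' u w k : Tel K m u w w k - Tel K m' u w w k = Tel K (fun p => m p - m' p) u w w k.
Proof. by rewrite /Tel /T -!big_split -sumrB/=; apply: eq_bigr => p _; ring. Qed.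

Lemma T3Bm K m m' w k : T3 K m w k - T3 K m' w k = T3 K (fun p => m p - m' p) w k.
Proof. by rewrite /T3 /T -sumrB/=; apply: eq_bigr => p _; ring. Qed.

Lemma T3Dm K m m' w k : T3 K m w k + T3 K m' w k = T3 K (fun p => m p + m' p) w k.
Proof. by rewrite /T3 /T -big_split/=; apply: eq_bigr => p _; ring. Qed.

Lemma T3Zm K z m w k : z * T3 K m w k = T3 K (fun p => z * m p) w k.
Proof. by rewrite /T3 /T mulr_sumr/=; apply: eq_bigr => p _; ring. Qed.

Section bounds.
Variables (K : seq I) (r A D : R) (m : I * I * I -> R[i]).
Hypothesis uK : uniq K.

Lemma T3_H2 w : (forall p, N (m p) <= r) -> hb W2 w A -> hb W2 (T3 K m w) (81 * c0 ^+ 2 * r ^+ 2 * A ^+ 3).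
Proof.
move=> mr wA; apply: hb_le (T_H2 d3 uK mr wA wA (hb_cb2 wA)) _.
by rewrite le_eqVlt; apply/orP; left; apply/eqP; ring.
Qed.

Lemma T3_jap w : (forall p, N (m p) <= r * jsum p) -> hb W2 w A -> hb W0 (T3 K m w) (9 * c0 ^+ 2 * r ^+ 2 * A ^+ 3).
Proof.
move=> mr wA; apply: hb_le (T_jap d3 uK mr wA wA (hb_cb2 wA)) _.
by rewrite le_eqVlt; apply/orP; left; apply/eqP; ring.
Qed.

Lemma T3_crit w : (forall p, N (m p) <= r * (jap p.1.1 * jap p.1.2 + jap p.1.1 * jap p.2 + jap p.1.2 * jap p.2)) ->
  hb Wr w A -> hb W0 (T3 K m w) (36 * 6 ^+ d * c0 * r ^+ 2 * A ^+ 3).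
Proof.
move=> mr wA; have wA' : hb Wr (cb w) A by apply: hb_cb => // k; rewrite /Wr /Convergence.rho japN.
apply: hb_le (T_crit d3 uK mr wA wA wA') _.
by rewrite le_eqVlt; apply/orP; left; apply/eqP; ring.
Qed.

(** The factors [rho] pass from the symbol to the functions, which turns H^(2 + d/4) data into H^2
    data with a bounded symbol. Conjugation respects this because [rho] is even. *)
Lemma T3_rho w : (forall p, N (m p) <= r * (rho p.1.1 * rho p.1.2 * rho p.2)) ->
  hb Wr w A -> hb W2 (T3 K m w) (81 * c0 ^+ 2 * r ^+ 2 * A ^+ 3).
Proof.
move=> mr wA; pose w' k := (rho k)%:C * w k.
have wA' : hb W2 w' A.
  move=> J uJ; apply: le_trans (wA J uJ); apply: ler_sum => k _.
  by rewrite /w' Normc.normcM normc_real ger0_norm ?rhoge0// exprMn mulrCA mulrA /Wr exprMn.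
pose m' p := m p * ((rho p.1.1 * rho p.1.2 * rho p.2)^-1)%:C.
have r0 (p : I * I * I) : 0 < rho p.1.1 * rho p.1.2 * rho p.2.
  by rewrite !mulr_gt0// (lt_le_trans ltr01)// rho_ge1.
have cbE k : cb w' k = (rho k)%:C * cb w k.
  rewrite /cb /w' [LHS]rmorphM; congr (_ * _).
  by apply: complex_eq; rewrite /= ?oppr0 ?/Convergence.rho ?japN.
have e k : T3 K m' w' k = T3 K m w k.
  apply: eq_bigr => p _; rewrite cbE /m' {1 2}/w' -mulrA; congr (_ * _).
  have gen (x y z t : R) (f g h : R[i]) :
    x%:C * (y%:C * f * (z%:C * g) * (t%:C * h)) = (x * (y * z * t))%:C * (f * g * h).
    by rewrite !rmorphM; ring.
  by rewrite gen mulVf ?mul1r// gt_eqF.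
have mr' p : N (m' p) <= r.
  rewrite /m' Normc.normcM normc_real ger0_norm; last by rewrite invr_ge0 ltW.
  by rewrite ler_pdivrMr.
apply: hb_ext e _; apply: hb_le (T_H2 d3 uK mr' wA' wA' (hb_cb2 wA')) _.
by rewrite le_eqVlt; apply/orP; left; apply/eqP; ring.
Qed.

Lemma Tel_H2 u v w : (forall p, N (m p) <= r) -> hb W2 u D -> hb W2 v A -> hb W2 w A ->
  hb W2 (Tel K m u v w) (972 * c0 ^+ 2 * r ^+ 2 * A ^+ 2 * D).
Proof.
move=> mr uD vA wA; apply: hb_le (hb_add3 _ (T_H2 d3 uK mr uD vA (hb_cb2 vA))
  (T_H2 d3 uK mr wA uD (hb_cb2 vA)) (T_H2 d3 uK mr wA wA (hb_cb2 uD))) _ => //.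
by rewrite le_eqVlt; apply/orP; left; apply/eqP; ring.
Qed.

(** The computation yields 12 in place of 972; the larger constant is that of [Tel_H2], so that
    [Klip] serves both norms. *)
Lemma Tel_L2 u v w : (forall p, N (m p) <= r) -> hb W0 u D -> hb W2 v A -> hb W2 w A ->
  hb W0 (Tel K m u v w) (972 * c0 ^+ 2 * r ^+ 2 * A ^+ 2 * D).
Proof.
move=> mr uD vA wA; have D0 := hb_ge0 uD; apply: hb_le (hb_add3 _ (T_L2_1 d3 uK mr uD vA (hb_cb2 vA))
  (T_L2_2 d3 uK mr wA uD (hb_cb2 vA)) (T_L2_3 d3 uK mr wA wA (hb_cb0 uD))) _ => //.
rewrite [leLHS](_ : _ = 12 * (c0 ^+ 2 * (r ^+ 2 * (A ^+ 2 * D)))); last by ring.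
rewrite [leRHS](_ : _ = 972 * (c0 ^+ 2 * (r ^+ 2 * (A ^+ 2 * D)))); last by ring.
have : 0 <= c0 ^+ 2 * (r ^+ 2 * (A ^+ 2 * D)).
  by apply: mulr_ge0 (sqr_ge0 _) (mulr_ge0 (sqr_ge0 _) (mulr_ge0 (sqr_ge0 _) D0)).
lra.
Qed.

Lemma Tel_jap u w : (forall p, N (m p) <= r * jsum p) -> hb W2 u D -> hb W2 w A ->
  hb W0 (Tel K m u w w) (108 * c0 ^+ 2 * r ^+ 2 * A ^+ 2 * D).
Proof.
move=> mr uD wA; apply: hb_le (hb_add3 _ (T_jap d3 uK mr uD wA (hb_cb2 wA))
  (T_jap d3 uK mr wA uD (hb_cb2 wA)) (T_jap d3 uK mr wA wA (hb_cb2 uD))) _ => //.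
by rewrite le_eqVlt; apply/orP; left; apply/eqP; ring.
Qed.

Lemma Quad_H2 u w : (forall p, N (m p) <= r) -> hb W2 u D -> hb W2 w A ->
  hb W2 (Quad K m u w) (2000 * c0 ^+ 2 * r ^+ 2 * (A + D) * D ^+ 2).
Proof.
move=> mr uD wA; have D0 := hb_ge0 uD; have A0 := hb_ge0 wA.
apply: hb_le (hb_add _ (hb_add3 _ (T_H2 d3 uK mr uD uD (hb_cb2 wA))
  (T_H2 d3 uK mr uD wA (hb_cb2 uD)) (T_H2 d3 uK mr wA uD (hb_cb2 uD))) (T_H2 d3 uK mr uD uD (hb_cb2 uD))) _ => //.
pose z := c0 ^+ 2 * (r ^+ 2 * D ^+ 2).
have z0 : 0 <= z by apply: mulr_ge0 (sqr_ge0 _) (mulr_ge0 (sqr_ge0 _) (sqr_ge0 _)).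
rewrite [leLHS](_ : _ = 1944 * (A * z) + 162 * (D * z)); last by rewrite /z; ring.
rewrite [leRHS](_ : _ = 2000 * (A * z) + 2000 * (D * z)); last by rewrite /z; ring.
have := mulr_ge0 A0 z0; have := mulr_ge0 D0 z0; lra.
Qed.

End bounds.

End telescoping.

(** * Local error *)

Section local_error.
Context {R : realType} {d : nat}.
Hypothesis d3 : (d <= 3)%N.
Local Notation I := 'rV[int]_d.
Local Notation c0 := (10 ^+ d : R).
Let w0 (k : I) : 0 <= W0 k :> R. Proof. exact: W0_ge0. Qed.
Let w2 (k : I) : 0 <= W2 k :> R. Proof. exact: W2_ge0. Qed.
Hint Resolve w0 w2 : core.
Implicit Types (s t : R) (k : I) (W : I -> R).

Lemma mvt_hb W (V V' : R -> I -> R[i]) (a b X : R) :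
  (forall k, 0 <= W k) -> a <= b -> 0 <= X ->
  (forall k s, a <= s <= b -> ccont (V^~ k) s) ->
  (forall k s, a < s < b -> cder (V^~ k) s (V' s k)) ->
  (forall s, a < s < b -> hb W (V' s) X) ->
  hb W (fun k => V b k - V a k) (X * (b - a) ^+ 2).
Proof. by move=> Wp ab X0 cV dV hV K uK; apply: (mvt_sum Wp ab X0 cV dV) => s /hV; exact. Qed.

Lemma mvt_hb_approx W (x : I -> R[i]) (a b X : R) :
  (forall k, 0 <= W k) -> a <= b -> 0 <= X ->
  (forall e, 0 < e -> exists Z Z' : R -> I -> R[i],
    [/\ forall k s, a <= s <= b -> ccont (Z^~ k) s,
        forall k s, a < s < b -> cder (Z^~ k) s (Z' s k),
        forall k, N (x k - (Z b k - Z a k)) <= e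
      & forall s, a < s < b -> exists2 y, hb W y X & forall k, N (Z' s k - y k) <= e]) ->
  hb W x (X * (b - a) ^+ 2).
Proof.
move=> Wp ab X0 h K uK; apply/ler_addgt0Pl => e e0.
set c := (b - a) ^+ 2; have c0 : 0 <= c by exact: sqr_ge0.
pose e1 := e / (2 * (c + 1)); pose e2 := e / 2.
have e10 : 0 < e1 by rewrite divr_gt0// mulr_gt0// ltr_wpDl.
have e20 : 0 < e2 by rewrite divr_gt0.
have [r1 r10 h1] := hb_pert K Wp X0 e10.
have [r2 r20 h2] := hb_pert K Wp (mulr_ge0 (addr_ge0 X0 (ltW e10)) c0) e20.
have [|Z [Z' [cZ dZ xZ Z'y]]] := h (Num.min r1 r2); first by rewrite lt_min r10.
have hZ : \sum_(k <- K) W k * N (Z b k - Z a k) ^+ 2 <= (X + e1) * c.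
  apply: (mvt_sum Wp ab _ cZ dZ) => [|s sab]; first by rewrite addr_ge0// ltW.
  have [y yX Zy] := Z'y s sab; apply: h1 (yX K uK) _ => k.
  by apply: le_trans (Zy k) _; rewrite ge_min lexx.
apply: le_trans (h2 x (fun k => Z b k - Z a k) hZ _) _ => [k|].
  by apply: le_trans (xZ k) _; rewrite ge_min lexx orbT.
have : e1 * c <= e2.
  rewrite /e1 /e2 mulrAC ler_pdivrMr; last by rewrite mulr_gt0// ltr_wpDl.
  rewrite (_ : e / 2 * (2 * (c + 1)) = e * (c + 1)); last by field.
  by rewrite ler_wpM2l ?(ltW e0) ?lerDl.
by rewrite mulrDl /e2; lra.
Qed.

(** [lo] is the left end of the time window: [- tau] for the two-step recursion and 0 for the first
    step, which has no past. *)
Variables (mu tau lo A : R) (V Xi : R -> I -> R[i]).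
Hypotheses (tau0 : 0 < tau) (tau1 : tau <= 1) (lo0 : lo <= 0) (lotau : - tau <= lo).
Let z : R[i] := - ('i%C * mu%:C).
Hypothesis VAd : forall s, lo <= s <= tau -> hb Wr (V s) A.
Hypothesis cVd : forall k s, lo <= s <= tau -> ccont (V^~ k) s.
Hypothesis dVd : forall k s, lo < s < tau -> cder (V^~ k) s (z * Xi s k).
Hypothesis XiTd : forall e, 0 < e -> exists n0, forall n s k, (n0 <= n)%N -> lo <= s <= tau ->
  N (Xi s k - T3 (box n) (mE s) (V s) k) <= e.

Let Nz : N z <= `|mu|.
Proof. by rewrite /z complex.normcN Normc.normcM normci mul1r normc_real. Qed.

Let mu2 : `|mu| ^+ 2 = mu ^+ 2. Proof. by rewrite real_normK ?num_real. Qed.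

Let VA2d s : lo <= s <= tau -> hb W2 (V s) A.
Proof. by move=> /VAd; apply: hb_weight; exact: W2r. Qed.

Let dom0 : lo <= 0 <= tau. Proof. by rewrite lo0 ltW. Qed.

(** All constants bound squared norms: K1 that of [Xi s] in H^2, K2 tau^2 that of V(s) - V(0) in
    H^2, K3 tau^2 that of Xi(s) - Xi(-s) in L^2, K4 tau^4 that of V(s) + V(-s) - 2 V(0) in L^2; K5
    and K6 belong to the defect [D]. *)
Let K1 := 81 * c0 ^+ 2 * A ^+ 3.
Let K2 := mu ^+ 2 * K1.
Let K3 := 4 * (1944 * c0 ^+ 2 * A ^+ 2 * K2 + 576 * c0 ^+ 2 * A ^+ 3).
Let K4 := mu ^+ 2 * K3.
Let K5 := 2 * (4 * (36 * 6 ^+ d * c0 * 48 ^+ 2 * A ^+ 3 + 972 * c0 ^+ 2 * A ^+ 2 * K4 + 108 * c0 ^+ 2 * 64 * A ^+ 2 * K2)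
   + 4 * (2000 * c0 ^+ 2 * (A + K2) * K2 ^+ 2)).
Let K6 := 4 * (1944 * c0 ^+ 2 * A ^+ 2 * K2 + 81 * c0 ^+ 2 * 48 ^+ 2 * A ^+ 3).

Let Xi_H2d s : lo <= s <= tau -> hb W2 (Xi s) K1.
Proof.
move=> st; apply: hb_approx => // e e0; have [n0 h] := XiTd e0.
exists (T3 (box n0) (mE s) (V s)); last by move=> k; apply: h.
apply: hb_le (T3_H2 d3 (box_uniq n0) (normc_mE s) (VA2d st)) _.
by rewrite expr1n mulr1.
Qed.

Let K1_ge0 : 0 <= K1. Proof. exact: hb_ge0 (Xi_H2d dom0). Qed.
Let K2_ge0 : 0 <= K2. Proof. exact: mulr_ge0 (sqr_ge0 _) K1_ge0. Qed.

Let dV_H2d s : lo <= s <= tau -> hb W2 (fun k => V s k - V 0 k) (K2 * tau ^+ 2).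
Proof.
move=> /andP[ls st]; have [s0|s0] := leP 0 s.
  have h : hb W2 (fun k => V s k - V 0 k) (K2 * (s - 0) ^+ 2).
    apply: (@mvt_hb _ _ (fun s k => z * Xi s k)) => // [k t /andP[t0 ts]|k t /andP[t0 ts]|t /andP[t0 ts]].
    - by apply: cVd; rewrite (le_trans lo0)// (le_trans ts).
    - by apply: dVd; rewrite (le_lt_trans lo0)// (lt_le_trans ts).
    - rewrite /K2 -mu2; apply: hb_scale => //; apply: Xi_H2d.
      by rewrite (le_trans lo0 (ltW t0))/= (le_trans (ltW ts)).
  by apply: hb_le h _; rewrite subr0 ler_wpM2l// lerXn2r ?nnegrE ?(ltW tau0).
have h : hb W2 (fun k => V 0 k - V s k) (K2 * (0 - s) ^+ 2).
  apply: (@mvt_hb _ _ (fun s k => z * Xi s k)) => // [|k t /andP[t0 ts]|k t /andP[t0 ts]|t /andP[t0 ts]]; first exact: ltW.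
  - by apply: cVd; rewrite (le_trans ls)// (le_trans ts)// ltW.
  - by apply: dVd; rewrite (le_lt_trans ls)// (lt_trans ts).
  - rewrite /K2 -mu2; apply: hb_scale => //; apply: Xi_H2d.
    by rewrite (le_trans ls (ltW t0))/= (le_trans (ltW ts))// ltW.
apply: (@hb_le _ _ _ _ (K2 * (0 - s) ^+ 2)).
  by apply: hb_ext (hb_opp h) => k; rewrite opprB.
rewrite sub0r ler_wpM2l// lerXn2r ?nnegrE ?(ltW tau0) ?oppr_ge0 ?(ltW s0)//.
by rewrite lerNl (le_trans lotau).
Qed.

Let VB_H2d K s : uniq K -> lo <= s <= tau ->
  hb W2 (fun k => T3 K (mE s) (V s) k - T3 K (mE s) (V 0) k) (972 * c0 ^+ 2 * A ^+ 2 * (K2 * tau ^+ 2)).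
Proof.
move=> uK st; have h := Tel_H2 d3 uK (normc_mE s) (dV_H2d st) (VA2d st) (VA2d dom0).
apply: hb_ext (hb_le h _) => [k|]; first by rewrite -T3_sub.
by rewrite expr1n mulr1.
Qed.

(* The first step is only needed to lower order. *)
Let K7 := 2 * (972 * c0 ^+ 2 * A ^+ 2 * K2 + 9 * c0 ^+ 2 * 100 * A ^+ 3).
Let K8 := 2 * (81 * c0 ^+ 2 * A ^+ 3 + 81 * c0 ^+ 2 * 9 * A ^+ 3).
Let F K s k : R[i] := T3 K (mE s) (V s) k - T3 K (mg tau) (V 0) k.

Let F_L2 K s : uniq K -> 0 <= s <= tau -> hb W0 (F K s) (K7 * tau ^+ 2).
Proof.
move=> uK sI; have /andP[s0 stau] := sI.
have st : lo <= s <= tau by rewrite (le_trans lo0).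
have e k : (T3 K (mE s) (V s) k - T3 K (mE s) (V 0) k) + T3 K (fun p => mE s p - mg tau p) (V 0) k = F K s k.
  by rewrite -T3Bm /F; ring.
have mr (p : I * I * I) := mE_mg p tau0 sI.
apply: hb_ext e (hb_le (hb_add _ (hb_W20 (VB_H2d uK st)) (T3_jap d3 uK mr (VA2d dom0))) _) => //.
by rewrite le_eqVlt; apply/orP; left; apply/eqP; rewrite /K7; ring.
Qed.

Let F_H2 K s : uniq K -> 0 <= s <= tau -> hb W2 (F K s) K8.
Proof.
move=> uK sI; have /andP[s0 stau] := sI.
have st : lo <= s <= tau by rewrite (le_trans lo0).
apply: hb_le (hb_sub _ (T3_H2 d3 uK (normc_mE s) (VA2d st)) (T3_H2 d3 uK (normc_mg tau) (VA2d dom0))) _ => //.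
by rewrite le_eqVlt; apply/orP; left; apply/eqP; rewrite /K8; ring.
Qed.

Let first_error (Gam : I -> R[i]) W X : (forall k, 0 <= W k) -> 0 <= X ->
  (forall e, 0 < e -> exists n0, forall n k, (n0 <= n)%N ->
    N (Gam k - T3 (box n) (fun p => tau%:C * mg tau p) (V 0) k) <= e) ->
  (forall K s, uniq K -> 0 <= s <= tau -> hb W (F K s) X) ->
  hb W (fun k => V tau k - V 0 k - z * Gam k) (mu ^+ 2 * X * tau ^+ 2).
Proof.
move=> Wp X0 GT FX; rewrite -[X in _ * X ^+ 2]subr0.
apply: mvt_hb_approx => // [|| e e0]; [exact: ltW|exact: mulr_ge0 (sqr_ge0 _) X0|].
pose e' := e / (2 * `|mu| + 1).
have e'0 : 0 < e' by rewrite divr_gt0// ltr_wpDl// mulr_ge0.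
have muz : `|mu| * (2 * e') <= e.
  rewrite /e' mulrA mulrA ler_pdivrMr; last by rewrite ltr_wpDl// mulr_ge0.
  by have := ltW e0; lra.
have [n1 h1] := XiTd e'0; have [n2 h2] := GT _ e'0.
pose n := maxn n1 n2; pose K := @box d n; have uK : uniq K := box_uniq n.
exists (fun s k => V s k - V 0 k - s%:C * (z * T3 K (mg tau) (V 0) k)).
exists (fun s k => z * Xi s k - 0 - z * T3 K (mg tau) (V 0) k).
have dT k s : cder (fun s => s%:C * (z * T3 K (mg tau) (V 0) k)) s (z * T3 K (mg tau) (V 0) k).
  apply: cder_eq (cderM (cder_id s) (cder_cst _ _)) _; by rewrite mulr0 addr0 mul1r.
split.
- move=> k s /andP[s0 st]; have st' : lo <= s <= tau by rewrite (le_trans lo0).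
  apply: ccontB; last exact: cder_ccont (dT k s).
  by apply: ccontB; [exact: cVd|exact: cder_ccont (cder_cst _ _)].
- move=> k s /andP[s0 st]; have st' : lo < s < tau by rewrite (le_lt_trans lo0).
  by apply: cderB => //; apply: cderB; [exact: dVd|exact: cder_cst].
- move=> k; rewrite mul0r subrr !subr0.
  have -> : V tau k - V 0 k - z * Gam k - (V tau k - V 0 k - tau%:C * (z * T3 K (mg tau) (V 0) k))
     = - (z * (Gam k - T3 K (fun p => tau%:C * mg tau p) (V 0) k)) by rewrite -T3Zm; ring.
  rewrite complex.normcN Normc.normcM; apply: le_trans muz.
  apply: ler_pM; rewrite ?normc_ge0//; have := h2 n k (leq_maxr _ _); rewrite -/K; lra.
move=> s /andP[s0 st]; have st' : lo <= s <= tau by rewrite (le_trans lo0 (ltW s0)) ltW.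
exists (fun k => z * F K s k).
  rewrite -mu2; apply: hb_scale => //; apply: FX => //; by rewrite !ltW.
move=> k; rewrite /F.
have -> : z * Xi s k - 0 - z * T3 K (mg tau) (V 0) k - z * (T3 K (mE s) (V s) k - T3 K (mg tau) (V 0) k) =
   z * (Xi s k - T3 K (mE s) (V s) k) by ring.
rewrite Normc.normcM; apply: le_trans muz.
apply: ler_pM; rewrite ?normc_ge0//.
by have := h1 n s k (leq_maxl _ _) st'; rewrite -/K; lra.
Qed.

Definition KL2_first := mu ^+ 2 * K7.
Definition KH2_first := mu ^+ 2 * K8.

(** These are squared bounds: order tau^2 in L^2 and order tau in H^2, enough for a step made once.
    The quintic term is not part of [Gam]; its contribution is added in [first_err]. *)
Lemma local_error_first (Gam : I -> R[i]) :
  (forall e, 0 < e -> exists n0, forall n k, (n0 <= n)%N ->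
    N (Gam k - T3 (box n) (fun p => tau%:C * mg tau p) (V 0) k) <= e) ->
  hb W0 (fun k => V tau k - V 0 k - z * Gam k) (KL2_first * tau ^+ 4) /\
  hb W2 (fun k => V tau k - V 0 k - z * Gam k) (KH2_first * tau ^+ 2).
Proof.
move=> GT; have I0 : (0 : R) <= 0 <= tau by rewrite lexx/= ltW.
split.
  apply: hb_le (first_error w0 _ GT F_L2) _; first exact: hb_ge0 (F_L2 (box_uniq 0) I0).
  by rewrite le_eqVlt; apply/orP; left; apply/eqP; rewrite /KL2_first; ring.
by apply: hb_le (first_error w2 (hb_ge0 (F_H2 (box_uniq 0) I0)) GT F_H2) _.
Qed.

Hypothesis loE : lo = - tau.

Let dom s : `|s| <= tau -> lo <= s <= tau. Proof. by rewrite loE ler_norml. Qed.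
Let VA s : `|s| <= tau -> hb Wr (V s) A. Proof. by move=> /dom; exact: VAd. Qed.
Let VA2 s : `|s| <= tau -> hb W2 (V s) A. Proof. by move=> /dom; exact: VA2d. Qed.
Let cV k s : `|s| <= tau -> ccont (V^~ k) s. Proof. by move=> /dom; exact: cVd. Qed.
Let dV k s : `|s| < tau -> cder (V^~ k) s (z * Xi s k).
Proof. by move=> h; apply: dVd; rewrite loE -ltr_norml. Qed.
Let XiT e : 0 < e -> exists n0, forall n s k, (n0 <= n)%N -> `|s| <= tau ->
  N (Xi s k - T3 (box n) (mE s) (V s) k) <= e.
Proof. by move=> /XiTd[n0 h]; exists n0 => n s k nn /dom; exact: h. Qed.
Let s00 : `|0 : R| <= tau. Proof. by rewrite normr0 ltW. Qed.
Let dV_H2 s : `|s| <= tau -> hb W2 (fun k => V s k - V 0 k) (K2 * tau ^+ 2).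
Proof. by move=> /dom; exact: dV_H2d. Qed.
Let VB_H2 K s : uniq K -> `|s| <= tau ->
  hb W2 (fun k => T3 K (mE s) (V s) k - T3 K (mE s) (V 0) k) (972 * c0 ^+ 2 * A ^+ 2 * (K2 * tau ^+ 2)).
Proof. by move=> uK /dom; exact: VB_H2d. Qed.

(** Both V(s) - V(0) and the symbol difference gain a factor tau; the latter costs one power of
    [jsum], which H^2 affords when the output is measured in L^2. *)
Let XiB_L2 s : `|s| <= tau -> hb W0 (fun k => Xi s k - Xi (- s) k) (K3 * tau ^+ 2).
Proof.
move=> st; have st' : `|- s| <= tau by rewrite normrN.
apply: hb_approx => // e e0; have [|n0 h] := XiT (_ : 0 < e / 2); first by rewrite divr_gt0.
pose K := @box d n0; have uK : uniq K := box_uniq n0.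
pose y k := (T3 K (mE s) (V s) k - T3 K (mE s) (V 0) k) + T3 K (fun p => mE s p - mE (- s) p) (V 0) k
   - (T3 K (mE (- s)) (V (- s)) k - T3 K (mE (- s)) (V 0) k).
exists y.
  have m8 (p : I * I * I) : N (mE s p - mE (- s) p) <= 8 * tau * jsum p.
    apply: le_trans (normc_mEB _ _ _) _; apply: ler_wpM2r; first exact: japs_ge0.
    by rewrite opprK (le_trans (ler_wpM2l _ (ler_normD s s)))//; lra.
  have h1 := T3_jap d3 uK m8 (VA2 s00).
  apply: hb_le (hb_add3 _ (hb_W20 (VB_H2 uK st)) h1 (hb_opp (hb_W20 (VB_H2 uK st')))) _ => //.
  by rewrite le_eqVlt; apply/orP; left; apply/eqP; rewrite /K3; ring.
move=> k; rewrite /y -T3Bm.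
have -> : Xi s k - Xi (- s) k - (T3 K (mE s) (V s) k - T3 K (mE s) (V 0) k +
  (T3 K (mE s) (V 0) k - T3 K (mE (- s)) (V 0) k) - (T3 K (mE (- s)) (V (- s)) k - T3 K (mE (- s)) (V 0) k))
  = (Xi s k - T3 K (mE s) (V s) k) - (Xi (- s) k - T3 K (mE (- s)) (V (- s)) k) by ring.
apply: le_trans (normcB _ _) _; have := h n0 s k (leqnn _) st; have := h n0 (- s) k (leqnn _) st'.
by rewrite -/K; lra.
Qed.

Let K3_ge0 : 0 <= K3.
Proof. by have := hb_ge0 (XiB_L2 s00); rewrite pmulr_lge0// exprn_gt0. Qed.
Let K4_ge0 : 0 <= K4. Proof. exact: mulr_ge0 (sqr_ge0 _) K3_ge0. Qed.

(** The derivative of V(s) + V(-s) is the odd difference of [XiB_L2], already of order tau, so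
    integration yields order tau^2: the first-order terms have cancelled. *)
Let VS_L2 s : 0 <= s <= tau -> hb W0 (fun k => V s k + V (- s) k - (V 0 k + V 0 k)) (K4 * tau ^+ 4).
Proof.
move=> /andP[s0 st].
have h : hb W0 (fun k => V s k + V (- s) k - (V 0 k + V (- 0) k)) (K4 * tau ^+ 2 * (s - 0) ^+ 2).
  apply: (@mvt_hb _ (fun s k => V s k + V (- s) k) (fun s k => z * (Xi s k - Xi (- s) k))) => //.
  - by apply: mulr_ge0 => //; exact: sqr_ge0.
  - move=> k t /andP[t0 ts]; have tt : `|t| <= tau by rewrite ger0_norm// (le_trans ts).
    apply: ccontD; first exact: cV.
    apply: (@ccont_comp _ (V^~ k) -%R t); last by apply: cV; rewrite normrN.
    exact: opp_continuous.
  - move=> k t /andP[t0 ts]; have tt : `|t| < tau by rewrite gtr0_norm// (lt_le_trans ts).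
    rewrite mulrBr; apply: cderD; first exact: dV.
    by apply: (cder_opp (f := V^~ k)); apply: dV; rewrite normrN.
  - move=> t /andP[t0 ts]; have tt : `|t| <= tau by rewrite gtr0_norm// (le_trans (ltW ts)).
    by rewrite /K4 -mu2 -mulrA; apply: hb_scale => //; exact: XiB_L2.
apply: hb_ext (hb_le h _) => [k|]; first by rewrite oppr0.
rewrite subr0 -mulrA ler_wpM2l// (_ : tau ^+ 4 = tau ^+ 2 * tau ^+ 2); last by ring.
by rewrite ler_wpM2l ?sqr_ge0// lerXn2r ?nnegrE// ltW.
Qed.

Let D K s k : R[i] := T3 K (mE s) (V s) k + T3 K (mE (- s)) (V (- s)) k - T3 K (mq tau s) (V 0) k.

Let D_L2 K s : uniq K -> 0 <= s <= tau -> hb W0 (D K s) (K5 * tau ^+ 4).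
Proof.
move=> uK sI; have /andP[s0 stau] := sI.
have st : `|s| <= tau by rewrite ger0_norm.
have st' : `|- s| <= tau by rewrite normrN.
pose dp k := V s k - V 0 k; pose dm k := V (- s) k - V 0 k.
pose P k := V s k + V (- s) k - (V 0 k + V 0 k).
have m8 (p : I * I * I) : N (mE (- s) p - mE s p) <= 8 * tau * jsum p.
  apply: le_trans (normc_mEB _ _ _) _; apply: ler_wpM2r; first exact: japs_ge0.
  rewrite (_ : - s - s = - (s + s)); last by ring.
  by rewrite normrN (le_trans (ler_wpM2l _ (ler_normD s s)))//; lra.
(* Expansion around V(0): the symbol defect; the linear response to the even combination [P], of
   order tau^2; the linear response to [dm] under a symbol difference of order tau; the parts of
   higher degree, of order tau^2. *)
have e k : (T3 K (fun p => mE s p + mE (- s) p - mq tau s p) (V 0) k + Tel K (mE s) P (V 0) (V 0) k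
  + Tel K (fun p => mE (- s) p - mE s p) dm (V 0) (V 0) k)
  + (Quad K (mE s) dp (V 0) k + Quad K (mE (- s)) dm (V 0) k) = D K s k.
  have h1 := T3_quad K (mE s) (V s) (V 0) k; have h2 := T3_quad K (mE (- s)) (V (- s)) (V 0) k.
  rewrite -/dp in h1; rewrite -/dm in h2.
  have h3 : Tel K (mE s) P (V 0) (V 0) k = Tel K (mE s) dp (V 0) (V 0) k + Tel K (mE s) dm (V 0) (V 0) k.
    by rewrite -TelD; congr (Tel _ _ _ _ _ _); apply/funext => l; rewrite /P /dp /dm; ring.
  rewrite h3 -TelBm -T3Bm -T3Dm /D.
  have -> : T3 K (mE s) (V s) k = T3 K (mE s) (V 0) k + (Tel K (mE s) dp (V 0) (V 0) k + Quad K (mE s) dp (V 0) k).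
    by rewrite -h1; ring.
  have -> : T3 K (mE (- s)) (V (- s)) k = T3 K (mE (- s)) (V 0) k + (Tel K (mE (- s)) dm (V 0) (V 0) k + Quad K (mE (- s)) dm (V 0) k).
    by rewrite -h2; ring.
  by ring.
have hp := dV_H2 st; have hm := dV_H2 st'.
have t2 : tau ^+ 2 <= 1 by rewrite expr_le1 ?(ltW tau0).
have mc (p : I * I * I) := mE_mq_crit p tau0 sI.
have ha := T3_crit d3 uK mc (VA s00).
have hb := Tel_L2 d3 uK (normc_mE s) (VS_L2 sI) (VA2 s00) (VA2 s00).
have hc := Tel_jap d3 uK m8 hm (VA2 s00).
have hd := Quad_H2 d3 uK (normc_mE s) hp (VA2 s00).
have he := Quad_H2 d3 uK (normc_mE (- s)) hm (VA2 s00).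
apply: hb_ext e (hb_le (hb_add _ (hb_add3 _ ha hb hc) (hb_add _ (hb_W20 hd) (hb_W20 he))) _) => //.
have q : 2000 * c0 ^+ 2 * 1 ^+ 2 * (A + K2 * tau ^+ 2) * (K2 * tau ^+ 2) ^+ 2 <=
   2000 * c0 ^+ 2 * (A + K2) * K2 ^+ 2 * tau ^+ 4.
  rewrite [leLHS](_ : _ = 2000 * (c0 ^+ 2 * ((A + K2 * tau ^+ 2) * (K2 * tau ^+ 2) ^+ 2))); last by ring.
  rewrite [leRHS](_ : _ = 2000 * (c0 ^+ 2 * ((A + K2) * (K2 * tau ^+ 2) ^+ 2))); last by ring.
  rewrite ler_pM2l ?ltr0n//; apply: ler_wpM2l; first exact: sqr_ge0.
  by apply: ler_wpM2r; [exact: sqr_ge0|rewrite lerD2l ler_piMr].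
rewrite [leRHS](_ : _ = 2 * (4 * (36 * 6 ^+ d * c0 * (48 * tau ^+ 2) ^+ 2 * A ^+ 3 +
   972 * c0 ^+ 2 * 1 ^+ 2 * A ^+ 2 * (K4 * tau ^+ 4) +
   108 * c0 ^+ 2 * (8 * tau) ^+ 2 * A ^+ 2 * (K2 * tau ^+ 2)) +
   2 * (2000 * c0 ^+ 2 * (A + K2) * K2 ^+ 2 * tau ^+ 4 + 2000 * c0 ^+ 2 * (A + K2) * K2 ^+ 2 * tau ^+ 4))); last first.
  by rewrite /K5; ring.
by rewrite ler_pM2l ?ltr0n// lerD2l ler_pM2l ?ltr0n// lerD.
Qed.

(** In H^2 the symbol defect is controlled only at order tau^(d/4), through [T3_rho]; the variation
    of the profile is of order tau, which is no worse as d / 4 <= 1. *)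
Let D_H2 K s : uniq K -> 0 <= s <= tau -> hb W2 (D K s) (K6 * (tau `^ (d%:R / 4)) ^+ 2).
Proof.
move=> uK sI; have /andP[s0 stau] := sI.
have st : `|s| <= tau by rewrite ger0_norm.
have st' : `|- s| <= tau by rewrite normrN.
have e k : (T3 K (mE s) (V s) k - T3 K (mE s) (V 0) k) + (T3 K (mE (- s)) (V (- s)) k - T3 K (mE (- s)) (V 0) k)
   + T3 K (fun p => mE s p + mE (- s) p - mq tau s p) (V 0) k = D K s k.
  by rewrite -T3Bm -T3Dm /D; ring.
have mr (p : I * I * I) := mE_mq_rho d3 p tau0 sI.
apply: hb_ext e (hb_le (hb_add3 _ (VB_H2 uK st) (VB_H2 uK st') (T3_rho d3 uK mr (VA s00))) _) => //.
set q := tau `^ _.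
have tq : tau ^+ 2 <= q ^+ 2.
  rewrite lerXn2r ?nnegrE ?powR_ge0 ?(ltW tau0)//.
  rewrite -[leLHS]powRr1 ?(ltW tau0)//; apply: ger_powR; first by rewrite tau0.
  rewrite ler_pdivrMr ?ltr0n// mul1r (@le_trans _ _ 3%:R) ?ler_nat//.
rewrite [leLHS](_ : _ = 7776 * (c0 ^+ 2 * (A ^+ 2 * K2)) * tau ^+ 2 + 324 * c0 ^+ 2 * 48 ^+ 2 * A ^+ 3 * q ^+ 2); last by ring.
rewrite [leRHS](_ : _ = 7776 * (c0 ^+ 2 * (A ^+ 2 * K2)) * q ^+ 2 + 324 * c0 ^+ 2 * 48 ^+ 2 * A ^+ 3 * q ^+ 2); last by rewrite /K6; ring.
rewrite lerD2r; apply: ler_wpM2l tq; apply: mulr_ge0; first exact: ler0n.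
exact: mulr_ge0 (sqr_ge0 _) (mulr_ge0 (sqr_ge0 _) K2_ge0).
Qed.

(** The curve V(s) - V(-s) - z T3 (mm tau s) starts at 0, its derivative is close to z D, and its
    value at tau is close to the local error. *)
Let step_error (Gam : I -> R[i]) W X : (forall k, 0 <= W k) -> 0 <= X ->
  (forall e, 0 < e -> exists n0, forall n k, (n0 <= n)%N ->
    N (Gam k - T3 (box n) (mm tau tau) (V 0) k) <= e) ->
  (forall K s, uniq K -> 0 <= s <= tau -> hb W (D K s) X) ->
  hb W (fun k => V tau k - V (- tau) k - z * Gam k) (mu ^+ 2 * X * tau ^+ 2).
Proof.
move=> Wp X0 GT DX; rewrite -[X in _ * X ^+ 2]subr0.
apply: mvt_hb_approx => // [|| e e0]; [exact: ltW|exact: mulr_ge0 (sqr_ge0 _) X0|].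
(* The 2 accounts for the forcing at both s and -s; the 1 keeps the denominator positive. *)
pose e' := e / (2 * `|mu| + 1).
have e'0 : 0 < e' by rewrite divr_gt0// ltr_wpDl// mulr_ge0.
have muz : `|mu| * (2 * e') <= e.
  rewrite /e' mulrA mulrA ler_pdivrMr; last by rewrite ltr_wpDl// mulr_ge0.
  by have := ltW e0; lra.
have [n1 h1] := XiT e'0; have [n2 h2] := GT _ e'0.
pose n := maxn n1 n2; pose K := @box d n; have uK : uniq K := box_uniq n.
exists (fun s k => V s k - V (- s) k - z * T3 K (mm tau s) (V 0) k).
exists (fun s k => z * Xi s k + z * Xi (- s) k - z * T3 K (mq tau s) (V 0) k).
have dT k s : cder (fun s => z * T3 K (mm tau s) (V 0) k) s (z * T3 K (mq tau s) (V 0) k).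
  apply: cderZ; apply: cder_sum => p; apply: cder_eq (cderM (cder_mm tau s p) (cder_cst _ _)) _.
  by rewrite mulr0 addr0.
split.
- move=> k s /andP[s0 st]; have st' : `|s| <= tau by rewrite ger0_norm.
  apply: ccontB; last exact: cder_ccont (dT k s).
  apply: ccontB; first exact: cV.
  apply: (@ccont_comp _ (V^~ k) -%R s); last by apply: cV; rewrite normrN.
  exact: opp_continuous.
- move=> k s /andP[s0 st]; have st' : `|s| < tau by rewrite gtr0_norm.
  apply: cderB => //; rewrite -[z * Xi (- s) k]opprK; apply: cderB; first exact: dV.
  by apply: (cder_opp (f := V^~ k)); apply: dV; rewrite normrN.
- move=> k; have T0 : T3 K (mm tau 0) (V 0) k = 0.
    by rewrite /T3 /T big1// => p _; rewrite mm0 mul0r.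
  rewrite T0 oppr0 subrr mulr0 !subr0.
  have -> : V tau k - V (- tau) k - z * Gam k - (V tau k - V (- tau) k - z * T3 K (mm tau tau) (V 0) k)
     = - (z * (Gam k - T3 K (mm tau tau) (V 0) k)) by ring.
  rewrite complex.normcN Normc.normcM; apply: le_trans muz.
  apply: ler_pM; rewrite ?normc_ge0//; have := h2 n k (leq_maxr _ _); rewrite -/K; lra.
move=> s /andP[s0 st]; have st' : `|s| <= tau by rewrite gtr0_norm// ltW.
exists (fun k => z * D K s k).
  rewrite -mu2; apply: hb_scale => //; apply: DX => //; by rewrite !ltW.
move=> k; rewrite /D.
have -> : z * Xi s k + z * Xi (- s) k - z * T3 K (mq tau s) (V 0) k -
   z * (T3 K (mE s) (V s) k + T3 K (mE (- s)) (V (- s)) k - T3 K (mq tau s) (V 0) k) =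
   z * ((Xi s k - T3 K (mE s) (V s) k) + (Xi (- s) k - T3 K (mE (- s)) (V (- s)) k)) by ring.
rewrite Normc.normcM; apply: le_trans muz.
apply: ler_pM; rewrite ?normc_ge0//; apply: le_trans (complex.le_normcD _ _) _.
have := h1 n s k (leq_maxl _ _) st'; have := h1 n (- s) k (leq_maxl _ _); rewrite normrN => /(_ st').
rewrite -/K; lra.
Qed.

Definition KL2 := mu ^+ 2 * K5.
Definition KH2 := mu ^+ 2 * K6.

Lemma local_error (Gam : I -> R[i]) :
  (forall e, 0 < e -> exists n0, forall n k, (n0 <= n)%N ->
    N (Gam k - T3 (box n) (mm tau tau) (V 0) k) <= e) ->
  hb W0 (fun k => V tau k - V (- tau) k - z * Gam k) (KL2 * tau ^+ 6) /\
  hb W2 (fun k => V tau k - V (- tau) k - z * Gam k) (KH2 * (tau * tau `^ (d%:R / 4)) ^+ 2).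
Proof.
move=> GT; have I0 : (0 : R) <= 0 <= tau by rewrite lexx/= ltW.
split.
  apply: hb_le (step_error w0 _ GT D_L2) _; first exact: hb_ge0 (D_L2 (box_uniq 0) I0).
  by rewrite le_eqVlt; apply/orP; left; apply/eqP; rewrite /KL2; ring.
apply: hb_le (step_error w2 _ GT D_H2) _; first exact: hb_ge0 (D_H2 (box_uniq 0) I0).
by rewrite le_eqVlt; apply/orP; left; apply/eqP; rewrite /KH2; ring.
Qed.

End local_error.

(** * The exact solution *)

Section derivative_criteria.
Context {R : realType}.
Implicit Types (f : R -> R[i]) (s t : R).

Lemma is_derive_eps (f : R -> R) t l :
  (forall e, 0 < e -> exists2 r, 0 < r & forall s, `|s - t| < r -> `|f s - f t - (s - t) * l| <= e * `|s - t|) ->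
  is_derive t (1 : R) f l.
Proof.
move=> h.
have c : (fun u : R => u^-1 *: ((f \o shift t) (u *: (1 : R)) - f t)) @ 0^' --> l.
  apply/cvgrPdist_le => e e0; have [r r0 hr] := h e e0.
  rewrite /dnbhs /within/=; apply/nbhs_ballP; exists r => //= u; rewrite /ball/= sub0r normrN => ur un0.
  have := hr (u + t); rewrite addrK => /(_ ur) h1.
  rewrite /GRing.scale/= mulr1 distrC.
  have -> : u^-1 * (f (u + t) - f t) - l = u^-1 * (f (u + t) - f t - u * l) by field.
  rewrite normrM normfV mulrC ler_pdivrMr ?normr_gt0//.
by apply: DeriveDef; [exact: cvgP c|exact: cvg_lim c].
Qed.

Lemma cder_eps f t l :
  (forall e, 0 < e -> exists2 r, 0 < r & forall s, `|s - t| < r -> N (f s - f t - (s - t)%:C * l) <= e * `|s - t|) ->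
  cder f t l.
Proof.
move=> h; split; apply: is_derive_eps => e e0; have [r r0 hr] := h e e0; exists r => // s st;
  apply: le_trans (hr s st).
- apply: le_trans (le_Re_normc _); rewrite !ReImE/= mul0r subr0; exact: lexx.
- apply: le_trans (le_Im_normc _); rewrite !ReImE/= mul0r addr0; exact: lexx.
Qed.

Lemma ccont_eps f t :
  (forall e, 0 < e -> exists2 r, 0 < r & forall s, `|s - t| < r -> N (f s - f t) <= e) -> ccont f t.
Proof.
move=> h; split; apply/cvgrPdist_le => e e0; have [r r0 hr] := h e e0;
  apply/nbhs_ballP; exists r => //= s; rewrite /ball/= distrC => /hr; rewrite distrC; apply: le_trans.
- by apply: le_trans (le_Re_normc _); rewrite !ReImE.
- by apply: le_trans (le_Im_normc _); rewrite !ReImE.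
Qed.

End derivative_criteria.

(** * The cubic nonlinearity on the Fourier side *)

Section cubic.
Context {R : realType} {d : nat}.
Hypothesis d3 : (d <= 3)%N.
Local Notation P := (@torus_prob R d).
Local Notation I := 'rV[int]_d.
Local Notation fc := (@fourier R d).
Implicit Types (u v w : torus R d -> R[i]) (k : I).

Lemma l2_conj_fun w : l2 P w -> l2 P (conj_fun w).
Proof. exact: l2_conj. Qed.

Lemma sqr_normc_conj (z : R[i]) : `|z| ^+ 2 = z * z^*.
Proof. by rewrite mulc_conj rmorphXn. Qed.

Lemma cubicE w : cubic w = fun x => w x * w x * conj_fun w x.
Proof. by apply/funext => x; rewrite /cubic sqr_normc_conj /conj_fun; ring. Qed.

Lemma hb_fourier_conj W w X : l2 P w -> (forall k, W (- k) = W k) -> hb W (fc w) X ->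
  hb W (fc (conj_fun w)) X.
Proof. by move=> lw WN wX; apply: hb_ext (hb_cb WN wX) => k; rewrite fourier_conj_fun. Qed.

Lemma hb2_conj w X : l2 P w -> hb W2 (fc w) X -> hb W2 (fc (conj_fun w)) X.
Proof. by move=> lw; apply: hb_fourier_conj => // k; rewrite /W2 japN. Qed.

Lemma cubic_l2 w X : l2 P w -> hb W2 (fc w) X -> l2 P (cubic w).
Proof.
by move=> lw wX; rewrite cubicE; apply: (prod3_l2 d3 lw lw (l2_conj_fun lw) wX (hb2_conj lw wX)).
Qed.

Lemma T_ext K m a b c a' b' c' k : (forall l, a l = a' l) -> (forall l, b l = b' l) -> (forall l, c l = c' l) ->
  @T R d K m a b c k = T K m a' b' c' k.
Proof. by move=> h1 h2 h3; apply: eq_bigr => p _; rewrite h1 h2 h3. Qed.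

Lemma cubic_hb2 w X : l2 P w -> hb W2 (fc w) X -> hb W2 (fc (cubic w)) (81 * (10 ^+ d) ^+ 2 * (X * X * X)).
Proof.
move=> lw wX; rewrite cubicE.
exact: (prod3_hb2 d3 lw lw (l2_conj_fun lw) wX wX (hb2_conj lw wX)).
Qed.

Lemma cubic_approx X e : 0 < e -> exists n0, forall n, (n0 <= n)%N -> forall w,
  l2 P w -> hb W2 (fc w) X -> forall k,
  N (fc (cubic w) k - T3 (box n) (fun=> 1) (fc w) k) <= e.
Proof.
move=> e0; have [n0 h] := prod3_approx d3 X e0; exists n0 => n nn w lw wX k.
rewrite cubicE /T3; apply: le_trans (h n nn w w (conj_fun w) lw lw (l2_conj_fun lw) wX wX (hb2_conj lw wX) k).
by rewrite (T_ext _ _ _ (fun=> erefl) (fun=> erefl) (fourier_conj_fun lw)).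
Qed.

(** The phases of the three inputs and of the output combine into the resonance function, with the
    opposite sign in the conjugated slot. *)
Lemma T3_twist K s (a : I -> R[i]) k :
  T3 K (mE s) (fun k => E (s * freq2 k) * a k) k = E (s * freq2 k) * T3 K (fun=> 1) a k.
Proof.
rewrite /T3 /T mulr_sumr; apply: eq_bigr => p /eqP <-.
have -> : cb (fun k => E (s * freq2 k) * a k) p.2 = E (- (s * freq2 p.2)) * cb a p.2.
  by rewrite /cb [LHS]rmorphM freq2N EN.
rewrite /mE /phL [LHS](_ : _ = (E (s * (freq2 (fsum p) - freq2 p.1.1 - freq2 p.1.2 + freq2 p.2)) * E (s * freq2 p.1.1) * E (s * freq2 p.1.2) * E (- (s * freq2 p.2)))
  * (a p.1.1 * a p.1.2 * cb a p.2)); last by ring.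
by rewrite -!ED mul1r; congr (E _ * _); ring.
Qed.

End cubic.

Section exact_solution.
Context {R : realType} {d : nat}.
Hypothesis d3 : (d <= 3)%N.
Local Notation P := (@torus_prob R d).
Local Notation I := 'rV[int]_d.
Local Notation fc := (@fourier R d).
Variables (mu T : R) (u0 : torus R d -> R[i]) (Tmax : \bar R) (u : R -> torus R d -> R[i]).
Hypotheses (T0 : 0 < T) (sol : nls_solution mu u0 Tmax u) (TTmax : (T%:E < Tmax)%E).
Let M := sup_Hnorm (2 + d%:R / 4) T u.
Hypothesis Moo : (M < +oo)%E.
Let A := fine M ^+ 2.

Let HnormM t : 0 <= t <= T -> (Hnorm (2 + d%:R / 4) (u t) <= M)%E.
Proof. by move=> tT; apply: ereal_sup_ubound; exists t => //=; rewrite in_itv. Qed.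

Let Mfin : M = (fine M)%:E /\ 0 <= fine M.
Proof.
have M0 : (0 <= M)%E.
  have h0 : 0 <= (0 : R) <= T by rewrite lexx ltW.
  apply: le_trans (HnormM h0); rewrite /Hnorm; exact: poweR_ge0.
by split; [rewrite fineK// ge0_fin_numE|exact: fine_ge0].
Qed.

Lemma solution_Wr t : 0 <= t <= T -> hb Wr (fc (u t)) A.
Proof.
move=> tT; have [Me M0] := Mfin.
have := HnormM tT; rewrite Me => /(Hnorm_bnd M0) h K uK; apply: le_trans (h K uK).
apply: ler_sum => k _; rewrite /Wr exprMn rho_sqr powRD; last first.
  by apply/implyP => _; rewrite gt_eqF// (jap_gt0 k).
by rewrite -powR_mulrn ?(ltW (jap_gt0 k))// [X in X * _]mulrC.
Qed.

Lemma solution_W2 t : 0 <= t <= T -> hb W2 (fc (u t)) A.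
Proof. by move=> /solution_Wr; apply: hb_weight; exact: W2r. Qed.

Let lt_Tmax t : t <= T -> (t%:E < Tmax)%E.
Proof. by move=> tT; apply: le_lt_trans TTmax; rewrite lee_fin. Qed.

Lemma solution_l2 t : 0 <= t -> (t%:E < Tmax)%E -> l2 P (u t).
Proof. by move=> t0 tT; apply: L2_l2; case: sol => _ _ /(_ t (conj t0 tT)) []. Qed.

Definition velocity t k : R[i] := - ('i%C * (freq2 k)%:C) * fc (u t) k - 'i%C * mu%:C * fc (cubic (u t)) k.

Let laplacian_spec t : 0 <= t <= T ->
  l2 P (laplacian (u t)) /\ forall k, fc (laplacian (u t)) k = (- freq2 k)%:C * fc (u t) k.
Proof.
move=> tT; have /andP[t0 tT'] := tT.
apply: (@multiplier_spec _ _ _ _ A); first exact: solution_l2 (lt_Tmax tT').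
move=> K uK; apply: le_trans (solution_W2 tT uK); apply: ler_sum => k _.
rewrite Normc.normcM exprMn normc_real normrN ger0_norm ?freq2_ge0// /W2.
apply: ler_wpM2r; first exact: sqr_ge0.
by rewrite lerXn2r ?nnegrE ?freq2_ge0 ?(ltW (jap_gt0 _))// lerDr.
Qed.

(** A single coefficient is bounded by the L^2 norm, so the equation in L^2 gives an expansion of
    the coefficients that is uniform in the frequency. It is available for nonnegative times
    only. *)
Lemma solution_diff t e : 0 <= t <= T -> 0 < e ->
  exists2 r, 0 < r & forall s, `|s - t| < r -> 0 <= s -> forall k,
    N (fc (u s) k - fc (u t) k - (s - t)%:C * velocity t k) <= e * `|s - t|.
Proof.
move=> tT e0; have /andP[t0 tT'] := tT.
have lt := solution_l2 t0 (lt_Tmax tT'); have [ll fl] := laplacian_spec tT.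
have lc := cubic_l2 d3 lt (solution_W2 tT).
case: sol => _ _ _ _ /(_ t (conj t0 (lt_Tmax tT'))) lim.
have [r1 r10 h1] : exists2 r, 0 < r & forall s, `|s - t| < r -> (s%:E < Tmax)%E.
  have : nbhs t [set s : R | (s%:E < Tmax)%E] by apply: open_nbhs_nbhs; split; [exact: open_ereal_lt|exact: lt_Tmax].
  by move=> /nbhs_ballP[r r0 h]; exists r => // s st; apply: h; rewrite /ball/= distrC.
have := lim [set x | (x < e%:E)%E] (open_ereal_lt' _).
rewrite /= lte_fin e0 => /(_ isT); rewrite /within/= /dnbhs/= => /nbhs_ballP[r2 r20 h2].
exists (Num.min r1 r2) => [|s]; first by rewrite lt_min r10.
rewrite lt_min => /andP[s1 s2] s0 k.
have [->|st] := eqVneq s t.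
  by rewrite !subrr mul0r subrr Normc.normc0 normr0 mulr0.
have ls := solution_l2 s0 (h1 s s1).
have := h2 s; rewrite /ball/= distrC => /(_ s2 st (conj s0 (h1 s s1))).
pose g1 x := 'i%C * ((u s x - u t x) / (s - t)%:C).
pose g2 x := - laplacian (u t) x + mu%:C * cubic (u t) x.
have lg1 : l2 P g1.
  have := l2Z ('i%C / (s - t)%:C) (l2B ls lt); congr (l2 P _).
  by apply/funext => x; rewrite /g1; ring.
have lg2 : l2 P g2 by apply: l2D; [exact: l2N|exact: l2Z].
have lg := l2B lg1 lg2.
rewrite (L2normE lg) lte_fin => h.
have st0 : (s - t)%:C != 0 :> R[i] by rewrite -[0]/((0:R)%:C) (inj_eq (@complexI _)) subr_eq0.
have e1 : fc g1 k = 'i%C / (s - t)%:C * (fc (u s) k - fc (u t) k).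
  rewrite -fourierB; [|exact: l2_cible..]; rewrite -fourierZ; last by apply: l2_cible; exact: l2B.
  by congr fc; apply/funext => x; rewrite /g1; ring.
have e2 : fc g2 k = (freq2 k)%:C * fc (u t) k + mu%:C * fc (cubic (u t)) k.
  rewrite /g2 fourierD; [|by apply: l2_cible; exact: l2N|by apply: l2_cible; exact: l2Z].
  rewrite fourierZ; last exact: l2_cible.
  congr (_ + _); under [X in fc X]eq_fun do rewrite -mulN1r.
  by rewrite fourierZ ?fl; [rewrite raddfN; ring|exact: l2_cible].
have e3 : fc (fun x => g1 x - g2 x) k = 'i%C / (s - t)%:C * (fc (u s) k - fc (u t) k - (s - t)%:C * velocity t k).
  rewrite fourierB; [|exact: l2_cible..]; rewrite e1 e2 /velocity.
  have ii : 'i%C * 'i%C = -1 :> R[i] by rewrite -expr2; exact: sqrCi.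
  move: (fc (u s) k) (fc (u t) k) (fc (cubic _) k) ((s - t)%:C) st0 => x y w q q0.
  transitivity ('i%C / q * (x - y) + 'i%C * 'i%C * ((freq2 k)%:C * y + mu%:C * w)).
    by rewrite ii; ring.
  by field.
have := bessel_torus lg (K := [:: k]) isT; rewrite big_cons big_nil addr0 e3 => h3.
have h4 : N ('i%C / (s - t)%:C * (fc (u s) k - fc (u t) k - (s - t)%:C * velocity t k)) <= e.
  apply: le_trans (ltW h); rewrite -[leLHS]ger0_norm ?normc_ge0// -sqrtr_sqr ler_sqrt//; exact: n2_ge0.
move: h4; rewrite !Normc.normcM normci mul1r Normc.normcV normc_real.
by rewrite mulrC ler_pdivrMr// normr_gt0 subr_eq0.
Qed.

Variables (t0 tau lo : R).
Hypotheses (t0lo : 0 <= t0 + lo) (t0tau : t0 + tau <= T).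

(* Reflecting the time makes the profile continuous at [t0 + lo = 0] from both sides. *)
Definition profile s k : R[i] := E (s * freq2 k) * fc (u `|t0 + s|) k.
Definition forcing s k : R[i] := E (s * freq2 k) * fc (cubic (u `|t0 + s|)) k.

Let absE s : lo <= s -> `|t0 + s| = t0 + s.
Proof. by move=> ls; rewrite ger0_norm// (le_trans t0lo)// lerD2l. Qed.

Let inT s : lo <= s <= tau -> 0 <= `|t0 + s| <= T.
Proof. by move=> /andP[ls st]; rewrite normr_ge0 absE// (le_trans _ t0tau)// lerD2l. Qed.

Lemma profile_Wr s : lo <= s <= tau -> hb Wr (profile s) A.
Proof.
move=> sI; apply: hb_le (hb_mul (r := 1) _ _ (solution_Wr (inT sI))) _.
- by move=> k; exact: sqr_ge0.
- by move=> k; rewrite normc_E.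
- by rewrite expr1n mul1r.
Qed.

Let cderE (k : I) s : cder (fun s : R => E (s * freq2 k)) s ('i%C * (freq2 k : R)%:C * E (s * freq2 k)).
Proof. exact: cder_E. Qed.

Lemma profile_cont k s : lo <= s <= tau -> ccont (profile^~ k) s.
Proof.
move=> sI; apply: ccontM; first exact: cder_ccont (cderE k s).
apply: ccont_eps => e e0; have [r r0 h] := solution_diff (inT sI) ltr01.
pose v := N (velocity `|t0 + s| k).
have v0 : 0 <= v by exact: normc_ge0.
exists (Num.min r (e / (v + 1))) => [|x]; first by rewrite lt_min r0 divr_gt0// ltr_wpDl.
rewrite lt_min => /andP[x1 x2].
have hx : `| `|t0 + x| - `|t0 + s| | <= `|x - s|.
  by apply: le_trans (ler_dist_dist _ _) _; rewrite (_ : t0 + x - (t0 + s) = x - s); [exact: lexx|ring].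
have := h `|t0 + x| (le_lt_trans hx x1) (normr_ge0 _) k.
set a := fc _ k; set b := fc _ k; set w := velocity _ k => h1.
apply: (@le_trans _ _ ((1 + v) * `|x - s|)); last first.
  by move: x2; rewrite ltr_pdivlMr ?ltr_wpDl// mulrC addrC => /ltW.
have -> : a - b = (a - b - (`|t0 + x| - `|t0 + s|)%:C * w) + (`|t0 + x| - `|t0 + s|)%:C * w by rewrite subrK.
apply: le_trans (complex.le_normcD _ _) _; rewrite mulrDl; apply: lerD.
  by apply: le_trans h1 _; rewrite !mul1r.
by rewrite Normc.normcM normc_real mulrC ler_wpM2l.
Qed.

Lemma profile_der k s : lo < s < tau -> cder (profile^~ k) s (- ('i%C * mu%:C) * forcing s k).
Proof.
move=> /andP[ls st]; have sI : lo <= s <= tau by rewrite !ltW.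
have ts : 0 < t0 + s by rewrite (le_lt_trans t0lo)// ltrD2l.
have hU : cder (fun x => fc (u `|t0 + x|) k) s (velocity `|t0 + s| k).
  apply: cder_eps => e e0; have [r r0 h] := solution_diff (inT sI) e0.
  (* Within distance t0 + s of [s] the time stays nonnegative and the reflection does nothing. *)
  exists (Num.min r (t0 + s)) => [|x]; first by rewrite lt_min r0.
  rewrite lt_min => /andP[x1 x2].
  have xp : 0 <= t0 + x by move: x2; rewrite ltr_norml => /andP[]; lra.
  have e1 : `|t0 + x| - `|t0 + s| = x - s by rewrite !ger0_norm ?(ltW ts)//; ring.
  by have := h `|t0 + x|; rewrite e1 => /(_ x1 (normr_ge0 _) k).
apply: cder_eq (cderM (cderE k s) hU) _.
by rewrite /velocity /forcing; ring.
Qed.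

(** One cutoff serves all times because [A] bounds the solution in H^2 uniformly on [0, T]. *)
Lemma forcing_approx e : 0 < e -> exists n0, forall n s k, (n0 <= n)%N -> lo <= s <= tau ->
  N (forcing s k - T3 (box n) (mE s) (profile s) k) <= e.
Proof.
move=> e0; have [n0 h] := cubic_approx d3 A e0; exists n0 => n s k nn sI.
have /andP[ls st] := sI; have sT := inT sI; have /andP[s0 sT'] := sT.
have ->: T3 (box n) (mE s) (profile s) k = E (s * freq2 k) * T3 (box n) (fun=> 1) (fc (u `|t0 + s|)) k.
  exact: T3_twist.
rewrite /forcing -mulrBr Normc.normcM normc_E mul1r.
by apply: h => //; [exact: solution_l2 (lt_Tmax _)|exact: solution_W2].
Qed.

End exact_solution.

(** * The scheme on the Fourier side *)

Section phi_conj.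
Context {R : realType}.
Implicit Types (x s : R).

Lemma cjM (z w : R[i]) : (z * w)^* = z^* * w^*. Proof. exact: rmorphM. Qed.
Lemma cjD (z w : R[i]) : (z + w)^* = z^* + w^*. Proof. exact: rmorphD. Qed.
Lemma cjB (z w : R[i]) : (z - w)^* = z^* - w^*. Proof. exact: rmorphB. Qed.
Lemma cjV (z : R[i]) : (z^-1)^* = (z^*)^-1. Proof. exact: fmorphV. Qed.
Lemma cj_real (x : R) : (x%:C)^* = x%:C. Proof. by rewrite /= oppr0. Qed.
Lemma cj1 : (1 : R[i])^* = 1. Proof. exact: rmorph1. Qed.
Lemma cj_ix x : ('i%C * x%:C)^* = 'i%C * (- x)%:C.
Proof. by apply: complex_eq; rewrite /=; ring. Qed.

Lemma P1N x s : P1 (- x) s = (P1 x s)^*.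
Proof.
rewrite /P1 oppr_eq0; case: (x == 0); first by rewrite cj_real.
by rewrite cjM cjV cjB cj1 cj_ix -EN mulrN.
Qed.

Lemma P2N x s : P2 (- x) s = (P2 x s)^*.
Proof.
rewrite /P2 oppr_eq0; case: (x == 0).
  rewrite cjM cjV expr2 cjM cj_real; congr (_ / _).
  exact: esym (rmorph_nat _ 2).
by rewrite P1N cjM cjV cjB cjM cj_ix cj_real -EN mulrN.
Qed.

Lemma phi2N x : phi2 ('i%C * (- x)%:C) = (phi2 ('i%C * x%:C))^*.
Proof. by have := P2N x 1; rewrite !P2_phi2 expr1n !mul1r. Qed.

End phi_conj.

Section scheme.
Context {R : realType} {d : nat}.
Hypothesis d3 : (d <= 3)%N.
Local Notation P := (@torus_prob R d).
Local Notation I := 'rV[int]_d.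
Local Notation fc := (@fourier R d).
Local Notation fr := (@freq2 R d).
Local Notation c0 := (10 ^+ d : R).
Implicit Types (u v w : torus R d -> R[i]) (k : I) (p : I * I * I).
Let w0 (k : I) : 0 <= W0 k :> R. Proof. exact: W0_ge0. Qed.
Let w2 (k : I) : 0 <= W2 k :> R. Proof. exact: W2_ge0. Qed.
Hint Resolve w0 w2 : core.

Definition symbol3 (al ga : I -> R[i]) p : R[i] := al p.1.1 * al p.1.2 * ga p.2.

Definition mult_of (al : I -> R[i]) v w := l2 P w /\ forall k, fc w k = al k * fc v k.

Lemma mult_hb al v w r X : mult_of al v w -> (forall k, N (al k) <= r) -> hb W2 (fc v) X ->
  hb W2 (fc w) (r ^+ 2 * X).
Proof. by move=> [lw fw] alr vX; apply: hb_ext (hb_mul w2 alr vX) => k; rewrite fw. Qed.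

(** Each nonlinear term of the scheme is a product of three multipliers applied to v, v and its
    conjugate, hence a limit of cubic convolutions with a factorised symbol. *)
Lemma prod_symbol al ga r X e : (forall k, N (al k) <= r) -> (forall k, N (ga k) <= r) -> 0 < e ->
  exists n0, forall n, (n0 <= n)%N -> forall v w w', l2 P v -> hb W2 (fc v) X ->
  mult_of al v w -> mult_of ga (conj_fun v) w' -> forall k,
  N (fc (fun x => w x ^+ 2 * w' x) k - T3 (box n) (symbol3 al ga) (fc v) k) <= e.
Proof.
move=> ar gr e0; have [n0 h] := prod3_approx d3 (r ^+ 2 * X) e0.
exists n0 => n nn v w w' lv vX mw mw' k.
have [lw fw] := mw; have [lw' fw'] := mw'.
have -> : T3 (box n) (symbol3 al ga) (fc v) k = T (box n) (fun=> 1) (fc w) (fc w) (fc w') k.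
  apply: eq_bigr => p _; rewrite !fw fw' fourier_conj_fun// /symbol3; ring.
apply: h => //; [exact: (mult_hb mw ar vX)|exact: (mult_hb mw ar vX)|].
exact: (mult_hb mw' gr (hb2_conj lv vX)).
Qed.

Lemma prod_l2 al ga r X v w w' : (forall k, N (al k) <= r) -> (forall k, N (ga k) <= r) ->
  l2 P v -> hb W2 (fc v) X -> mult_of al v w -> mult_of ga (conj_fun v) w' ->
  l2 P (fun x => w x ^+ 2 * w' x).
Proof.
move=> ar gr lv vX mw mw'; have [lw fw] := mw; have [lw' fw'] := mw'.
have := prod3_l2 d3 lw lw lw' (mult_hb mw ar vX) (mult_hb mw' gr (hb2_conj lv vX)).
by congr (l2 P _); apply/funext => x; rewrite expr2.
Qed.

Lemma fun_laplacian_mult (h : R -> R[i]) r v : l2 P v -> (forall l, N (h l) <= r) ->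
  mult_of (fun k => h (- fr k)) v (fun_laplacian h v).
Proof. by move=> lv hr; have [] := multiplier_bounded lv (fun k => hr (- fr k)). Qed.

Lemma mult_of1 v : l2 P v -> mult_of (fun=> 1) v v.
Proof. by move=> lv; split=> // k; rewrite mul1r. Qed.

Lemma normc_cexp t : N (cexp ('i%C * t%:C)) = 1 :> R.
Proof. by rewrite cexpE normc_E. Qed.

Lemma schroedinger_mult (t : R) v : l2 P v -> mult_of (fun k => E (- (t * fr k))) v (schroedinger t v).
Proof.
move=> lv; have := @fun_laplacian_mult (fun l => cexp ('i%C * (t * l)%:C)) 1 v lv.
have h l : N (cexp ('i%C * (t * l)%:C)) <= 1 by rewrite normc_cexp.
move=> /(_ h) [lw fw]; split=> // k; by rewrite fw cexpE mulrN.
Qed.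

Variables (mu tau : R).
Let zeta (l : R) : R[i] := - 2 * 'i%C * (tau * l)%:C.

Let zetaE (l : R) : zeta l = 'i%C * (tau * (2 * - l))%:C.
Proof. by rewrite /zeta; apply: complex_eq; rewrite /=; ring. Qed.

Let zetaNE (l : R) : - zeta l = 'i%C * (- (tau * (2 * - l)))%:C.
Proof. by rewrite /zeta; apply: complex_eq; rewrite /=; ring. Qed.

Let ga (l : R) : R[i] := (Re (phi1 (zeta l)))%:C - (Re (phi2 (zeta l)))%:C.
Let ga1 (l : R) : R[i] := phi1 (zeta l) - phi2 (zeta l).
Let gb (l : R) : R[i] := cexp ('i%C * (tau * l)%:C) * phi2 (zeta l).
Let gc (l : R) : R[i] := cexp (- 'i%C * (tau * l)%:C) * phi2 (- zeta l).

Let ga_le l : N (ga l) <= 2.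
Proof.
apply: le_trans (normcB _ _) _; rewrite !normc_real zetaE.
have := le_trans (le_Re_normc _) (normc_phi1 (tau * (2 * - l))).
have := le_trans (le_Re_normc _) (normc_phi2 (tau * (2 * - l))).
lra.
Qed.

Let ga1_le l : N (ga1 l) <= 2.
Proof.
apply: le_trans (normcB _ _) _; rewrite zetaE.
by have := normc_phi1 (tau * (2 * - l)); have := normc_phi2 (tau * (2 * - l)); lra.
Qed.

Let gb_le l : N (gb l) <= 2.
Proof.
rewrite /gb Normc.normcM normc_cexp mul1r zetaE.
by have := normc_phi2 (tau * (2 * - l)); lra.
Qed.

Let gcE l : gc l = E (- (tau * l)) * phi2 ('i%C * (- (tau * (2 * - l)))%:C).
Proof. by rewrite /gc zetaNE mulNr -mulrN -raddfN cexpE. Qed.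

Let gc_le l : N (gc l) <= 2.
Proof.
by rewrite gcE Normc.normcM normc_E mul1r; have := normc_phi2 (- (tau * (2 * - l))); lra.
Qed.

Let E_le x : N (E x) <= 2 :> R.
Proof. by rewrite normc_E; lra. Qed.

Let one_le : N (1 : R[i]) <= 2.
Proof. by rewrite Normc.normc1; lra. Qed.

Let pa v x := v x ^+ 2 * fun_laplacian ga (conj_fun v) x.
Let pa1 v x := v x ^+ 2 * fun_laplacian ga1 (conj_fun v) x.
Let pb v x := schroedinger tau v x ^+ 2 * fun_laplacian gb (conj_fun v) x.
Let pc v x := schroedinger (- tau) v x ^+ 2 * fun_laplacian gc (conj_fun v) x.

Definition step_term v x : R[i] := 2 * schroedinger tau (pa v) x + pb v x + schroedinger (2 * tau) (pc v) x.
Definition first_term v x : R[i] := schroedinger tau (pa1 v) x + pb v x.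
Definition quintic v x : R[i] := `|v x| ^+ 4 * v x.

Lemma sLRI2_stepE u v : sLRI2_step mu tau u v =
  fun x => schroedinger (2 * tau) u x - 'i%C * mu%:C * tau%:C * step_term v x.
Proof.
apply/funext => x.
have gen (X a b c m : R[i]) : X - 2 * 'i%C * m * tau%:C * a - 'i%C * m * tau%:C * b - 'i%C * m * tau%:C * c =
  X - 'i%C * m * tau%:C * (2 * a + b + c) by ring.
exact: gen.
Qed.

Lemma sLRI2_firstE u : sLRI2_first mu tau u =
  fun x => schroedinger tau u x - 'i%C * mu%:C * tau%:C * first_term u x
    - mu%:C ^+ 2 * (tau%:C ^+ 2 / 2) * schroedinger tau (quintic u) x.
Proof.
apply/funext => x.
have gen (X a b c m : R[i]) : X - m * a - m * b - c = X - m * (a + b) - c by ring.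
exact: gen.
Qed.

Definition mstep p : R[i] := 2 * (E (- (tau * fr (fsum p))) * symbol3 (fun=> 1) (fun k => ga (- fr k)) p)
  + symbol3 (fun k => E (- (tau * fr k))) (fun k => gb (- fr k)) p
  + E (- (2 * tau * fr (fsum p))) * symbol3 (fun k => E (- (- tau * fr k))) (fun k => gc (- fr k)) p.
Definition mfirst p : R[i] := E (- (tau * fr (fsum p))) * symbol3 (fun=> 1) (fun k => ga1 (- fr k)) p
  + symbol3 (fun k => E (- (tau * fr k))) (fun k => gb (- fr k)) p.

(** Returning to the interaction picture multiplies by E (tau |k|^2), and E (tau y) is that phase
    times the phases of the inputs. The terms with real parts give the part without E (tau y); the
    other two terms of the scheme are conjugate to each other and complete [twoRe]. *)
Lemma mstep_mm p : tau != 0 -> mm tau tau p = tau%:C * E (tau * fr (fsum p)) * mstep p.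
Proof.
move=> tn0; rewrite /mm P1_phi1 P2_phi2 /mstep /symbol3 /ga gcE /gb zetaE cexpE !opprK.
rewrite -[2 * fr p.2]/(phx p) phi2N; set q1 := phi1 _; set q2 := phi2 _.
have -> : (Re q1)%:C = (q1 + q1^*) / 2.
  by apply: (@mulIf _ (2 : R[i])); rewrite ?pnatr_eq0// mulfVK ?pnatr_eq0//; apply: complex_eq; rewrite /=; case: (q1) => a b /=; ring.
have -> : (Re q2)%:C = (q2 + q2^*) / 2.
  by apply: (@mulIf _ (2 : R[i])); rewrite ?pnatr_eq0// mulfVK ?pnatr_eq0//; apply: complex_eq; rewrite /=; case: (q2) => a b /=; ring.
have t0 : tau%:C != 0 :> R[i] by rewrite -[0]/((0:R)%:C) (inj_eq (@complexI _)).
rewrite (_ : (tau^-1)%:C * (tau%:C ^+ 2 * q2 * (E (tau * phy p) - 1)) = tau%:C * (q2 * (E (tau * phy p) - 1))); last first.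
  by rewrite fmorphV; field.
rewrite -mulrDr /twoRe cjM cj_real -mulrDr -mulrA; congr (_ * _).
rewrite cjD cjM cjB cj1.
set e0 := E (tau * fr (fsum p)).
have e1 : E (- (tau * fr (fsum p))) = e0^* by rewrite EN.
have e2 : E (- (2 * tau * fr (fsum p))) = e0^* * e0^*.
  by rewrite -EN -ED; congr E; ring.
have ee : e0 * e0^* = 1 by rewrite -EN mulEN.
set g1 := E (- (tau * fr p.1.1)); set g2 := E (- (tau * fr p.1.2)); set g3 := E (tau * - fr p.2).
have e3 : E (- (- tau * fr p.1.1)) = g1^* by rewrite -EN; congr E; ring.
have e4 : E (- (- tau * fr p.1.2)) = g2^* by rewrite -EN; congr E; ring.
have e5 : E (- (tau * - fr p.2)) = g3^* by rewrite -EN.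
have e6 : E (tau * phy p) = e0 * (g1 * g2 * g3).
  by rewrite -!ED; congr E; rewrite /phy; ring.
rewrite e1 e2 e3 e4 e5 e6 !cjM.
rewrite [RHS](_ : _ = (e0 * e0^* ) * (q1 + q1^* - q2 - q2^* ) + e0 * (g1 * g2 * g3) * q2 +
  (e0 * e0^* ) * e0^* * (g1^* * g2^* * g3^* ) * q2^* ); last by field.
by rewrite ee; ring.
Qed.

Lemma mfirst_mg p : mg tau p = E (tau * fr (fsum p)) * mfirst p.
Proof.
rewrite /mg /mfirst /symbol3 /ga1 /gb zetaE cexpE !opprK.
rewrite -[2 * fr p.2]/(phx p); set q1 := phi1 _; set q2 := phi2 _.
set e0 := E (tau * fr (fsum p)).
have e1 : E (- (tau * fr (fsum p))) = e0^* by rewrite EN.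
have ee : e0 * e0^* = 1 by rewrite -EN mulEN.
set g1 := E (- (tau * fr p.1.1)); set g2 := E (- (tau * fr p.1.2)); set g3 := E (tau * - fr p.2).
have e6 : E (tau * phy p) = e0 * (g1 * g2 * g3).
  by rewrite -!ED; congr E; rewrite /phy; ring.
rewrite e1 e6.
rewrite [RHS](_ : _ = (e0 * e0^* ) * (q1 - q2) + e0 * (g1 * g2 * g3) * q2); last by ring.
by rewrite ee; ring.
Qed.

Lemma normc_comb (e1 e2 s1 s2 s3 : R[i]) (a1 a2 a3 : R) : N s1 <= a1 -> N s2 <= a2 -> N s3 <= a3 ->
  N e1 = 1 -> N e2 = 1 -> N (2 * (e1 * s1) + s2 + e2 * s3) <= 2 * a1 + a2 + a3.
Proof.
move=> h1 h2 h3 n1 n2; have n22 : N (2 : R[i]) = 2.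
  by rewrite (_ : 2 = 2%:C) ?normc_real ?ger0_norm// rmorph_nat.
apply: le_trans (complex.le_normcD _ _) _; apply: le_trans (lerD (complex.le_normcD _ _) (lexx _)) _.
rewrite [N (2 * _)]Normc.normcM [N (e1 * _)]Normc.normcM [N (e2 * _)]Normc.normcM n1 n2 n22 !mul1r.
lra.
Qed.

(** A crude value: the three terms contribute at most 2 * 2 + 2 + 2. *)
Lemma normc_mstep p : N (mstep p) <= 30.
Proof.
have h al be : (forall k, N (al k) <= 1) -> (forall k, N (be k) <= 2) -> N (symbol3 al be p) <= 2.
  move=> ha hb; rewrite /symbol3 !Normc.normcM -[leRHS]mul1r.
  by apply: ler_pM; rewrite ?mulr_ge0 ?normc_ge0// mulr_ile1 ?normc_ge0.
have hE x : N (E x) <= 1 :> R by rewrite normc_E.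
have h1 : N ((1 : R[i])) <= 1 by rewrite Normc.normc1.
have ha := h (fun=> 1) (fun k => ga (- fr k)) (fun=> h1) (fun k => ga_le _).
have hb := h _ (fun k => gb (- fr k)) (fun k => hE (- (tau * fr k))) (fun k => gb_le _).
have hc := h _ (fun k => gc (- fr k)) (fun k => hE (- (- tau * fr k))) (fun k => gc_le _).
by apply: le_trans (normc_comb ha hb hc (normc_E _) (normc_E _)) _; lra.
Qed.

Lemma step_l2 X v : l2 P v -> hb W2 (fc v) X -> l2 P (step_term v).
Proof.
move=> lv vX; have lc := l2_conj_fun lv.
have la : l2 P (pa v).
  exact: (prod_l2 (fun=> one_le) (fun k => ga_le (- fr k)) lv vX (mult_of1 lv) (fun_laplacian_mult lc ga_le)).
have lb : l2 P (pb v).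
  exact: (prod_l2 (fun k => E_le _) (fun k => gb_le (- fr k)) lv vX (schroedinger_mult tau lv) (fun_laplacian_mult lc gb_le)).
have lc' : l2 P (pc v).
  exact: (prod_l2 (fun k => E_le _) (fun k => gc_le (- fr k)) lv vX (schroedinger_mult (- tau) lv) (fun_laplacian_mult lc gc_le)).
have [lsa _] := schroedinger_mult tau la; have [lsc _] := schroedinger_mult (2 * tau) lc'.
exact: (l2D (l2D (l2Z 2 lsa) lb) lsc).
Qed.

Lemma T3_out K (phi : I -> R[i]) m (a : I -> R[i]) k :
  phi k * T3 K m a k = T3 K (fun p => phi (fsum p) * m p) a k.
Proof. by rewrite /T3 /T mulr_sumr; apply: eq_bigr => p /eqP <-; rewrite mulrA. Qed.

Lemma fourier_comb3 (f g h : torus R d -> R[i]) k : l2 P f -> l2 P g -> l2 P h ->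
  fc (fun x => 2 * f x + g x + h x) k = 2 * fc f k + fc g k + fc h k.
Proof.
move=> lf lg lh; have l2f : l2 P (fun x => 2 * f x) by exact: l2Z.
rewrite fourierD; [|by apply: l2_cible; exact: l2D|exact: l2_cible].
by rewrite fourierD ?fourierZ //; exact: l2_cible.
Qed.

Lemma step_approx X e : 0 < e -> exists n0, forall n, (n0 <= n)%N -> forall v,
  l2 P v -> hb W2 (fc v) X -> forall k, N (fc (step_term v) k - T3 (box n) mstep (fc v) k) <= e.
Proof.
move=> e0; have e40 : 0 < e / 4 by rewrite divr_gt0.
have e4 : 2 * (e / 4) + e / 4 + e / 4 <= e by lra.
have [na ha] := @prod_symbol (fun=> 1) (fun k => ga (- fr k)) 2 X _ (fun=> one_le) (fun k => ga_le _) e40.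
have [nb hb] := @prod_symbol _ (fun k => gb (- fr k)) 2 X _ (fun k => E_le (- (tau * fr k))) (fun k => gb_le _) e40.
have [nc hc] := @prod_symbol _ (fun k => gc (- fr k)) 2 X _ (fun k => E_le (- (- tau * fr k))) (fun k => gc_le _) e40.
exists (maxn na (maxn nb nc)) => n; rewrite !geq_max => /and3P[nna nnb nnc] v lv vX k.
have lc := l2_conj_fun lv.
have la : l2 P (pa v).
  exact: (prod_l2 (fun=> one_le) (fun k => ga_le (- fr k)) lv vX (mult_of1 lv) (fun_laplacian_mult lc ga_le)).
have lb : l2 P (pb v).
  exact: (prod_l2 (fun k => E_le _) (fun k => gb_le (- fr k)) lv vX (schroedinger_mult tau lv) (fun_laplacian_mult lc gb_le)).
have lc' : l2 P (pc v).
  exact: (prod_l2 (fun k => E_le _) (fun k => gc_le (- fr k)) lv vX (schroedinger_mult (- tau) lv) (fun_laplacian_mult lc gc_le)).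
have [lsa fsa] := schroedinger_mult tau la; have [lsc fsc] := schroedinger_mult (2 * tau) lc'.
have fE : fc (step_term v) k = 2 * (E (- (tau * fr k)) * fc (pa v) k) + fc (pb v) k + E (- (2 * tau * fr k)) * fc (pc v) k.
  by rewrite -fsa -fsc; exact: (fourier_comb3 k lsa lb lsc).
rewrite fE.
have -> : T3 (box n) mstep (fc v) k =
  2 * (E (- (tau * fr k)) * T3 (box n) (symbol3 (fun=> 1) (fun k => ga (- fr k))) (fc v) k)
  + T3 (box n) (symbol3 (fun k => E (- (tau * fr k))) (fun k => gb (- fr k))) (fc v) k
  + E (- (2 * tau * fr k)) * T3 (box n) (symbol3 (fun k => E (- (- tau * fr k))) (fun k => gc (- fr k))) (fc v) k.
  by rewrite (T3_out _ (fun k => E (- (tau * fr k)))) (T3_out _ (fun k => E (- (2 * tau * fr k)))) T3Zm !T3Dm.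
set xa := fc (pa v) k; set xb := fc (pb v) k; set xc := fc (pc v) k.
have := ha n nna v v _ lv vX (mult_of1 lv) (fun_laplacian_mult lc ga_le) k; rewrite -/(pa v) -/xa.
have := hb n nnb v _ _ lv vX (schroedinger_mult tau lv) (fun_laplacian_mult lc gb_le) k; rewrite -/(pb v) -/xb.
have := hc n nnc v _ _ lv vX (schroedinger_mult (- tau) lv) (fun_laplacian_mult lc gc_le) k; rewrite -/(pc v) -/xc.
set yc := T3 _ _ _ _; set yb := T3 _ _ _ _; set ya := T3 _ _ _ _ => h3 h2 h1.
have gen (q r : R[i]) : 2 * (q * xa) + xb + r * xc - (2 * (q * ya) + yb + r * yc) =
  2 * (q * (xa - ya)) + (xb - yb) + r * (xc - yc).
  by move: xa xb xc ya yb yc {h1 h2 h3} => ? ? ? ? ? ?; ring.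
rewrite gen.
exact: le_trans (normc_comb h1 h2 h3 (normc_E _) (normc_E _)) e4.
Qed.

(** The Lipschitz bound holds for truncated convolutions by telescoping and passes to the limit, in
    whichever norm [Tel] is bounded. *)
Lemma step_lip (W : I -> R) (c A D : R) v w : (forall k, 0 <= W k) ->
  (forall (K : seq I) (u : I -> R[i]), uniq K -> hb W u D -> hb W (Tel K mstep u (fc v) (fc w)) (c * D)) ->
  l2 P v -> l2 P w -> hb W2 (fc v) A -> hb W2 (fc w) A ->
  hb W (fun k => fc v k - fc w k) D ->
  hb W (fun k => fc (step_term v) k - fc (step_term w) k) (c * D).
Proof.
move=> Wp hT lv lw vA wA vwD; apply: hb_approx => // e e0.
have e2 : 0 < e / 2 by rewrite divr_gt0.
have [n0 h] := step_approx A e2.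
exists (fun k => T3 (box n0) mstep (fc v) k - T3 (box n0) mstep (fc w) k).
  by apply: hb_ext (hT _ _ (box_uniq n0) vwD) => k; rewrite -T3_sub.
have gen (a b a' b' : R[i]) : a - b - (a' - b') = (a - a') - (b - b') by ring.
move=> k; rewrite gen.
apply: le_trans (normcB _ _) _.
by rewrite [leRHS]splitr lerD// h.
Qed.

Definition Klip A : R := 972 * c0 ^+ 2 * 30 ^+ 2 * A ^+ 2.

Lemma step_lip0 A D v w : l2 P v -> l2 P w -> hb W2 (fc v) A -> hb W2 (fc w) A ->
  hb W0 (fun k => fc v k - fc w k) D ->
  hb W0 (fun k => fc (step_term v) k - fc (step_term w) k) (Klip A * D).
Proof.
move=> lv lw vA wA; apply: (step_lip w0 _ lv lw vA wA) => K u uK uD.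
exact: (Tel_L2 d3 uK normc_mstep uD vA wA).
Qed.

Lemma step_lip2 A D v w : l2 P v -> l2 P w -> hb W2 (fc v) A -> hb W2 (fc w) A ->
  hb W2 (fun k => fc v k - fc w k) D ->
  hb W2 (fun k => fc (step_term v) k - fc (step_term w) k) (Klip A * D).
Proof.
move=> lv lw vA wA; apply: (step_lip w2 _ lv lw vA wA) => K u uK uD.
exact: (Tel_H2 d3 uK normc_mstep uD vA wA).
Qed.

Lemma step_fourier A u v : l2 P u -> l2 P v -> hb W2 (fc v) A ->
  l2 P (sLRI2_step mu tau u v) /\ forall k, fc (sLRI2_step mu tau u v) k =
    E (- (2 * tau * fr k)) * fc u k - 'i%C * mu%:C * tau%:C * fc (step_term v) k.
Proof.
move=> lu lv vA; have ls := step_l2 lv vA; have [lsu fsu] := schroedinger_mult (2 * tau) lu.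
have lz : l2 P (fun x => 'i%C * mu%:C * tau%:C * step_term v x) by exact: l2Z.
rewrite sLRI2_stepE; split; first exact: l2B.
move=> k; rewrite -fsu -(fourierZ _ _ (l2_cible ls)); exact: (fourierB k (l2_cible lsu) (l2_cible lz)).
Qed.

Lemma step_forcing A u e : 0 < tau -> l2 P u -> hb W2 (fc u) A -> 0 < e ->
  exists n0, forall n k, (n0 <= n)%N ->
  N (tau%:C * E (tau * fr k) * fc (step_term u) k - T3 (box n) (mm tau tau) (fc u) k) <= e.
Proof.
move=> t0 lu uA e0; have et : 0 < e / tau by rewrite divr_gt0.
have [n0 h] := step_approx A et.
exists n0 => n k nn.
have -> : T3 (box n) (mm tau tau) (fc u) k = tau%:C * E (tau * fr k) * T3 (box n) mstep (fc u) k.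
  rewrite -mulrA (T3_out _ (fun k => E (tau * fr k))) T3Zm.
  by congr (T3 _ _ _ _); apply/funext => p; rewrite mstep_mm ?gt_eqF// mulrA.
rewrite -mulrBr 2!Normc.normcM normc_E mulr1 normc_real gtr0_norm// mulrC -ler_pdivlMr//.
exact: h.
Qed.

Lemma first_l2 X v : l2 P v -> hb W2 (fc v) X -> l2 P (first_term v).
Proof.
move=> lv vX; have lc := l2_conj_fun lv.
have la : l2 P (pa1 v).
  exact: (prod_l2 (fun=> one_le) (fun k => ga1_le (- fr k)) lv vX (mult_of1 lv) (fun_laplacian_mult lc ga1_le)).
have lb : l2 P (pb v).
  exact: (prod_l2 (fun k => E_le _) (fun k => gb_le (- fr k)) lv vX (schroedinger_mult tau lv) (fun_laplacian_mult lc gb_le)).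
have [lsa _] := schroedinger_mult tau la; exact: (l2D lsa lb).
Qed.

Lemma first_forcing A v e : 0 < tau -> l2 P v -> hb W2 (fc v) A -> 0 < e ->
  exists n0, forall n k, (n0 <= n)%N ->
  N (tau%:C * E (tau * fr k) * fc (first_term v) k - T3 (box n) (fun p => tau%:C * mg tau p) (fc v) k) <= e.
Proof.
move=> t0 lv vX e0; have e40 : 0 < e / tau / 2 by rewrite !divr_gt0.
have [na ha] := @prod_symbol (fun=> 1) (fun k => ga1 (- fr k)) 2 A _ (fun=> one_le) (fun k => ga1_le _) e40.
have [nb hb] := @prod_symbol _ (fun k => gb (- fr k)) 2 A _ (fun k => E_le (- (tau * fr k))) (fun k => gb_le _) e40.
exists (maxn na nb) => n k; rewrite geq_max => /andP[nna nnb].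
have lc := l2_conj_fun lv.
have la : l2 P (pa1 v).
  exact: (prod_l2 (fun=> one_le) (fun k => ga1_le (- fr k)) lv vX (mult_of1 lv) (fun_laplacian_mult lc ga1_le)).
have lb : l2 P (pb v).
  exact: (prod_l2 (fun k => E_le _) (fun k => gb_le (- fr k)) lv vX (schroedinger_mult tau lv) (fun_laplacian_mult lc gb_le)).
have [lsa fsa] := schroedinger_mult tau la.
have fE : fc (first_term v) k = E (- (tau * fr k)) * fc (pa1 v) k + fc (pb v) k.
  by rewrite -fsa; exact: (fourierD k (l2_cible lsa) (l2_cible lb)).
have TE : T3 (box n) (fun p => tau%:C * mg tau p) (fc v) k = tau%:C * E (tau * fr k) * (
  E (- (tau * fr k)) * T3 (box n) (symbol3 (fun=> 1) (fun k => ga1 (- fr k))) (fc v) k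
  + T3 (box n) (symbol3 (fun k => E (- (tau * fr k))) (fun k => gb (- fr k))) (fc v) k).
  rewrite (T3_out _ (fun k => E (- (tau * fr k)))) T3Dm -mulrA (T3_out _ (fun k => E (tau * fr k))) T3Zm.
  by congr (T3 _ _ _ _); apply/funext => p; rewrite mfirst_mg /mfirst.
rewrite fE TE.
set xa := fc (pa1 v) k; set xb := fc (pb v) k.
have := ha n nna v v _ lv vX (mult_of1 lv) (fun_laplacian_mult lc ga1_le) k; rewrite -/(pa1 v) -/xa.
have := hb n nnb v _ _ lv vX (schroedinger_mult tau lv) (fun_laplacian_mult lc gb_le) k; rewrite -/(pb v) -/xb.
set yb := T3 _ _ _ _; set ya := T3 _ _ _ _ => h2 h1.
have gen (t q r : R[i]) : t * r * (q * xa + xb) - t * r * (q * ya + yb) = t * r * (q * (xa - ya) + (xb - yb)).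
  by move: xa xb ya yb {h1 h2} => ? ? ? ?; ring.
rewrite gen.
rewrite 2!Normc.normcM normc_E mulr1 normc_real gtr0_norm// mulrC -ler_pdivlMr//.
apply: le_trans (complex.le_normcD _ _) _; rewrite [N (E _ * _)]Normc.normcM normc_E mul1r.
by rewrite [leRHS]splitr lerD.
Qed.

Lemma quintic_hb A v : l2 P v -> hb W2 (fc v) A ->
  l2 P (quintic v) /\ hb W2 (fc (quintic v)) (81 * c0 ^+ 2 * (A * A * (81 * c0 ^+ 2 * (A * A * A)))).
Proof.
move=> lv vA; have lc := cubic_l2 d3 lv vA; have cA := cubic_hb2 d3 lv vA.
have lcv := l2_conj_fun lv; have cvA := hb2_conj lv vA.
have -> : quintic v = fun x => v x * conj_fun v x * cubic v x.
  apply/funext => x; rewrite /quintic cubicE (_ : 4 = 2 * 2)%N// exprM sqr_normc_conj /conj_fun.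
  by move: (v x) (conjc _) => a b; ring.
split; last exact: (prod3_hb2 d3 lv lcv lc vA cvA cA).
pose X := A + 81 * c0 ^+ 2 * (A * A * A).
have A0 := hb_ge0 vA; have B0 := hb_ge0 cA.
by apply: (prod3_l2 d3 lv lcv lc (X := X)); [apply: hb_le cvA _|apply: hb_le cA _]; rewrite /X ?lerDl ?lerDr.
Qed.

Lemma first_fourier A u : l2 P u -> hb W2 (fc u) A ->
  l2 P (sLRI2_first mu tau u) /\ forall k, fc (sLRI2_first mu tau u) k =
    E (- (tau * fr k)) * fc u k - 'i%C * mu%:C * tau%:C * fc (first_term u) k
    - mu%:C ^+ 2 * (tau%:C ^+ 2 / 2) * (E (- (tau * fr k)) * fc (quintic u) k).
Proof.
move=> lu uA; have lf := first_l2 lu uA; have [lsu fsu] := schroedinger_mult tau lu.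
have [lq _] := quintic_hb lu uA; have [lsq fsq] := schroedinger_mult tau lq.
have lz : l2 P (fun x => 'i%C * mu%:C * tau%:C * first_term u x) by exact: l2Z.
have lz' : l2 P (fun x => mu%:C ^+ 2 * (tau%:C ^+ 2 / 2) * schroedinger tau (quintic u) x) by exact: l2Z.
have lB := l2B lsu lz.
rewrite sLRI2_firstE; split; first exact: l2B.
move=> k; rewrite -fsu -fsq -(fourierZ _ _ (l2_cible lf)) -(fourierZ _ _ (l2_cible lsq)).
by rewrite -(fourierB k (l2_cible lsu) (l2_cible lz)); exact: (fourierB k (l2_cible lB) (l2_cible lz')).
Qed.

End scheme.

(** * Global error *)

Section global.
Context {R : realType} {d : nat}.
Hypothesis d3 : (d <= 3)%N.
Local Notation P := (@torus_prob R d).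
Local Notation I := 'rV[int]_d.
Local Notation fc := (@fourier R d).
Local Notation fr := (@freq2 R d).
Local Notation c0 := (10 ^+ d : R).
Implicit Types (k : I) (W : I -> R).
Let w0 (k : I) : 0 <= W0 k :> R. Proof. exact: W0_ge0. Qed.
Let w2 (k : I) : 0 <= W2 k :> R. Proof. exact: W2_ge0. Qed.
Hint Resolve w0 w2 : core.

(** The triangle inequality for squared norms; with t = tau the first term grows by 1 + tau per
    step, which stays bounded over T / tau steps. *)
Lemma hb_young W (x y : I -> R[i]) a b t : (forall k, 0 <= W k) -> 0 < t -> hb W x a -> hb W y b ->
  hb W (fun k => x k + y k) ((1 + t) * a + (1 + t^-1) * b).
Proof.
move=> Wp t0 xa yb K uK.
have ti : 0 < t^-1 by rewrite invr_gt0.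
apply: (@le_trans _ _ ((1 + t) * \sum_(k <- K) W k * N (x k) ^+ 2 + (1 + t^-1) * \sum_(k <- K) W k * N (y k) ^+ 2)).
  rewrite !mulr_sumr -big_split/=; apply: ler_sum => k _.
  rewrite (_ : _ + _ = W k * ((1 + t) * N (x k) ^+ 2 + (1 + t^-1) * N (y k) ^+ 2)); last by ring.
  apply: ler_wpM2l => //; have h := complex.le_normcD (x k) (y k).
  apply: (@le_trans _ _ ((N (x k) + N (y k)) ^+ 2)).
    by rewrite lerXn2r ?nnegrE ?addr_ge0 ?normc_ge0.
  move: (N (x k)) (N (y k)) => p q.
  rewrite -subr_ge0 (_ : _ - _ = t^-1 * (t * p - q) ^+ 2); last by field; rewrite gt_eqF.
  by rewrite mulr_ge0 ?sqr_ge0// ltW.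
by apply: lerD; [apply: ler_wpM2l (xa K uK)|apply: ler_wpM2l (yb K uK)]; rewrite addr_ge0// ltW.
Qed.

Lemma hb_unimodular W (m x : I -> R[i]) a : (forall k, 0 <= W k) -> (forall k, N (m k) <= 1) ->
  hb W x a -> hb W (fun k => m k * x k) a.
Proof. by move=> Wp m1 xa; have := hb_mul Wp m1 xa; rewrite expr1n mul1r. Qed.

(** The free flow is unimodular, so growth comes from the other terms. In [q], one tau pays for
    Young's factor, another for the local error, whose square is tau^2 below the envelope, and 4
    mu^2 c tau for the nonlinear term. *)
Lemma recursion W (x0 x2 g l : I -> R[i]) (mu tau X c loc : R) n :
  (forall k, 0 <= W k) -> 0 < tau -> tau <= 1 -> 0 <= c -> 0 <= X ->
  let q := 1 + (2 + 4 * mu ^+ 2 * c) * tau in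
  hb W x0 (X * q ^+ n) -> hb W g (c * (X * q ^+ n.+1)) -> hb W l loc -> 4 * loc <= tau ^+ 2 * X ->
  (forall k, x2 k = E (- (2 * tau * fr k)) * x0 k
     - ('i%C * mu%:C * tau%:C * g k + E (- (tau * fr k)) * l k)) ->
  hb W x2 (X * q ^+ n.+2).
Proof.
move=> Wp t0 t1 c_ge0 X0 q h0 hg hl loct e2.
have E1 (t : R) : N (E t) <= 1 by rewrite normc_E.
have Nm : N ('i%C * mu%:C * tau%:C : R[i]) <= `|mu| * tau.
  by rewrite !Normc.normcM normci mul1r !normc_real (gtr0_norm t0).
have h1 := hb_unimodular Wp (fun k => E1 (- (2 * tau * fr k))) h0.
have h2 := hb_opp (hb_add Wp (hb_scale Wp Nm hg) (hb_unimodular Wp (fun k => E1 (- (tau * fr k))) hl)).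
apply: hb_ext (hb_le (hb_young Wp t0 h1 h2) _) => [k|]; first by rewrite e2.
rewrite exprMn real_normK ?num_real//.
have a0 : 0 <= 4 * mu ^+ 2 * c by rewrite mulr_ge0// mulr_ge0// sqr_ge0.
have q1 : 1 <= q by rewrite lerDl mulr_ge0 ?ltW// ltr_wpDr.
have Q1 : 1 <= q ^+ n by rewrite exprn_ege1.
rewrite !exprS; set Q := q ^+ n in Q1 *.
have lt : (1 + tau^-1) * loc <= tau * X / 2.
  rewrite -(@ler_pM2l _ (4 * tau)) ?mulr_gt0//.
  rewrite [leLHS](_ : _ = (1 + tau) * (4 * loc)); last by field; rewrite gt_eqF.
  rewrite [leRHS](_ : _ = 2 * (tau ^+ 2 * X)); last by field.
  have l0 : 0 <= 4 * loc by rewrite mulr_ge0// (hb_ge0 hl).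
  by apply: ler_pM => //; lra.
have gt : (1 + tau^-1) * (2 * (mu ^+ 2 * tau ^+ 2 * (c * (X * (q * Q))))) <= 4 * mu ^+ 2 * c * tau * (X * (q * Q)).
  have Y0 : 0 <= mu ^+ 2 * c * tau * (X * (q * Q)).
    apply: mulr_ge0; first by apply: mulr_ge0; [apply: mulr_ge0 => //; exact: sqr_ge0|exact: ltW].
    by apply: mulr_ge0 => //; apply: mulr_ge0; lra.
  rewrite [leLHS](_ : _ = 2 * (1 + tau) * (mu ^+ 2 * c * tau * (X * (q * Q)))); last by field; rewrite gt_eqF.
  rewrite [leRHS](_ : _ = 4 * (mu ^+ 2 * c * tau * (X * (q * Q)))); last by ring.
  by apply: ler_wpM2r => //; lra.
have XQ : X * Q <= X * (q * Q) by apply: ler_wpM2l => //; rewrite ler_peMl//; lra.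
have XQ1 : X <= X * (q * Q) by rewrite ler_peMr// mulr_ege1.
rewrite [leRHS](_ : _ = X * (q * Q) * (1 + 2 * tau) + 4 * mu ^+ 2 * c * tau * (X * (q * Q))); last by rewrite {1}/q; ring.
have := ler_wpM2l (ltW t0) XQ; have := ler_wpM2l (ltW t0) XQ1.
move: (X * (q * Q)) XQ XQ1 gt lt => Y *; lra.
Qed.

(** In the constants below, 2 (A + 1) in [Krate] is the squared H^2 bound of a numerical solution at
    distance at most 1 from the exact one. The 4 comes from the hypothesis of [recursion], the 2 and
    the quintic part from the first step; absolute values spare any sign condition. *)
Definition Kquintic (A : R) : R := 81 * c0 ^+ 2 * (A * A * (81 * c0 ^+ 2 * (A * A * A))).
Definition Krate (mu A : R) : R := 2 + 4 * mu ^+ 2 * @Klip R d (2 * (A + 1)).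
Definition KX2 (mu A : R) : R := 4 * `|@KH2 R d mu A| + 2 * `|@KH2_first R d mu A| + mu ^+ 4 * `|Kquintic A|.
Definition KX0 (mu A : R) : R := 4 * `|@KL2 R d mu A| + 2 * `|@KL2_first R d mu A| + mu ^+ 4 * `|Kquintic A|.

Lemma KX2_ge0 mu A : 0 <= KX2 mu A.
Proof.
apply: addr_ge0 (addr_ge0 (mulr_ge0 (ler0n _ 4) (normr_ge0 _)) (mulr_ge0 (ler0n _ 2) (normr_ge0 _))) (mulr_ge0 _ (normr_ge0 _)).
exact: exprn_even_ge0.
Qed.

Lemma KX0_ge0 mu A : 0 <= KX0 mu A.
Proof.
apply: addr_ge0 (addr_ge0 (mulr_ge0 (ler0n _ 4) (normr_ge0 _)) (mulr_ge0 (ler0n _ 2) (normr_ge0 _))) (mulr_ge0 _ (normr_ge0 _)).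
exact: exprn_even_ge0.
Qed.

Lemma Klip_ge0 A : 0 <= @Klip R d A.
Proof.
apply: mulr_ge0 (sqr_ge0 A); apply: mulr_ge0 (sqr_ge0 _); apply: mulr_ge0 (sqr_ge0 _); exact: ler0n.
Qed.

Lemma first_const (h f k m r s t : R) : 0 <= s -> 0 <= t -> 0 <= m -> t <= r -> s <= r ->
  2 * (f * s) + m * t * `|k| <= (4 * `|h| + 2 * `|f| + m * `|k|) * r.
Proof.
move=> s0 t_ge0 m0 tr sr; have r0 := le_trans s0 sr.
have h0 := mulr_ge0 (normr_ge0 h) r0; have k0 := mulr_ge0 m0 (normr_ge0 k).
have f1 := ler_wpM2r s0 (ler_norm f); have f2 := ler_wpM2l (normr_ge0 f) sr.
have k1 := ler_wpM2l k0 tr.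
rewrite !mulrDl (mulrAC m t) -!mulrA; rewrite -!mulrA in k1; lra.
Qed.

Lemma step_const (h f k m s t : R) : 0 <= t -> 0 <= s -> 0 <= m ->
  4 * (h * (t * s)) <= t * ((4 * `|h| + 2 * `|f| + m * `|k|) * s).
Proof.
move=> t_ge0 s0 m0; have ts := mulr_ge0 t_ge0 s0.
have h1 := ler_wpM2r ts (ler_norm h); have f1 := mulr_ge0 (normr_ge0 f) ts.
have k1 := mulr_ge0 (mulr_ge0 m0 (normr_ge0 k)) ts.
rewrite [leRHS](_ : _ = 4 * (`|h| * (t * s)) + 2 * (`|f| * (t * s)) + m * `|k| * (t * s)); last by ring.
lra.
Qed.

Variables (mu T : R) (u0 : torus R d -> R[i]) (Tmax : \bar R) (u : R -> torus R d -> R[i]).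
Hypotheses (T0 : 0 < T) (sol : nls_solution mu u0 Tmax u) (TTmax : (T%:E < Tmax)%E).
Hypothesis Moo : (sup_Hnorm (2 + d%:R / 4) T u < +oo)%E.
Let A := fine (sup_Hnorm (2 + d%:R / 4) T u) ^+ 2.
Variable tau : R.
Hypotheses (t0 : 0 < tau) (t1 : tau <= 1).
Let S n := sLRI2 mu tau u0 n.
Let t_ n := n%:R * tau.
Let err n k := fc (S n) k - fc (u (t_ n)) k.

Let t_in n : t_ n <= T -> 0 <= t_ n <= T.
Proof. by move=> tT; rewrite tT mulr_ge0// ltW. Qed.

Let u_l2 n : t_ n <= T -> l2 P (u (t_ n)).
Proof.
move=> tT; apply: (solution_l2 sol); first by rewrite mulr_ge0// ltW.
by apply: le_lt_trans TTmax; rewrite lee_fin.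
Qed.

Let u_W2 n : t_ n <= T -> hb W2 (fc (u (t_ n))) A.
Proof. by move=> tT; apply: (solution_W2 T0 Moo); exact: t_in. Qed.

(** [local_error] centred at t_(n+1), with the twist undone by multiplying by E (- tau |k|^2). *)
Let step_local n : t_ n.+2 <= T ->
  exists2 l : I -> R[i],
    hb W0 l (@KL2 R d mu A * tau ^+ 6) /\ hb W2 l (@KH2 R d mu A * (tau * tau `^ (d%:R / 4)) ^+ 2)
  & forall k, fc (u (t_ n.+2)) k = E (- (2 * tau * fr k)) * fc (u (t_ n)) k
     - 'i%C * mu%:C * tau%:C * fc (step_term tau (u (t_ n.+1))) k + E (- (tau * fr k)) * l k.
Proof.
move=> tT.
have tE1 : t_ n.+1 = t_ n + tau by rewrite /t_ -natr1; ring.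
have tE2 : t_ n.+2 = t_ n + tau + tau by rewrite /t_ -natr1 -natr1; ring.
have tn0 : 0 <= t_ n by rewrite mulr_ge0// ltW.
have lo0 : - tau <= 0 by rewrite oppr_le0 ltW.
have t0lo : 0 <= t_ n.+1 + - tau by rewrite tE1 addrK.
have t0tau : t_ n.+1 + tau <= T by rewrite tE1 -tE2.
have tT1 : t_ n.+1 <= T by rewrite (le_trans _ t0tau)// lerDl ltW.
pose V := profile u (t_ n.+1); pose Xi := forcing u (t_ n.+1).
pose Gam k := tau%:C * E (tau * fr k) * fc (step_term tau (u (t_ n.+1))) k.
have V0 : V 0 = fc (u (t_ n.+1)).
  by apply/funext => k; rewrite /V /profile mul0r E0 mul1r addr0 ger0_norm// mulr_ge0// ltW.
have Vt k : V tau k = E (tau * fr k) * fc (u (t_ n.+2)) k.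
  by rewrite /V /profile tE1 -tE2 ger0_norm// mulr_ge0// ltW.
have Vmt k : V (- tau) k = E (- tau * fr k) * fc (u (t_ n)) k.
  by rewrite /V /profile tE1 addrK ger0_norm.
have [|h0 h2] := local_error d3 (Xi := Xi) (V := V) (Gam := Gam) (A := A) (mu := mu) t0 t1 lo0 (lexx _)
   (profile_Wr T0 Moo t0lo t0tau) (profile_cont d3 T0 sol TTmax Moo t0lo t0tau)
   (profile_der d3 T0 sol TTmax Moo t0lo t0tau) (forcing_approx d3 T0 sol TTmax Moo t0lo t0tau) (erefl _).
  move=> e e0; rewrite V0; exact: (step_forcing d3 t0 (u_l2 tT1) (u_W2 tT1) e0).
exists (fun k => V tau k - V (- tau) k - - ('i%C * mu%:C) * Gam k); [exact: conj h0 h2|move=> k].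
rewrite Vt Vmt /Gam.
have e1 : E (- tau * fr k) = (E (tau * fr k))^* by rewrite -EN mulNr.
have e2 : E (- (tau * fr k)) = (E (tau * fr k))^* by rewrite -EN.
have e3 : E (- (2 * tau * fr k)) = (E (tau * fr k))^* * (E (tau * fr k))^*.
  by rewrite -!EN -ED; congr E; ring.
have ee : (E (tau * fr k))^* * E (tau * fr k) = 1 by rewrite mulrC -EN mulEN.
rewrite e1 e2 e3.
move: (fc (u (t_ n.+2)) k) (fc (u (t_ n)) k) (fc (step_term _ _) k) (E (tau * fr k)) (conjc _) ee => x y w a b ee.
rewrite [RHS](_ : _ = (b * a) * x + 'i%C * mu%:C * tau%:C * (b * a - 1) * w); last by ring.
by rewrite ee; ring.
Qed.

Let first_local : t_ 1 <= T ->
  exists2 l : I -> R[i],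
    hb W0 l (@KL2_first R d mu A * tau ^+ 4) /\ hb W2 l (@KH2_first R d mu A * tau ^+ 2)
  & forall k, fc (u (t_ 1)) k = E (- (tau * fr k)) * fc u0 k
     - 'i%C * mu%:C * tau%:C * fc (first_term tau u0) k + E (- (tau * fr k)) * l k.
Proof.
move=> tT.
have tE1 : t_ 1 = tau by rewrite /t_ mul1r.
have t00 : t_ 0 = 0 by rewrite /t_ mul0r.
have t0T : t_ 0 <= T by rewrite t00 ltW.
have u00 : u (t_ 0) = u0 by rewrite t00; case: sol.
have lu : l2 P u0 by rewrite -u00; exact: u_l2.
have uA : hb W2 (fc u0) A by rewrite -u00; exact: u_W2.
have t0lo : 0 <= (0 : R) + 0 by rewrite addr0.
have t0tau : 0 + tau <= T by rewrite add0r -tE1.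
have lo : - tau <= 0 by rewrite oppr_le0 ltW.
pose V := profile u 0; pose Xi := forcing u 0.
pose Gam k := tau%:C * E (tau * fr k) * fc (first_term tau u0) k.
have V0 : V 0 = fc u0.
  by apply/funext => k; rewrite /V /profile mul0r E0 mul1r addr0 normr0 -t00 u00.
have Vt k : V tau k = E (tau * fr k) * fc (u (t_ 1)) k.
  by rewrite /V /profile tE1 add0r ger0_norm// ltW.
have [|h0 h2] := local_error_first d3 (Xi := Xi) (V := V) (Gam := Gam) (A := A) (mu := mu) t0 (lexx _) lo
   (profile_Wr T0 Moo t0lo t0tau) (profile_cont d3 T0 sol TTmax Moo t0lo t0tau)
   (profile_der d3 T0 sol TTmax Moo t0lo t0tau) (forcing_approx d3 T0 sol TTmax Moo t0lo t0tau).
  move=> e e0; rewrite V0; exact: (first_forcing d3 t0 lu uA e0).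
exists (fun k => V tau k - V 0 k - - ('i%C * mu%:C) * Gam k); [exact: conj h0 h2|move=> k].
rewrite Vt V0 /Gam.
have e2 : E (- (tau * fr k)) = (E (tau * fr k))^* by rewrite -EN.
have ee : (E (tau * fr k))^* * E (tau * fr k) = 1 by rewrite mulrC -EN mulEN.
rewrite e2.
move: (fc (u (t_ 1)) k) (fc u0 k) (fc (first_term _ _) k) (E (tau * fr k)) (conjc _) ee => x y w a b ee.
rewrite [RHS](_ : _ = (b * a) * x + 'i%C * mu%:C * tau%:C * (b * a - 1) * w); last by ring.
by rewrite ee; ring.
Qed.

Let q := 1 + Krate mu A * tau.
Let X2 := KX2 mu A * (tau `^ (d%:R / 4)) ^+ 2.
Let X0 := KX0 mu A * tau ^+ 4.

Let A_ge0 : 0 <= A. Proof. exact: sqr_ge0. Qed.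

Let rate0 : 0 <= Krate mu A.
Proof.
exact: addr_ge0 (ler0n _ 2) (mulr_ge0 (mulr_ge0 (ler0n _ 4) (sqr_ge0 _)) (Klip_ge0 _)).
Qed.

Let q_exp n : t_ n <= T -> q ^+ n <= expR (Krate mu A * T).
Proof.
move=> tT; apply: (@le_trans _ _ (expR (Krate mu A * tau) ^+ n)).
  rewrite lerXn2r ?nnegrE ?expR_ge0 ?expR_ge1Dx//.
  by rewrite addr_ge0// mulr_ge0// ltW.
by rewrite -expRM_natl ler_expR mulrCA ler_wpM2l.
Qed.

(** The difference consists of the local error of the cubic part and the quintic term, whose factor
    is bounded by mu^2 tau^2 / 2; both squares are added. *)
Let first_err (W : I -> R) (l : I -> R[i]) L X : t_ 1 <= T -> (forall k, 0 <= W k) ->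
  (forall k, fc (u (t_ 1)) k = E (- (tau * fr k)) * fc u0 k
     - 'i%C * mu%:C * tau%:C * fc (first_term tau u0) k + E (- (tau * fr k)) * l k) ->
  hb W l L -> hb W (fc (quintic u0)) (Kquintic A) ->
  2 * L + mu ^+ 4 * tau ^+ 4 * `|Kquintic A| <= X -> hb W (err 1) X.
Proof.
move=> tT Wp ul lL qK LX.
have u00 : u (t_ 0) = u0 by rewrite /t_ mul0r; case: sol.
have tT0 : t_ 0 <= T by rewrite /t_ mul0r ltW.
have lu : l2 P u0 by rewrite -u00; exact: u_l2.
have uA : hb W2 (fc u0) A by rewrite -u00; exact: u_W2.
have [_ f1] := first_fourier d3 mu tau lu uA.
have E1 (t : R) : N (E t) <= 1 by rewrite normc_E.
pose z : R[i] := mu%:C ^+ 2 * (tau%:C ^+ 2 / 2).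
have Nz : N z <= mu ^+ 2 * tau ^+ 2 / 2.
  have n2 : N (2 : R[i]) = 2 by rewrite (_ : 2 = 2%:C) ?normc_real ?ger0_norm// rmorph_nat.
  rewrite /z Normc.normcM normcX [N (_ / _)]Normc.normcM normcX !normc_real Normc.normcV n2.
  by rewrite !real_normK ?num_real// mulrA.
have h := hb_opp (hb_add Wp (hb_unimodular Wp (fun k => E1 (- (tau * fr k))) lL)
   (hb_scale Wp Nz (hb_unimodular Wp (fun k => E1 (- (tau * fr k))) qK))).
apply: hb_ext (hb_le h _) => [k|].
  have gen (a w s g y e : R[i]) : a * s - w * g - z * (a * y) - (a * s - w * g + a * e) = - (a * e + z * (a * y)) by ring.
  by rewrite /err [fc (S 1) k](f1 k) ul; exact/esym/gen.
apply: le_trans LX; rewrite mulrDr lerD2l.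
rewrite [leLHS](_ : _ = mu ^+ 4 * tau ^+ 4 * Kquintic A / 2); last by field.
have m0 : 0 <= mu ^+ 4 * tau ^+ 4 by rewrite mulr_ge0// exprn_even_ge0.
have : mu ^+ 4 * tau ^+ 4 * Kquintic A <= mu ^+ 4 * tau ^+ 4 * `|Kquintic A|.
  by apply: ler_wpM2l => //; exact: ler_norm.
have : 0 <= mu ^+ 4 * tau ^+ 4 * `|Kquintic A| by rewrite mulr_ge0.
lra.
Qed.

(** The bootstrap condition: the envelope of the squared H^2 error stays below 1 up to time T, so
    that the Lipschitz constant inside [Krate] remains valid. *)
Hypothesis small : X2 * expR (Krate mu A * T) <= 1.

Let X2_ge0 : 0 <= X2. Proof. exact: mulr_ge0 (KX2_ge0 _ _) (sqr_ge0 _). Qed.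
Let X0_ge0 : 0 <= X0. Proof. by apply: mulr_ge0 (KX0_ge0 _ _) _; exact: exprn_even_ge0. Qed.

(** The H^2 bound feeds the Lipschitz constant of both recursions, so the two errors are propagated
    together. *)
Let good n := [/\ l2 P (S n), hb W2 (err n) (X2 * q ^+ n) & hb W0 (err n) (X0 * q ^+ n)].

Let S_W2 n : t_ n <= T -> good n -> hb W2 (fc (S n)) (2 * (A + 1)).
Proof.
move=> tT [_ h2 _]; rewrite addrC.
have h1 : hb W2 (err n) 1.
  by apply: hb_le h2 (le_trans _ small); apply: ler_wpM2l => //; exact: q_exp.
by apply: hb_ext (hb_add w2 h1 (u_W2 tT)) => k; rewrite /err subrK.
Qed.

Let tau_powR : tau <= tau `^ (d%:R / 4).
Proof.
rewrite -[leLHS]powRr1 ?(ltW t0)//; apply: ger_powR; first by rewrite t0.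
by rewrite ler_pdivrMr ?ltr0n// mul1r (@le_trans _ _ 3%:R) ?ler_nat.
Qed.

Let good0 : good 0.
Proof.
have u00 : u (t_ 0) = u0 by rewrite /t_ mul0r; case: sol.
have tT0 : t_ 0 <= T by rewrite /t_ mul0r ltW.
have e0 k : err 0 k = 0 by rewrite /err u00 subrr.
have z (W : I -> R) X : 0 <= X -> hb W (err 0) X.
  by move=> X_ge0 K uK; rewrite big1// => k _; rewrite e0 Normc.normc0 expr0n mulr0.
split; first by rewrite /S/= -u00; exact: u_l2.
- by apply: z; rewrite expr0 mulr1; exact: X2_ge0.
- by apply: z; rewrite expr0 mulr1; exact: X0_ge0.
Qed.

Let good1 : t_ 1 <= T -> good 1.
Proof.
move=> tT.
have u00 : u (t_ 0) = u0 by rewrite /t_ mul0r; case: sol.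
have tT0 : t_ 0 <= T by rewrite /t_ mul0r ltW.
have lu : l2 P u0 by rewrite -u00; exact: u_l2.
have uA : hb W2 (fc u0) A by rewrite -u00; exact: u_W2.
have [lS _] := first_fourier d3 mu tau lu uA.
have [l [l0 l2] ul] := first_local tT.
have [_ qK] := quintic_hb d3 lu uA.
have q1 : 1 <= q by rewrite lerDl mulr_ge0// ltW.
have m4 : 0 <= mu ^+ 4 * `|Kquintic A| by rewrite mulr_ge0 ?exprn_even_ge0.
have tt : tau ^+ 4 <= tau ^+ 2.
  by rewrite (_ : tau ^+ 4 = tau ^+ 2 * tau ^+ 2) ?ler_piMr ?sqr_ge0 ?expr_le1 ?(ltW t0)//; ring.
have tq : tau ^+ 2 <= (tau `^ (d%:R / 4)) ^+ 2 by rewrite lerXn2r ?nnegrE ?powR_ge0 ?(ltW t0).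
split; [exact: lS| |].
- apply: (@hb_le _ _ _ _ X2); last by rewrite expr1 ler_peMr.
  apply: (first_err tT w2 ul l2 qK).
  rewrite /X2 /KX2; apply: (@first_const _ _ _ _ _ _ _ _ _ _ (le_trans tt tq) tq); [exact: sqr_ge0|exact: exprn_even_ge0..].
- apply: (@hb_le _ _ _ _ X0); last by rewrite expr1 ler_peMr.
  apply: (first_err tT w0 ul l0 (hb_W20 qK)).
  by rewrite /X0 /KX0; apply: (@first_const _ _ _ _ _ _ _ _ _ _ (lexx _) (lexx _)); exact: exprn_even_ge0.
Qed.

Let goodSS n : t_ n.+2 <= T -> good n -> good n.+1 -> good n.+2.
Proof.
move=> tT g0 g1.
have tS m : t_ m <= t_ m.+1 by rewrite /t_ ler_wpM2r ?(ltW t0)// ler_nat.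
have tT1 := le_trans (tS _) tT; have tT0 := le_trans (tS _) tT1.
have [lS0 e02 e00] := g0; have [lS1 e12 e10] := g1.
have S1 := S_W2 tT1 g1; have U1 := u_W2 tT1.
have U1' : hb W2 (fc (u (t_ n.+1))) (2 * (A + 1)) by apply: hb_le U1 _; have := A_ge0; lra.
have [lS2 fS2] := step_fourier d3 mu tau lS0 lS1 S1.
have [l [l0 l2] fu] := step_local tT.
have h0 := step_lip0 d3 tau lS1 (u_l2 tT1) S1 U1' e10.
have h2 := step_lip2 d3 tau lS1 (u_l2 tT1) S1 U1' e12.
have gen (a z b s g v g' x : R[i]) : a * s - z * g - (a * v - z * g' + b * x) = a * (s - v) - (z * (g - g') + b * x) by ring.
have e2 k : err n.+2 k = E (- (2 * tau * fr k)) * err n k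
     - ('i%C * mu%:C * tau%:C * (fc (step_term tau (S n.+1)) k - fc (step_term tau (u (t_ n.+1))) k)
        + E (- (tau * fr k)) * l k).
  rewrite {1}/err [fc (S n.+2) k](fS2 k) fu; exact: gen.
split; [exact: lS2| |].
- apply: (recursion w2 t0 t1 (Klip_ge0 _) X2_ge0 e02 h2 l2 _ e2).
  by rewrite exprMn /X2 /KX2; apply: step_const; [exact: sqr_ge0..|exact: exprn_even_ge0].
- apply: (recursion w0 t0 t1 (Klip_ge0 _) X0_ge0 e00 h0 l0 _ e2).
  have -> : tau ^+ 6 = tau ^+ 2 * tau ^+ 4 by ring.
  by rewrite /X0 /KX0; apply: step_const; [exact: sqr_ge0|exact: exprn_even_ge0..].
Qed.

Lemma global_error n : t_ n <= T ->
  (L2norm (fun x => (u (t_ n) x - S n x)%R) <=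
    (Num.sqrt (KX0 mu A * expR (Krate mu A * T)) * tau ^+ 2)%:E)%E.
Proof.
move=> tT.
have tS m : t_ m <= t_ m.+1 by rewrite /t_ ler_wpM2r ?(ltW t0)// ler_nat.
(* The recursion looks back two steps; the second half is conditional because the next time may
   exceed T. *)
have [g _] : good n /\ (t_ n.+1 <= T -> good n.+1).
  elim: n tT => [|n IH] tT; first by split; [exact: good0|exact: good1].
  have [g0 g1] := IH (le_trans (tS _) tT); split; first exact: g1.
  by move=> tT2; apply: goodSS => //; exact: g1.
have [lS _ e0] := g; have lu := u_l2 tT; have lB := l2B lu lS.
have X0' : 0 <= KX0 mu A * expR (Krate mu A * T) by rewrite mulr_ge0 ?KX0_ge0 ?expR_ge0.
rewrite (L2normE lB) lee_fin.
have -> : Num.sqrt (KX0 mu A * expR (Krate mu A * T)) * tau ^+ 2 =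
  Num.sqrt (KX0 mu A * expR (Krate mu A * T) * tau ^+ 4).
  rewrite [RHS]sqrtrM//; congr (_ * _); rewrite (_ : tau ^+ 4 = (tau ^+ 2) ^+ 2); last by ring.
  by rewrite sqrtr_sqr ger0_norm// sqr_ge0.
rewrite ler_sqrt; last by rewrite mulr_ge0// exprn_even_ge0.
have [//|_] := @l2_of_hb _ _ (fun x => u (t_ n) x - S n x) (X0 * q ^+ n) (l2_cible lB) _.
  apply: hb_ext (hb_opp e0) => k; rewrite /err opprB -fourierB//; exact: l2_cible.
move/le_trans; apply; rewrite /X0 mulrAC; apply: ler_wpM2r; first exact: exprn_even_ge0.
by apply: ler_wpM2l; [exact: KX0_ge0|exact: q_exp].
Qed.

End global.

(** As d >= 1 and tau <= 1, tau^(d/2) is at most sqrt tau, hence at most 1 / (Y + 1); this is where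
    the threshold for tau comes from. *)
Lemma small_step (R : realType) (d : nat) (tau Y : R) : (1 <= d)%N -> 0 < tau -> tau <= 1 -> 0 <= Y ->
  tau <= (Y + 1)^-1 ^+ 2 -> Y * (tau `^ (d%:R / 4)) ^+ 2 <= 1.
Proof.
move=> d1 t0 t1 Y0 tY; have Y1 : 0 < Y + 1 by rewrite ltr_wpDl.
have h : (tau `^ (d%:R / 4)) ^+ 2 <= (Y + 1)^-1.
  apply: (@le_trans _ _ (Num.sqrt tau)).
    rewrite -powR_mulrn ?powR_ge0// -powRrM -powR12_sqrt ?(ltW t0)//.
    apply: ger_powR; first by rewrite t0.
    have : 1 <= d%:R :> R by rewrite ler1n.
    by lra.
  rewrite -[leRHS]ger0_norm ?invr_ge0 ?(ltW Y1)// -sqrtr_sqr ler_sqrt// sqr_ge0//.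
apply: (@le_trans _ _ (Y * (Y + 1)^-1)); first exact: ler_wpM2l.
by rewrite ler_pdivrMr// mul1r lerDl.
Qed.

End Convergence.

Theorem theorem3p14 (R : realType) (d : nat) (mu T : R) :
  (1 <= d <= 3)%N -> mu != 0 -> 0 < T ->
  exists tau0 C : R -> R,
    (forall M : R, 0 < tau0 M /\ 0 < C M) /\
    forall (u0 : torus R d -> R[i]) (Tmax : \bar R)
           (u : R -> torus R d -> R[i]),
      let M := sup_Hnorm (2 + d%:R / 4) T u in
      maximal_nls_solution mu u0 Tmax u ->
      (T%:E < Tmax)%E ->
      (M < +oo)%E ->
      forall (tau : R) (n : nat),
        0 < tau <= tau0 (fine M) -> n%:R <= T / tau ->
        (L2norm (fun x => (u (n%:R * tau) x - sLRI2 mu tau u0 n x)%R)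
           <= (C (fine M) * tau ^+ 2)%:E)%E.
Proof.
move=> /andP[d1 d3] _ T0.
pose e (m : R) := expR (@Convergence.Krate R d mu (m ^+ 2) * T).
pose Y (m : R) := @Convergence.KX2 R d mu (m ^+ 2) * e m.
have Y0 m : 0 <= Y m by rewrite mulr_ge0 ?Convergence.KX2_ge0 ?expR_ge0.
exists (fun m => Num.min 1 ((Y m + 1)^-1 ^+ 2)).
(* The constants are functions of the squared norm, hence [m ^+ 2]; adding 1 makes this one positive
   even if the root vanishes. *)
exists (fun m => Num.sqrt (@Convergence.KX0 R d mu (m ^+ 2) * e m) + 1); split.
  move=> m; split; last by rewrite ltr_wpDl ?sqrtr_ge0.
  by rewrite lt_min ltr01 exprn_gt0// invr_gt0 ltr_wpDl.
move=> u0 Tmax u M [sol _] TT Moo tau n /andP[t0]; rewrite le_min => /andP[t1 tY] nT.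
have tn : n%:R * tau <= T by rewrite -ler_pdivlMr.
have small := Convergence.small_step d1 t0 t1 (Y0 (fine M)) tY.
have small' : @Convergence.KX2 R d mu (fine M ^+ 2) * (tau `^ (d%:R / 4)) ^+ 2 * expR (@Convergence.Krate R d mu (fine M ^+ 2) * T) <= 1.
  by rewrite mulrAC.
apply: le_trans (Convergence.global_error d3 T0 sol TT Moo t0 t1 small' tn) _.
by rewrite lee_fin ler_wpM2r ?sqr_ge0// lerDl.
Qed.
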